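(* Let $d\ge2$, $\alpha>0$ and $i\in\{1,\ldots,d\}$. There is a constant $C$ such that for all $f \in H_1^i(\mathbb{T}^d)$, $$\sup_{\rho >0} \rho\, \lambda(\sigma^\alpha_* f > \rho) \leq C \|f\|_{H_1^i}.$$
   Context: $\mathbb{T}=[-\pi,\pi]$ is the torus and $\lambda$ is Lebesgue measure. For $f\in L_1(\mathbb{T}^d)$, $\widehat f(k)=(2\pi)^{-d}\int_{\mathbb{T}^d} f(x)e^{-\imath k\cdot x}\,dx$, $k\in\mathbb{Z}^d$ ($\imath=\sqrt{-1}$). Fix a real parameter $1\le\gamma<\infty$. The rectangular Riesz means, for $n\in\mathbb{N}^d$ with all $n_i\ge1$, and the unrestricted maximal operator are $$\sigma_n^{\alpha}f(x)=\sum_{|k_1|\le n_1}\cdots\sum_{|k_d|\le n_d}\prod_{i=1}^d\Big(1-\Big(\frac{|k_i|}{n_i}\Big)^\gamma\Big)^\alpha\widehat f(k)e^{\imath k\cdot x},\qquad \sigma_*^\alpha f=\sup_{n\in\mathbb{N}^d,\ n_i\ge1}|\sigma_n^\alpha f|.$$ The hybrid Hardy space $H_1^i(\mathbb{T}^d)$ consists of all functions $f\in L_1(\mathbb{T}^d)$ with $$\|f\|_{H_1^i}:=\Big\|\sup_{t_k>0,\ k=1,\ldots,d,\ k\ne i}|f*(P_{t_1}\otimes\cdots\otimes P_{t_{i-1}}\otimes P_{t_{i+1}}\otimes\cdots\otimes P_{t_d})|\Big\|_{L_1(\mathbb{T}^d)}<\infty,$$ where $P_t(x)=\sum_{k\in\mathbb{Z}}e^{-t|k|}e^{\imath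 kx}$ $(x\in\mathbb{T},\ t>0)$ is the one-dimensional periodic Poisson kernel and the convolution is taken in all variables except the $i$-th one. *)

(* Defs.v *)
From HB Require Import structures.
From mathcomp Require Import all_boot all_order all_algebra.
From mathcomp Require Import all_classical all_reals all_analysis.
From mathcomp Require Import complex.

Set Implicit Arguments.
Unset Strict Implicit.
Unset Printing Implicit Defensive.

Import Order.TTheory GRing.Theory Num.Theory.
Import numFieldNormedType.Exports.

Local Open Scope classical_set_scope.
Local Open Scope ring_scope.

Section LebesgueTuple.
Variable R : realType.
Local Notation T := (measurableTypeR R).

Section Cons.
Variable n : nat.
Variable m : {sigma_finite_measure set (n.-tuple T) -> \bar R}.

Definition tuple_cons (z : T * n.-tuple T) : n.+1.-tuple T :=
  [tuple of z.1 :: z.2].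

Lemma measurable_tuple_cons : measurable_fun [set: T * n.-tuple T] tuple_cons.
Proof. exact: measurable_cons measurable_fst measurable_snd. Qed.

Definition lebesgue_cons : set (n.+1.-tuple T) -> \bar R :=
  pushforward (@lebesgue_measure R \x m)%E tuple_cons.

Let mpre (A : set (n.+1.-tuple T)) :
  measurable A -> measurable (tuple_cons @^-1` A).
Proof.
by move=> mA; rewrite -[X in measurable X]setTI; exact: measurable_tuple_cons.
Qed.

Let lebesgue_cons0 : lebesgue_cons set0 = 0%E.
Proof. by rewrite /lebesgue_cons /pushforward preimage_set0 measure0. Qed.

Let lebesgue_cons_ge0 A : (0 <= lebesgue_cons A)%E.
Proof. exact: integral_ge0. Qed.

Let lebesgue_cons_sigma_additive : semi_sigma_additive lebesgue_cons.
Proof.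
move=> F mF tF mUF; rewrite /lebesgue_cons /pushforward preimage_bigcup.
apply: measure_semi_sigma_additive.
- by move=> k; exact: mpre.
- apply/trivIsetP => /= i j _ _ ij; rewrite -preimage_setI.
  by move/trivIsetP : tF => /(_ _ _ _ _ ij) ->//; rewrite preimage_set0.
- by rewrite -preimage_bigcup; exact: mpre.
Qed.

HB.instance Definition _ := isMeasure.Build _ _ _ lebesgue_cons
  lebesgue_cons0 lebesgue_cons_ge0 lebesgue_cons_sigma_additive.

Let lebesgue_cons_sigma_finite : sigma_finite setT lebesgue_cons.
Proof.
have /sigma_finiteP[F [UF ndF Ffin]] := sigma_finiteT (@lebesgue_measure R).
have /sigma_finiteP[G [UG ndG Gfin]] := sigma_finiteT m.
pose uncons (t : n.+1.-tuple T) : T * n.-tuple T :=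
  (thead t, [tuple of behead t]).
have unconsK : uncons \o tuple_cons = id.
  by apply/funext => -[a s]; congr (_, _); exact: val_inj.
have muncons : measurable_fun setT uncons.
  apply/measurable_fun_pairP; split; last exact: measurable_behead.
  exact: measurable_tnth.
exists (fun k => uncons @^-1` (F k `*` G k)).
  apply/esym/seteqP; split=> // t _.
  have [i _ Fi] : (\bigcup_k F k) (thead t) by rewrite -UF.
  have [j _ Gj] : (\bigcup_k G k) [tuple of behead t] by rewrite -UG.
  exists (maxn i j) => //; split=> /=.
    by move: (thead t) Fi; exact/subsetPset/ndF/leq_maxl.
  by move: [tuple of behead t] Gj; exact/subsetPset/ndG/leq_maxr.
move=> k; have [mF Fk] := Ffin k; have [mG Gk] := Gfin k; split.
  rewrite -[X in measurable X]setTI; apply: muncons => //.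
  exact: measurableX.
rewrite /lebesgue_cons /pushforward -comp_preimage unconsK preimage_id.
by rewrite product_measure1E// lte_mul_pinfty// ge0_fin_numE.
Qed.

HB.instance Definition _ := Measure_isSigmaFinite.Build _ _ _ lebesgue_cons
  lebesgue_cons_sigma_finite.

End Cons.

Fixpoint lebesgue_tuple (n : nat) :
    {sigma_finite_measure set (n.-tuple T) -> \bar R} :=
  if n is n'.+1 then lebesgue_cons (lebesgue_tuple n')
  else \d_ ([tuple] : 0.-tuple T).

Lemma lebesgue_tuple_box n (A : 'I_n -> set T) :
  (forall i, measurable (A i)) ->
  lebesgue_tuple n [set x | forall i, A i (tnth x i)] =
  (\prod_(i < n) lebesgue_measure (A i))%E.
Proof.
elim: n A => [|n IHn] A mA /=.
  rewrite big_ord0 (_ : [set _ | _] = setT) ?diracT//.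
  by apply/seteqP; split=> // x _ [].
rewrite big_ord_recl -IHn => [|i]; last exact: mA.
rewrite /lebesgue_cons /pushforward.
rewrite (_ : _ @^-1` _ =
    A ord0 `*` [set x | forall i, A (lift ord0 i) (tnth x i)]).
  rewrite product_measure1E//.
  rewrite (_ : [set x | _] = \bigcap_(i in [set: 'I_n])
      ((fun x : n.-tuple T => tnth x i) @^-1` A (lift ord0 i))); last first.
    by apply/seteqP; split=> x /= Hx i; [move=> _|]; exact: Hx.
  apply: fin_bigcap_measurable => // i _.
  by rewrite -[X in measurable X]setTI; exact: measurable_tnth.
apply/seteqP; split=> -[a s] /= => [H|[H0 H] i].
  by split=> [|i]; [have := H ord0|have := H (lift ord0 i); rewrite tnthS].
by case: (unliftP ord0 i) => [j ->|->]//; rewrite tnthS.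
Qed.

End LebesgueTuple.

Section HybridHardy.
Variable R : realType.
Local Notation C := (complex R).
Local Notation T := (measurableTypeR R).
Local Notation normc := (@ComplexField.Normc.normc R).

Definition torus (d : nat) : set (d.-tuple T) :=
  [set x | forall j, - pi <= (tnth x j : R) <= pi].
Arguments torus : clear implicits.

Definition cintegral (d : nat) (D : set (d.-tuple T)) (f : d.-tuple T -> C) : C :=
  Complex (\int[lebesgue_tuple R d]_(x in D) complex.Re (f x))
          (\int[lebesgue_tuple R d]_(x in D) complex.Im (f x)).

(* Functions on the torus are total functions on R^d, of which only the values
   on the cube [-pi, pi]^d matter. *)
Definition L1_torus (d : nat) (f : d.-tuple T -> C) : Prop :=
  (lebesgue_tuple R d).-integrable (torus d) (fun x => (complex.Re (f x))%:E) /\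
  (lebesgue_tuple R d).-integrable (torus d) (fun x => (complex.Im (f x))%:E).

Definition cis (theta : R) : C := Complex (cos theta) (sin theta).

Definition dot (d : nat) (k : d.-tuple int) (x : d.-tuple T) : R :=
  \sum_(j < d) (tnth k j)%:~R * (tnth x j : R).

Definition fourier (d : nat) (f : d.-tuple T -> C) (k : d.-tuple int) : C :=
  real_complex R ((2 * pi) ^- d) *
  cintegral (torus d) (fun x => f x * cis (- dot k x)).

Definition riesz_mean (d : nat) (gamma alpha : R) (n : d.-tuple nat)
    (f : d.-tuple T -> C) (x : d.-tuple T) : C :=
  \sum_(k \in [set k : d.-tuple int |
                 forall j, (`|tnth k j| <= tnth n j)%N])
    real_complex R (\prod_(j < d)
      (1 - (`|tnth k j|%N%:R / (tnth n j)%:R) `^ gamma) `^ alpha) *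
    fourier f k * cis (dot k x).

Definition riesz_max (d : nat) (gamma alpha : R)
    (f : d.-tuple T -> C) (x : d.-tuple T) : \bar R :=
  ereal_sup [set (normc (riesz_mean gamma alpha n f x))%:E |
             n in [set n : d.-tuple nat | forall j, (1 <= tnth n j)%N]].

(* The sum over all integers, as the limit of its symmetric partial sums (it
   converges absolutely for t > 0). The alias C^o carries the topology. *)
Definition poisson (t x : R) : C :=
  limn (fun N : nat =>
    \sum_(k \in [set k : int | (`|k| <= N)%N])
      real_complex R (expR (- t * `|k|%N%:R)) * cis (k%:~R * x) : C^o).

(* The point whose i-th coordinate is that of x, and whose other coordinates
   are, in increasing order of index, those of y. *)
Definition glue (d : nat) (i : 'I_d) (x : d.-tuple T) (y : d.-1.-tuple T) :
    d.-tuple T :=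
  [tuple (if unlift i j is Some l then tnth y l else tnth x i) | j < d].

(* Convolutions on the torus are taken with respect to normalized Lebesgue
   measure, as the Fourier coefficients are. The l-th of the d - 1 parameters t
   goes with the coordinate lift i l. *)
Definition poisson_conv (d : nat) (i : 'I_d) (t : 'I_d.-1 -> R)
    (f : d.-tuple T -> C) (x : d.-tuple T) : C :=
  real_complex R ((2 * pi) ^- d.-1) *
  cintegral (torus d.-1) (fun y => f (glue i x y) *
    \prod_(l < d.-1) poisson (t l) ((tnth x (lift i l) : R) - tnth y l)).

Definition hardy_norm (d : nat) (i : 'I_d) (f : d.-tuple T -> C) : \bar R :=
  (\int[lebesgue_tuple R d]_(x in torus d)
    ereal_sup [set (normc (poisson_conv i t f x))%:E |
               t in [set t : 'I_d.-1 -> R | forall l, (0 < t l)%R]])%E.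

Definition hardy (d : nat) (i : 'I_d) (f : d.-tuple T -> C) : Prop :=
  L1_torus f /\ (hardy_norm i f < +oo)%E.

End HybridHardy.
Arguments torus : clear implicits.

(* Main.v *)
From HB Require Import structures.
Require Import Defs.
From mathcomp Require Import all_boot all_order all_algebra.
From mathcomp Require Import all_classical all_reals all_analysis.
From mathcomp Require Import complex measurable_realfun.
From mathcomp Require Import ring lra zify.
Import Order.TTheory GRing.Theory Num.Theory.
Import numFieldNormedType.Exports.
Local Open Scope classical_set_scope.
Local Open Scope ring_scope.
Set Implicit Arguments.
Unset Strict Implicit.
Unset Printing Implicit Defensive.
(* Keeps unification from unfolding the analytic functions. *)
Local Opaque powR expR sin cos pi.

(** Let [n] stand for the [d - 1] parameters other than the [i]-th one, and let
[V (b, y)] be the supremum over [n] of the modulus of the Riesz means, at the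
point [y] of the torus of dimension [d - 1], of the slice of [f] on which the
[i]-th coordinate is [b].

The one-dimensional Riesz kernel with parameter [n] is bounded by
[C n (1 + n |sin (x / 2)|)^(-1 - delta)] with [delta = min (alpha, 1)]
([riesz_kernel_bound]), hence averaging in the [i]-th coordinate is dominated by
the Hardy-Littlewood maximal function in that coordinate alone, uniformly in the
[i]-th parameter: the maximal Riesz mean of [f] at [(s, y)] is at most a
constant times the maximal function of [V (., y)] at [s] ([riesz_conv_le_HL_circle]).
The weak type inequality for fixed [y], integrated over [y], bounds the measure
of the level set of the maximal Riesz mean by [C / rho] times the integral of
[V] ([riesz_weak_type]).

What remains is an inequality on the torus of dimension [m = d - 1]: the integral
of the maximal Riesz mean is at most a constant times that of the
maximal Poisson mean, all parameters varying independently
([riesz_le_poisson_torus]). In dimension one it comes from a pointwise bound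
([riesz_pointwise]): a Riesz mean is a Poisson mean with the same parameter
followed by a convolution with a kernel of the same size, because
[(1 - s^gamma)^alpha e^s] is as good a multiplier as [(1 - s^gamma)^alpha]; and the
Poisson means, through their semigroup law, are controlled by averages of
[U^p] with [p < 1], where [U] is their supremum. So the maximal Riesz mean is at
most a constant times [M (U^p)^(1/p)], and [M] is bounded on [L^(1/p)]
([HL_circle_strong_type]).

This argument is insensitive to taking a further supremum over a family of
functions, with a constant that does not depend on the family
([riesz_le_poisson_circle]). That is what makes the iteration over the coordinates
possible: while one coordinate is treated, the other ones and their
parameters belong to the family ([tensor_le]). Trigonometric
polynomials are enough there, since an integrable function can be smoothed by a
Poisson mean and truncated, and the two errors disappear in the limit by Fatou's
lemma.

The kernels being real, the real and the imaginary part of [f] are treated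
separately. *)

(** * Kernels of cosine multipliers *)

Section CosineKernels.
Variable R : realType.
Implicit Types (lam a psi u v : nat -> R) (x t : R) (n l k : nat).

(** Comparable, on a period, to the distance to the origin; being moreover
subadditive and periodic, it serves as the distance of the circle. *)
Definition sinhalf x : R := `|sin (x / 2)|.

Lemma sinhalf_ge0 x : 0 <= sinhalf x. Proof. exact: normr_ge0. Qed.

Lemma sinhalf_le1 x : sinhalf x <= 1. Proof. exact: sin_max. Qed.

Lemma sinhalfN x : sinhalf (- x) = sinhalf x.
Proof. by rewrite /sinhalf mulNr sinN normrN. Qed.

Lemma sinhalf_triangle x y : sinhalf (x + y) <= sinhalf x + sinhalf y.
Proof.
rewrite /sinhalf mulrDl sinD (le_trans (ler_normD _ _))// !normrM lerD//.
  by rewrite ler_piMr// cos_max.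
by rewrite ler_piMl// cos_max.
Qed.

Definition mult_of_freq (k : nat) : R := if k == 0%N then 1 else 2.

(** The kernel of the multiplier [lam], that is, the sum of
[lam |k| e^(ikx)] over [|k| <= N], in real form. *)
Definition cosker (N : nat) lam x : R :=
  \sum_(k < N.+1) mult_of_freq k * lam k * cos (k%:R * x).

Lemma coskerS N lam x :
  cosker N.+1 lam x = cosker N lam x + 2 * lam N.+1 * cos (N.+1%:R * x).
Proof. by rewrite /cosker big_ord_recr. Qed.

Lemma cosker_norm_le N lam x (B : R) :
  (forall k, (k <= N)%N -> `|lam k| <= B) ->
  `|cosker N lam x| <= 2 * N.+1%:R * B.
Proof.
move=> lamB; rewrite (le_trans (ler_norm_sum _ _ _))//.
have -> : 2 * N.+1%:R * B = \sum_(k < N.+1) (2 * B).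
  by rewrite sumr_const card_ord -mulr_natr; ring.
apply: ler_sum => k _; rewrite !normrM.
have /lamB lk : (k <= N)%N by rewrite -ltnS.
rewrite -[leRHS]mulr1 ler_pM// ?mulr_ge0// ?cos_max// ler_pM//.
by rewrite /mult_of_freq; case: ifP; rewrite ger0_norm// ler1n.
Qed.

(** Summation by parts against the Dirichlet kernels. *)
Lemma sin_cosker N lam x :
  sin (x / 2) * cosker N lam x =
  \sum_(k < N) (lam k - lam k.+1) * sin ((k%:R + 2^-1) * x) +
  lam N * sin ((N%:R + 2^-1) * x).
Proof.
elim: N => [|N IH].
  rewrite /cosker big_ord_recl !big_ord0 /mult_of_freq/= mul0r cos0 addr0 add0r.
  by rewrite add0r [2^-1 * x]mulrC; ring.
rewrite coskerS mulrDr IH big_ord_recr/=.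
have -> : (N.+1%:R + 2^-1) * x = N.+1%:R * x + x / 2 by field.
have -> : (N%:R + 2^-1) * x = N.+1%:R * x - x / 2 by rewrite -natr1; field.
by rewrite !sinD sinN cosN; ring.
Qed.

Lemma sin_sum_sin n x :
  sin (x / 2) * \sum_(k < n) sin ((k%:R + 2^-1) * x) = (1 - cos (n%:R * x)) / 2.
Proof.
elim: n => [|n IH]; first by rewrite big_ord0 mul0r cos0; ring.
rewrite big_ord_recr/= mulrDr IH.
have -> : n%:R * x = (n%:R + 2^-1) * x - x / 2 by field.
have -> : n.+1%:R * x = (n%:R + 2^-1) * x + x / 2 by rewrite -natr1; field.
by rewrite !cosD sinN cosN; field.
Qed.

Lemma sum_by_parts l psi (s : nat -> R) :
  \sum_(k < l.+1) psi k * s k = psi l * (\sum_(j < l.+1) s j) -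
  \sum_(k < l) (psi k.+1 - psi k) * \sum_(j < k.+1) s j.
Proof.
elim: l => [|l IH]; first by rewrite !big_ord_recr !big_ord0/= subr0 !add0r.
rewrite big_ord_recr/= IH [in RHS]big_ord_recr/=.
by rewrite [X in _ = _ - X]big_ord_recr/=; ring.
Qed.

(** Asking for the same bound on the size and on the variation makes the class
stable under products. *)
Definition bounded_variation l (M : R) u :=
  (forall k, (k <= l)%N -> `|u k| <= M) /\ \sum_(k < l) `|u k.+1 - u k| <= M.

Lemma telescope_ord l u : \sum_(k < l) (u k.+1 - u k) = u l - u 0%N.
Proof. by rewrite -(big_mkord xpredT (fun k => u k.+1 - u k)) telescope_sumr. Qed.

Lemma bv_nondecreasing l M u :
  (forall k, (k <= l)%N -> 0 <= u k <= M) ->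
  (forall k, (k < l)%N -> u k <= u k.+1) -> bounded_variation l M u.
Proof.
move=> u0M ndu; split=> [k /u0M/andP[? ?]|]; first by rewrite ger0_norm.
under eq_bigr => k _ do rewrite ger0_norm ?subr_ge0 ?ndu//.
rewrite telescope_ord.
have /andP[? ?] := u0M l (leqnn _); have /andP[? ?] := u0M 0%N (leq0n _); lra.
Qed.

Lemma bv_nonincreasing l M u :
  (forall k, (k <= l)%N -> 0 <= u k <= M) ->
  (forall k, (k < l)%N -> u k.+1 <= u k) -> bounded_variation l M u.
Proof.
move=> u0M ndu; split=> [k /u0M/andP[? ?]|]; first by rewrite ger0_norm.
under eq_bigr => k _ do rewrite distrC ger0_norm ?subr_ge0 ?ndu//.
have -> : \sum_(k < l) (u k - u k.+1) = u 0%N - u l.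
  rewrite -[RHS]opprB -telescope_ord -sumrN.
  by apply: eq_bigr => k _; rewrite opprB.
have /andP[? ?] := u0M l (leqnn _); have /andP[? ?] := u0M 0%N (leq0n _); lra.
Qed.

Lemma bv_ge0 l M u : bounded_variation l M u -> 0 <= M.
Proof. by case=> /(_ 0%N (leq0n _)) + _; exact: le_trans. Qed.

Lemma bvM l M1 M2 u v : bounded_variation l M1 u -> bounded_variation l M2 v ->
  bounded_variation l (2 * M1 * M2) (fun k => u k * v k).
Proof.
move=> bu bv; have M10 := bv_ge0 bu; have M20 := bv_ge0 bv.
move: bu bv => [u1 u2] [v1 v2]; split=> [k kl|].
  rewrite normrM -mulrA; have := ler_pM (normr_ge0 _) (normr_ge0 _) (u1 _ kl) (v1 _ kl).
  have := mulr_ge0 M10 M20; lra.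
have -> : 2 * M1 * M2 = M1 * M2 + M1 * M2 by ring.
apply: (@le_trans _ _ (\sum_(k < l) (`|u k.+1 - u k| * M2 + M1 * `|v k.+1 - v k|))).
  apply: ler_sum => k _.
  have -> : u k.+1 * v k.+1 - u k * v k =
    (u k.+1 - u k) * v k.+1 + u k * (v k.+1 - v k) by ring.
  rewrite (le_trans (ler_normD _ _))// !normrM; apply: lerD.
    by apply: ler_wpM2l => //; exact: v1.
  by apply: ler_wpM2r => //; apply: u1; exact: ltnW.
by rewrite big_split/= -mulr_suml -mulr_sumr lerD// ?ler_wpM2r// ?ler_wpM2l.
Qed.

Lemma bvD l M1 M2 u v : bounded_variation l M1 u -> bounded_variation l M2 v ->
  bounded_variation l (M1 + M2) (fun k => u k + v k).
Proof.
move=> [u1 u2] [v1 v2]; split=> [k kl|].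
  by rewrite (le_trans (ler_normD _ _))// lerD// ?u1 ?v1.
apply: (@le_trans _ _ (\sum_(k < l) (`|u k.+1 - u k| + `|v k.+1 - v k|))).
  by apply: ler_sum => k _; rewrite opprD addrACA ler_normD.
by rewrite big_split/= lerD.
Qed.

Lemma bvZ l M (c : R) u : bounded_variation l M u ->
  bounded_variation l (`|c| * M) (fun k => c * u k).
Proof.
move=> [u1 u2]; split=> [k kl|]; first by rewrite normrM ler_wpM2l ?u1.
under eq_bigr => k _ do rewrite -mulrBr normrM.
by rewrite -mulr_sumr ler_wpM2l.
Qed.

(** Two summations by parts: the first [l.+1] differences are summed once more,
against the Fejer kernels, the remaining ones are estimated in absolute value. *)
Lemma cosker_split N l lam x (M : R) : (l < N)%N -> lam N = 0 ->
  0 < sinhalf x ->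
  bounded_variation l M (fun k => lam k - lam k.+1) ->
  `|cosker N lam x| * sinhalf x <=
  2 * M / sinhalf x + \sum_(l.+1 <= k < N) `|lam k - lam k.+1|.
Proof.
move=> lN lamN x0 [psi1 psi2].
rewrite mulrC -normrM sin_cosker lamN mul0r addr0.
rewrite -(big_mkord xpredT
  (fun k => (lam k - lam k.+1) * sin ((k%:R + 2^-1) * x))).
rewrite (big_cat_nat (n := l.+1))//= (le_trans (ler_normD _ _))//.
apply: lerD; last first.
  rewrite (le_trans (ler_norm_sum _ _ _))//; apply: ler_sum => k _.
  by rewrite normrM ler_piMr// sin_max.
rewrite ler_pdivlMr// big_mkord.
rewrite (sum_by_parts l (fun k => lam k - lam k.+1)
  (fun k => sin ((k%:R + 2^-1) * x))).
rewrite mulrC -normrM mulrBr mulrCA sin_sum_sin.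
have cosB (j : nat) : `|(1 - cos (j%:R * x)) / 2| <= 1.
  have := cos_le1 (j%:R * x); have := cos_geN1 (j%:R * x) => ? ?.
  by rewrite ger0_norm; lra.
rewrite (le_trans (ler_normB _ _))//.
have -> : 2 * M = M + M by ring.
apply: lerD.
  by rewrite normrM (le_trans (ler_piMr _ (cosB _)))// psi1.
apply: le_trans psi2; rewrite mulr_sumr (le_trans (ler_norm_sum _ _ _))//.
by apply: ler_sum => k _; rewrite mulrCA sin_sum_sin normrM ler_piMr.
Qed.

(** The size of a normalised kernel living at scale [1 / n], with a decay that
exceeds integrability by [delta]. *)
Definition kernel_bound (C n delta : R) (K : R -> R) :=
  forall x, `|K x| <= C * n * (1 + n * sinhalf x) `^ (- (1 + delta)).

End CosineKernels.

(** * The Riesz and Poisson kernels *)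

Section RieszKernel.
Variable R : realType.
Implicit Types (g al ka s x : R) (n l k m : nat).

(** The Riesz multiplier multiplied by [e^(ka s)]: for [ka = 0] it produces the
Riesz means themselves, and for [ka = 1] it produces them from the Poisson means
with the same parameter. *)
Definition riesz_profile g al ka s := (1 - s `^ g) `^ al * expR (ka * s).

Definition riesz_profile' g al ka s :=
  - (al * g) * (s `^ (g - 1) * (1 - s `^ g) `^ (al - 1) * expR (ka * s)) +
  ka * ((1 - s `^ g) `^ al * expR (ka * s)).

Lemma one_powR g : 1 `^ g = 1 :> R. Proof. by rewrite powR1. Qed.

Lemma powR_lt1 g s : 0 < g -> 0 <= s < 1 -> s `^ g < 1.
Proof.
by move=> g0 /andP[s0 s1]; rewrite -(one_powR g) gt0_ltr_powR// nnegrE.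
Qed.

Lemma powR_le1 g s : 0 <= g -> 0 <= s <= 1 -> s `^ g <= 1.
Proof.
by move=> g0 /andP[s0 s1]; rewrite -(one_powR g) ge0_ler_powR// nnegrE.
Qed.

Lemma is_derive_riesz_profile g al ka s : 0 < g -> 0 < s < 1 ->
  is_derive s 1 (riesz_profile g al ka) (riesz_profile' g al ka s).
Proof.
move=> g0 /andP[s0 s1].
have sg1 : 0 < 1 - s `^ g by rewrite subr_gt0 powR_lt1// ltW//.
have d1 : is_derive s 1 (fun s => 1 - s `^ g) (- (g * s `^ (g - 1))).
  have := is_derive1_powR g s0 => d.
  have := is_deriveB (is_derive_cst (1 : R) s 1) d; rewrite sub0r; apply.
have d2 : is_derive s 1 (fun s => (1 - s `^ g) `^ al)
   (al * (1 - s `^ g) `^ (al - 1) * (- (g * s `^ (g - 1)))).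
  exact: (@is_derive1_comp R (fun y => y `^ al) _ s _ _ (is_derive1_powR al sg1) d1).
have d3 : is_derive s 1 (fun s => expR (ka * s)) (expR (ka * s) * ka).
  apply: (@is_derive1_comp R expR (fun s => ka * s)).
  apply: is_derive_eq; by rewrite /GRing.scale/= mulr1.
apply: (@is_derive_eq _ _ _ _ _ _ _ _ (is_deriveM d2 d3)).
by rewrite /riesz_profile' /GRing.scale/=; ring.
Qed.

Lemma riesz_profile_MVT g al ka a b : 0 < g -> 0 <= a -> a < b -> b < 1 ->
  exists2 c, a < c < b &
  riesz_profile g al ka b - riesz_profile g al ka a =
  riesz_profile' g al ka c * (b - a).
Proof.
move=> g0 a0 ab b1.
have dp s : 0 < s < 1 -> {for s, continuous (riesz_profile g al ka)}.
  move=> s01; have /derivable1_diffP := @ex_derive _ _ _ _ _ _ _ (is_derive_riesz_profile al ka g0 s01).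
  exact: differentiable_continuous.
have [||c] := @MVT R (riesz_profile g al ka) (riesz_profile' g al ka) a b ab.
- move=> s; rewrite in_itv/= => /andP[? ?].
  by apply: is_derive_riesz_profile => //; lra.
- apply/continuous_within_itvP => //; split.
  + by move=> s; rewrite in_itv/= => /andP[? ?]; apply: dp; lra.
  + move: a0; rewrite le_eqVlt => /predU1P[<-|a0]; last first.
      by apply: cvg_at_right_filter; apply: dp; lra.
    rewrite /riesz_profile; apply: cvgM; last first.
      apply: cvg_at_right_filter; apply: continuous_comp; last exact: continuous_expR.
      exact: mulrl_continuous.
    have : {for (1 - 0 `^ g), continuous (fun y => y `^ al)}.
      rewrite powR0 ?gt_eqF// subr0.
      have /derivable1_diffP := @ex_derive _ _ _ _ _ _ _ (is_derive1_powR al (@ltr01 R)).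
      exact: differentiable_continuous.
    move=> c1; apply: (cvg_comp (fun x => 1 - x `^ g) (fun y => y `^ al) _ c1).
    apply: cvgB; first exact: cvg_cst.
    by rewrite powR0 ?gt_eqF//; exact: powR_cvg0.
  + by apply: cvg_at_left_filter; apply: dp; lra.
by rewrite in_itv/= => c1 c2; exists c.
Qed.

Definition riesz g al ka n k : R :=
  if (k <= n)%N then riesz_profile g al ka (k%:R / n%:R) else 0.

Lemma npowR_le (p x y : R) : p <= 0 -> 0 < x -> x <= y -> y `^ p <= x `^ p.
Proof.
move=> p0 x0 xy; have y0 := lt_le_trans x0 xy.
rewrite -[p]opprK (powRN y) (powRN x) lef_pV2 ?posrE; try exact: powR_gt0.
by rewrite ge0_ler_powR ?nnegrE ?oppr_ge0// ltW.
Qed.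

Lemma bvW l (M M' : R) (u v : nat -> R) : (forall k, (k <= l)%N -> u k = v k) -> M <= M' ->
  bounded_variation l M u -> bounded_variation l M' v.
Proof.
move=> uv MM' [u1 u2]; split=> [k kl|]; first by rewrite -uv// (le_trans (u1 _ kl)).
apply: le_trans MM'; apply: le_trans u2; apply: ler_sum => k _.
by rewrite !uv// ltnW.
Qed.

(** The singular factor of the derivative of the profile, at distance at least
[mu] from the end point: it blows up there only if [al < 1], and is bounded
otherwise. *)
Lemma riesz_weight_le g al mu x : 1 <= g -> 0 < mu <= 1 -> 0 <= x <= 1 - mu ->
  (1 - x `^ g) `^ (al - 1) <= mu `^ (Num.min al 1 - 1).
Proof.
move=> g1 /andP[mu0 mu1] /andP[x0 x1].
have xg0 := powR_ge0 x g.
have xg : x `^ g <= x.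
  move: x0; rewrite le_eqVlt => /predU1P[<-|x0].
    by rewrite powR0// gt_eqF// (lt_le_trans ltr01).
  by rewrite ge1r_powR// x0/=; lra.
have [al1|al1] := leP al 1; last first.
  rewrite subrr powRr0 -[leRHS](one_powR (al - 1)).
  by rewrite ge0_ler_powR ?nnegrE//; lra.
have -> : al - 1 = - (1 - al) by ring.
rewrite !powRN lef_pV2 ?posrE ?powR_gt0//; last lra.
by rewrite ge0_ler_powR ?nnegrE//; lra.
Qed.

(** By the mean value theorem the differences of the multiplier are values of
the derivative of the profile at increasing points, and this derivative is a
combination of products of monotone functions. Thus second differences are
controlled although no second derivative is ever computed. *)
Lemma riesz_bv g al ka n l mu : 1 <= g -> 0 < al -> 0 <= ka <= 1 -> (l.+1 < n)%N ->
  mu = (n - l.+1)%:R / n%:R ->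
  bounded_variation l
    ((4 * al * g + 2) * expR 1 / n%:R * mu `^ (Num.min al 1 - 1))
    (fun k => riesz g al ka n k - riesz g al ka n k.+1).
Proof.
move=> g1 al0 /andP[ka0 ka1] ln mudef.
have g0 : 0 < g by rewrite (lt_le_trans ltr01).
have n0 : 0 < n%:R :> R by rewrite ltr0n; lia.
have muE : mu = 1 - l.+1%:R / n%:R.
  by rewrite mudef natrB ?(ltnW ln)// mulrBl divff ?gt_eqF.
have mu0 : 0 < mu by rewrite mudef divr_gt0// ltr0n; lia.
clear mudef.
have mu1 : mu <= 1 by rewrite muE gerBl divr_ge0.
have e1 : 1 <= expR 1 :> R by rewrite -expR0 ler_expR.
have : forall k, exists c, (k <= l)%N -> (k%:R / n%:R < c < k.+1%:R / n%:R) /\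
    riesz g al ka n k - riesz g al ka n k.+1 = - riesz_profile' g al ka c / n%:R.
  move=> k; have [kl|_] := leqP k l; last by exists 0.
  have kn : (k <= n)%N by rewrite ltnW// ltnW// (leq_trans _ ln).
  have kn' : (k.+1 <= n)%N by rewrite ltnW// (leq_trans _ ln).
  have [||||c cab] := @riesz_profile_MVT g al ka (k%:R / n%:R) (k.+1%:R / n%:R).
  - by [].
  - by rewrite divr_ge0.
  - by rewrite ltr_pM2r ?invr_gt0// ltr_nat.
  - by rewrite ltr_pdivrMr// mul1r ltr_nat (leq_trans _ ln).
  move=> E; exists c => _; split=> //.
  rewrite /riesz kn kn'.
  by rewrite -opprB E -mulrBl -natrB// subSnn div1r mulNr.
move=> /choice[xi xiP].
have xi01 k : (k <= l)%N -> 0 <= xi k <= 1 - mu.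
  move=> kl; have [/andP[h1 h2] _] := xiP k kl.
  rewrite (le_trans _ (ltW h1)) ?divr_ge0//= (le_trans (ltW h2))//.
  by rewrite muE subKr ler_pM2r ?invr_gt0// ler_nat.
have xiS k : (k < l)%N -> xi k <= xi k.+1.
  move=> kl; have [/andP[_ h2] _] := xiP k (ltnW kl).
  by have [/andP[h1 _] _] := xiP k.+1 kl; rewrite ltW// (lt_trans h2).
have xig k : (k <= l)%N -> 0 <= xi k `^ g <= 1.
  by move=> /xi01/andP[? ?]; rewrite powR_ge0/= powR_le1 ?(ltW g0)//; lra.
have xigS k : (k < l)%N -> xi k `^ g <= xi k.+1 `^ g.
  move=> kl; have /andP[? _] := xi01 k (ltnW kl); have /andP[? _] := xi01 k.+1 kl.
  by rewrite ge0_ler_powR ?nnegrE ?xiS// ltW.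
have b1 : bounded_variation l 1 (fun k => xi k `^ (g - 1)).
  apply: bv_nondecreasing => k kl.
    by have := xi01 k kl => ?; rewrite powR_ge0/= powR_le1//; lra.
  have /andP[? _] := xi01 k (ltnW kl); have /andP[? _] := xi01 k.+1 kl.
  by rewrite ge0_ler_powR ?nnegrE ?xiS// subr_ge0.
have b2 : bounded_variation l (mu `^ (Num.min al 1 - 1))
    (fun k => (1 - xi k `^ g) `^ (al - 1)).
  have bd k : (k <= l)%N ->
      0 <= (1 - xi k `^ g) `^ (al - 1) <= mu `^ (Num.min al 1 - 1).
    by move=> kl; rewrite powR_ge0 riesz_weight_le// ?mu0 ?xi01.
  have [al1|al1] := leP al 1.
    apply: bv_nondecreasing => k kl.
      by have := bd k kl; rewrite min_l.
    have P j : (j <= l)%N -> 0 < 1 - xi j `^ g.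
      by move=> jl; have := xi01 j jl => ?; rewrite subr_gt0 powR_lt1//; lra.
    have Pk := P k (ltnW kl); have Pk1 := P k.+1 kl.
    have k1 : 1 - xi k.+1 `^ g <= 1 - xi k `^ g by rewrite lerD2l lerN2; exact: xigS.
    by apply: npowR_le => //; rewrite subr_le0.
  apply: bv_nonincreasing => k kl.
    by have := bd k kl; rewrite (min_r (ltW al1)).
  have /andP[? ?] := xig k (ltnW kl); have /andP[? ?] := xig k.+1 kl.
  by rewrite ge0_ler_powR ?nnegrE; have := xigS k kl; lra.
have b3 : bounded_variation l 1 (fun k => (1 - xi k `^ g) `^ al).
  apply: bv_nonincreasing => k kl.
    by have /andP[? ?] := xig k kl; rewrite powR_ge0/= powR_le1//; lra.
  have /andP[? ?] := xig k (ltnW kl); have /andP[? ?] := xig k.+1 kl.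
  by rewrite ge0_ler_powR ?nnegrE; have := xigS k kl; lra.
have b4 : bounded_variation l (expR 1) (fun k => expR (ka * xi k)).
  apply: bv_nondecreasing => k kl.
    rewrite expR_ge0 ler_expR; have /andP[? ?] := xi01 k kl.
    rewrite -[leRHS]mulr1 ler_pM//; lra.
  by rewrite ler_expR ler_wpM2l// xiS.
have nu1 : 1 <= mu `^ (Num.min al 1 - 1).
  have -> : Num.min al 1 - 1 = - (1 - Num.min al 1) by ring.
  rewrite powRN invf_ge1 ?powR_gt0// powR_le1 ?(ltW mu0)//.
  by rewrite subr_ge0 ge_min lexx orbT.
apply: bvW (bvZ n%:R^-1 (bvD (bvZ (al * g) (bvM (bvM b1 b2) b4)) (bvZ (- ka) (bvM b3 b4)))).
  move=> k kl; have [_ ->] := xiP k kl; rewrite /riesz_profile'; ring.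
rewrite normrN ger0_norm ?invr_ge0 ?ler0n// ger0_norm; last by rewrite mulr_ge0// ltW.
rewrite ger0_norm//.
set nu := mu `^ _ in nu1 *.
have -> : (4 * al * g + 2) * expR 1 / n%:R * nu =
  n%:R^-1 * (al * g * (2 * (2 * 1 * nu) * expR 1) + 2 * 1 * expR 1 * nu) by ring.
rewrite ler_wpM2l ?invr_ge0 ?ler0n// lerD2l.
have h : ka * (2 * 1 * expR 1) <= 2 * 1 * expR 1.
  by rewrite ler_piMl// !mulr_ge0// expR_ge0.
by rewrite (le_trans h)// ler_peMr// !mulr_ge0// expR_ge0.
Qed.

Lemma powR_bernoulli g mu : 1 <= g -> 0 <= mu <= 1 -> 1 - (1 - mu) `^ g <= g * mu.
Proof.
move=> g1 /andP[]; rewrite le_eqVlt => /predU1P[<-|mu0].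
  by rewrite subr0 one_powR subrr mulr0.
rewrite le_eqVlt => /predU1P[->|mu1].
  by rewrite subrr powR0 ?subr0 ?mulr1// gt_eqF// (lt_le_trans ltr01).
have dp s : 0 < s -> {for s, continuous (fun y => y `^ g)}.
  move=> s0; have /derivable1_diffP := @ex_derive _ _ _ _ _ _ _ (is_derive1_powR g s0).
  exact: differentiable_continuous.
have [|||c] := @MVT R (fun y => y `^ g) (fun x => g * x `^ (g - 1)) (1 - mu) 1.
- lra.
- by move=> s; rewrite in_itv/= => /andP[? ?]; apply: is_derive1_powR; lra.
- apply: continuous_in_subspaceT => x; rewrite inE/= in_itv/= => /andP[? ?].
  by apply: dp; lra.
rewrite in_itv/= one_powR => /andP[c0 c1] ->; rewrite subKr.
rewrite ler_wpM2r ?(ltW mu0)// ler_piMr//; first lra.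
by rewrite powR_le1; lra.
Qed.

(** Close to the end point first differences are enough: the multiplier is the
product of a nonincreasing and a nondecreasing sequence, the variations of which
telescope, and the first one is already small there. *)
Lemma riesz_tail g al ka n l mu : 1 <= g -> 0 < al -> 0 <= ka <= 1 -> (l.+1 < n)%N ->
  mu = (n - l.+1)%:R / n%:R ->
  \sum_(l.+1 <= k < n) `|riesz g al ka n k - riesz g al ka n k.+1| <=
  2 * g * expR 1 * mu `^ (Num.min al 1).
Proof.
move=> g1 al0 /andP[ka0 ka1] ln mudef.
have g0 : 0 < g by rewrite (lt_le_trans ltr01).
have n0 : 0 < n%:R :> R by rewrite ltr0n; lia.
have muE : mu = 1 - l.+1%:R / n%:R.
  by rewrite mudef natrB ?(ltnW ln)// mulrBl divff ?gt_eqF.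
have mu0 : 0 < mu by rewrite mudef divr_gt0// ltr0n; lia.
clear mudef.
have mu1 : mu <= 1 by rewrite muE gerBl divr_ge0.
have e1 : 1 <= expR 1 :> R by rewrite -expR0 ler_expR.
pose p k := (1 - (k%:R / n%:R : R) `^ g) `^ al.
pose E k : R := expR (ka * (k%:R / n%:R)).
have kn k : (k <= n)%N -> 0 <= (k%:R / n%:R : R) <= 1.
  by move=> kn; rewrite divr_ge0//= ler_pdivrMr// mul1r ler_nat.
have pS k : (k < n)%N -> p k.+1 <= p k.
  move=> kn'; have /kn/andP[k0 k1] := kn'; have /kn/andP[k2 k3] := ltnW kn'.
  have := powR_ge0 (k%:R / n%:R : R) g; have : (k.+1%:R / n%:R : R) `^ g <= 1.
    by rewrite powR_le1 ?k0// ltW.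
  have : (k%:R / n%:R : R) `^ g <= (k.+1%:R / n%:R) `^ g.
    by rewrite ge0_ler_powR ?nnegrE ?(ltW g0)// ler_pM2r ?invr_gt0// ler_nat.
  by move=> ? ? ?; rewrite ge0_ler_powR ?nnegrE ?(ltW al0)//; lra.
have ES k : E k <= E k.+1.
  by rewrite ler_expR ler_wpM2l// ler_pM2r ?invr_gt0// ler_nat.
have Ee k : (k <= n)%N -> E k <= expR 1.
  by move=> /kn/andP[? ?]; rewrite ler_expR -[leRHS]mulr1 ler_pM.
have E0 k : 0 <= E k by exact: expR_ge0.
have p0 k : 0 <= p k by exact: powR_ge0.
have plmu : p l.+1 <= g * mu `^ Num.min al 1.
  have q : 0 <= 1 - (l.+1%:R / n%:R : R) `^ g <= 1.
    by rewrite subr_ge0 (powR_le1 (ltW g0) (kn _ (ltnW ln)))/= gerBl powR_ge0.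
  have q2 : 1 - (l.+1%:R / n%:R : R) `^ g <= g * mu.
    have -> : l.+1%:R / n%:R = 1 - mu by rewrite muE subKr.
    by rewrite powR_bernoulli// mu1 ltW.
  have m0 : 0 < Num.min al 1 by rewrite lt_min al0 ltr01.
  have m1 : Num.min al 1 <= 1 by rewrite ge_min lexx orbT.
  have m2 : Num.min al 1 <= al by rewrite ge_min lexx.
  rewrite /p; set r := 1 - _ in q q2 *; case/andP: q => q0 q1.
  apply: (@le_trans _ _ (r `^ Num.min al 1)).
    move: q0; rewrite le_eqVlt => /predU1P[<-|q0]; last by rewrite ger_powR// q0.
    by rewrite !powR0 ?gt_eqF.
  apply: (@le_trans _ _ ((g * mu) `^ Num.min al 1)).
    by rewrite ge0_ler_powR ?nnegrE ?(ltW m0)// mulr_ge0// ltW.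
  rewrite powRM ?(ltW g0) ?(ltW mu0)// ler_wpM2r ?powR_ge0//.
  exact: ler1_powR.
have rE k : (k <= n)%N -> riesz g al ka n k = p k * E k by rewrite /riesz => ->.
clearbody p E.
have pl k : (l.+1 <= k <= n)%N -> p k <= p l.+1.
  move=> /andP[lk]; elim: k lk => [|k IH]; first by rewrite ltn0.
  rewrite leq_eqVlt => /predU1P[<- _|lk kn']; first exact: lexx.
  by apply: (le_trans (pS _ kn')); apply: IH => //; exact: ltnW.
apply: (@le_trans _ _ (\sum_(l.+1 <= k < n)
    ((p k - p k.+1) * expR 1 + p l.+1 * (E k.+1 - E k)))).
  apply: ler_sum_nat => k /andP[lk kn'].
  rewrite (rE k (ltnW kn')) (rE k.+1 kn').
  have -> : p k * E k - p k.+1 * E k.+1 =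
    (p k - p k.+1) * E k - p k.+1 * (E k.+1 - E k) by ring.
  rewrite (le_trans (ler_normB _ _))// !normrM (ger0_norm (E0 _)) (ger0_norm (p0 _)).
  rewrite !ger0_norm ?subr_ge0 ?pS// lerD//.
    by rewrite ler_wpM2l ?subr_ge0 ?pS// Ee// ltnW.
  by rewrite ler_wpM2r ?subr_ge0// pl//; lia.
rewrite big_split/= -mulr_suml -mulr_sumr telescope_sumr ?(ltnW ln)//.
have -> : \sum_(l.+1 <= k < n) (p k - p k.+1) = p l.+1 - p n.
  rewrite -[RHS]opprB -telescope_sumr ?(ltnW ln)// -sumrN.
  by apply: eq_bigr => k _; rewrite opprB.
have h1 : (p l.+1 - p n) * expR 1 <= p l.+1 * expR 1.
  by rewrite ler_wpM2r ?expR_ge0// gerBl.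
have h2 : p l.+1 * (E n - E l.+1) <= p l.+1 * expR 1.
  rewrite ler_wpM2l// (le_trans _ (Ee n _))// gerBl//.
have h3 : p l.+1 * expR 1 <= g * mu `^ Num.min al 1 * expR 1.
  by rewrite ler_wpM2r ?expR_ge0.
lra.
Qed.

Lemma powR_decay (D th : R) : 0 <= D <= 1 -> 1 <= th ->
  th `^ (- D) / th <= 4 * (1 + th) `^ (- (1 + D)).
Proof.
move=> /andP[D0 D1] th1; have th0 : 0 < th by lra.
have -> : th `^ (- D) / th = th `^ (- (1 + D)).
  have -> : - (1 + D) = - D + (- 1) by ring.
  by rewrite powRD ?(gt_eqF th0) ?implybT// powR_inv1// ltW.
have h : (2 * th) `^ (- (1 + D)) <= (1 + th) `^ (- (1 + D)).
  by apply: npowR_le; lra.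
rewrite powRM ?(ltW th0)// in h.
have h2 : 4^-1 <= 2 `^ (- (1 + D)) :> R.
  have -> : 4^-1 = 2 `^ (- 2%:R) :> R by rewrite powR_invn// -natrX.
  by rewrite ler_powR; lra.
have := ler_wpM2r (powR_ge0 th (- (1 + D))) h2; lra.
Qed.

Lemma riesz_norm_le g al ka n k : 0 <= g -> 0 <= al -> 0 <= ka <= 1 -> (0 < n)%N ->
  `|riesz g al ka n k| <= expR 1.
Proof.
move=> g0 al0 /andP[ka0 ka1] n0; rewrite /riesz; case: ifP => kn; last first.
  by rewrite normr0 expR_ge0.
have kn01 : 0 <= (k%:R / n%:R : R) <= 1.
  by rewrite divr_ge0//= ler_pdivrMr ?ltr0n// mul1r ler_nat.
have p1 := powR_le1 g0 kn01; have p0 := powR_ge0 (k%:R / n%:R : R) g.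
have q1 : (1 - (k%:R / n%:R : R) `^ g) `^ al <= 1 by apply: powR_le1 => //; lra.
rewrite /riesz_profile ger0_norm ?mulr_ge0 ?powR_ge0 ?expR_ge0//.
rewrite -[leRHS]mul1r ler_pM ?powR_ge0 ?expR_ge0// ler_expR.
case/andP: kn01 => ? ?; rewrite -[leRHS]mulr1; exact: ler_pM.
Qed.

(** Far from the origin, the two terms of [cosker_split] balance when the sum is
split at distance about [1 / sinhalf x] from its last frequency; near the origin
the number of terms gives the bound. *)
Lemma riesz_kernel_bound g al ka : 1 <= g -> 0 < al -> 0 <= ka <= 1 ->
  exists2 C : R, 0 < C & forall n, (0 < n)%N ->
  kernel_bound C n%:R (Num.min al 1) (cosker n (riesz g al ka n)).
Proof.
move=> g1 al0 ka01; set D := Num.min al 1.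
have g0 : 0 < g by rewrite (lt_le_trans ltr01).
have D0 : 0 < D by rewrite lt_min al0 ltr01.
have D1 : D <= 1 by rewrite ge_min lexx orbT.
have e0 : 0 < expR 1 :> R by exact: expR_gt0.
pose C1 := (4 * al * g + 2) * expR 1.
have C10 : 0 < C1 by rewrite mulr_gt0// addr_gt0// !mulr_gt0.
have A0 : 0 < 2 * C1 + 2 * g * expR 1.
  by apply: addr_gt0; apply: mulr_gt0 => //; exact: mulr_gt0.
exists (100 * expR 1 + 8 * (2 * C1 + 2 * g * expR 1)).
  by apply: addr_gt0; exact: mulr_gt0.
move=> n n0 x; have n0' : 0 < n%:R :> R by rewrite ltr0n.
have n1 : 1 <= n%:R :> R by rewrite ler1n.
set S := sinhalf x; set W := _ `^ _.
have S0 : 0 <= S by exact: sinhalf_ge0.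
have S1 : S <= 1 by exact: sinhalf_le1.
have W0 : 0 <= W by exact: powR_ge0.
have [th4|th4] := ltP (n%:R * S) 4.
  have K1 : `|cosker n (riesz g al ka n) x| <= 4 * n%:R * expR 1.
    have := @cosker_norm_le R n (riesz g al ka n) x (expR 1).
    move=> /(_ _)/le_trans; apply.
      by move=> k _; apply: riesz_norm_le => //; exact: ltW.
    by rewrite ler_wpM2r ?(ltW e0)// -natr1; lra.
  have W1 : 25^-1 <= W.
    have -> : 25^-1 = 5 `^ (- 2%:R) :> R by rewrite powR_invn// -natrX.
    apply: (@le_trans _ _ (5 `^ (- (1 + D)))); first by rewrite ler_powR; lra.
    apply: npowR_le; [lra| |lra].
    by rewrite ltr_wpDr// mulr_ge0// ltW.
  apply: (le_trans K1).
  apply: (@le_trans _ _ (100 * expR 1 * n%:R * W)).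
    have := ler_wpM2l (ltW (mulr_gt0 e0 n0')) W1; lra.
  rewrite ler_wpM2r// ler_wpM2r ?(ltW n0')// lerDl.
  by apply: mulr_ge0 => //; exact: ltW.
have Sgt0 : 0 < S.
  by move: S0; rewrite le_eqVlt => /predU1P[S0|//]; rewrite -S0 mulr0 in th4; lra.
(* The number of frequencies left to the second term of the splitting. *)
pose m := (Num.truncn S^-1).+1.
have Sm : S^-1 < m%:R by exact: truncnS_gt.
have mS : m%:R <= 2 / S.
  have Si0 : 0 <= S^-1 by rewrite invr_ge0.
  have /andP[h _] := truncn_itv Si0.
  rewrite /m -natr1 (le_trans (lerD h (lexx 1)))//.
  by have := S1; rewrite -(invf_ge1 Sgt0); lra.
have mn2 : 2 * m%:R <= n%:R :> R.
  rewrite (le_trans (ler_wpM2l _ mS))// mulrA ler_pdivrMr//; lra.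
have mn : (m < n)%N.
  rewrite -(ltr_nat R); have : (0 : R) < m%:R by rewrite ltr0n.
  lra.
pose l := (n - m.+1)%N.
have lm : l.+1 = (n - m)%N by rewrite /l subnSK.
have ln : (l.+1 < n)%N by rewrite lm ltn_subrL n0.
pose mu : R := (n - l.+1)%:R / n%:R.
have muE : mu = m%:R / n%:R by rewrite /mu lm subKn// ltnW.
have mu0 : 0 < mu by rewrite muE divr_gt0// ltr0n.
have := riesz_bv g1 al0 ka01 ln (erefl mu).
rewrite -/C1 -/D; set M := _ * mu `^ _ => bvM.
have tail := riesz_tail g1 al0 ka01 ln (erefl mu).
have rn0 : riesz g al ka n n = 0.
  rewrite /riesz leqnn /riesz_profile divff ?gt_eqF// one_powR subrr powR0 ?mul0r//.
  by rewrite gt_eqF.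
have := cosker_split (ltnW ln) rn0 Sgt0 bvM.
rewrite -/S -/D in tail * => KS.
have thmu : (n%:R * S)^-1 <= mu.
  rewrite muE invfM mulrC ler_wpM2r ?invr_ge0 ?(ltW n0')//; exact: ltW.
have muth : mu <= 2 / (n%:R * S).
  have -> : 2 / (n%:R * S) = 2 / S / n%:R by rewrite invfM; ring.
  by rewrite muE ler_wpM2r// invr_ge0 ltW.
have th0 : 0 < n%:R * S by exact: mulr_gt0.
have h1 : 2 * M / S <= 2 * C1 * mu `^ D.
  rewrite -(mulr_powRB1 (ltW mu0) D0) /M.
  have -> : 2 * (C1 / n%:R * mu `^ (D - 1)) / S =
    2 * C1 * ((n%:R * S)^-1 * mu `^ (D - 1)) by rewrite invfM; ring.
  rewrite ler_wpM2l ?ler_wpM2r ?powR_ge0// mulr_ge0// ltW//.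
have h2 : mu `^ D <= 2 * (n%:R * S) `^ (- D).
  apply: (@le_trans _ _ ((2 / (n%:R * S)) `^ D)).
    by rewrite ge0_ler_powR ?nnegrE ?(ltW D0) ?(ltW mu0)// divr_ge0// ltW.
  rewrite [leLHS]powRM ?invr_ge0 ?(ltW th0)//.
  rewrite -(powR_inv1 (ltW th0)) -powRrM mulN1r.
  by rewrite ler_wpM2r ?powR_ge0// ler1_powR// ler1n.
have h3 : (n%:R * S) `^ (- D) / (n%:R * S) <= 4 * W.
  by apply: powR_decay; [rewrite (ltW D0)|lra].
have h4 : `|cosker n (riesz g al ka n) x| * S <=
    (2 * C1 + 2 * g * expR 1) * (2 * (n%:R * S) `^ (- D)).
  apply: le_trans (ler_wpM2l (ltW A0) h2); lra.
rewrite -ler_pdivlMr// in h4; apply: (le_trans h4).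
have -> : (2 * C1 + 2 * g * expR 1) * (2 * (n%:R * S) `^ (- D)) / S =
  2 * (2 * C1 + 2 * g * expR 1) * n%:R * ((n%:R * S) `^ (- D) / (n%:R * S)).
  by rewrite invfM; field; rewrite !gt_eqF.
apply: (@le_trans _ _ (2 * (2 * C1 + 2 * g * expR 1) * n%:R * (4 * W))).
  rewrite ler_wpM2l// mulr_ge0 ?(ltW n0')// mulr_ge0//; exact: ltW.
have -> : 2 * (2 * C1 + 2 * g * expR 1) * n%:R * (4 * W) =
  8 * (2 * C1 + 2 * g * expR 1) * n%:R * W by ring.
rewrite ler_wpM2r// ler_wpM2r ?(ltW n0')// lerDr.
by apply: mulr_ge0 => //; exact: ltW.
Qed.

Definition poisson_seq n k : R := expR (- (k%:R / n%:R)).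

Lemma poisson_seq_ge0 n k : 0 <= poisson_seq n k.
Proof. exact: expR_ge0. Qed.

Lemma poisson_seqX n k : poisson_seq n k = expR (- n%:R^-1) ^+ k.
Proof. by rewrite /poisson_seq -mulrN expRM_natl. Qed.

(** The coefficients form a convex sequence, but for the jump where it is
truncated; that jump is at most [e^(- n)] as soon as [N >= n^2]. *)
Lemma poisson_kernel_bound n N : (0 < n)%N -> (n * n <= N)%N ->
  kernel_bound 16 n%:R 1 (cosker N (poisson_seq n)).
Proof.
move=> n0 nN x; have n0' : 0 < n%:R :> R by rewrite ltr0n.
have n1 : 1 <= n%:R :> R by rewrite ler1n.
set S := sinhalf x; set W := _ `^ _.
have S0 : 0 <= S by exact: sinhalf_ge0.
have S1 : S <= 1 by exact: sinhalf_le1.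
have W0 : 0 <= W by exact: powR_ge0.
pose q : R := expR (- n%:R^-1).
have q0 : 0 < q by exact: expR_gt0.
have q1 : 1 - q <= n%:R^-1 by have := expR_ge1Dx (- n%:R^-1 : R); rewrite -/q; lra.
have q2 : n.+1%:R^-1 <= 1 - q.
  have : q <= n%:R / n.+1%:R.
    rewrite /q expRN -[leRHS]invrK lef_pV2 ?posrE ?expR_gt0//; last first.
      by rewrite invr_gt0 divr_gt0// ltr0n.
    rewrite invfM invrK mulrC -natr1 mulrDl divff ?gt_eqF// mul1r.
    exact: expR_ge1Dx.
  have -> : n%:R / n.+1%:R = 1 - n.+1%:R^-1 :> R.
    by rewrite -natr1; field; rewrite natr1 pnatr_eq0.
  by rewrite lerBrDl => h; rewrite lerBrDr.
have pX k : poisson_seq n k = q ^+ k by exact: poisson_seqX.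
have [th1|th1] := ltP (n%:R * S) 1.
  have K1 : `|cosker N (poisson_seq n) x| <= 4 * n%:R.
    apply: (@le_trans _ _ (2 * n.+1%:R)); last by rewrite -natr1; lra.
    rewrite (le_trans (ler_norm_sum _ _ _))//.
    apply: (@le_trans _ _ (2 * \sum_(k < N.+1) q ^+ k)).
      rewrite mulr_sumr; apply: ler_sum => k _; rewrite !normrM.
      rewrite -[leRHS]mulr1 ler_pM ?mulr_ge0 ?cos_max// pX.
      rewrite (ger0_norm (exprn_ge0 _ (ltW q0))) ler_wpM2r ?exprn_ge0 ?(ltW q0)//.
      by rewrite /mult_of_freq; case: ifP => _; rewrite ger0_norm// ler1n.
    rewrite ler_pM2l//.
    have := subrX1 q N.+1; have := exprn_ge0 N.+1 (ltW q0).
    set Q := q ^+ _; set s := \sum_(_ < _) _ => Q0 E.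
    have s0 : 0 <= s by apply: sumr_ge0 => k _; exact: exprn_ge0 (ltW q0).
    have : s / n.+1%:R <= s * (1 - q) by rewrite ler_wpM2l.
    have -> : s * (1 - q) = 1 - Q by rewrite -[RHS]opprB E; ring.
    by rewrite ler_pdivrMr ?ltr0n// => h; apply: (le_trans h); rewrite ler_piMl//; lra.
  have W1 : 4^-1 <= W.
    have -> : 4^-1 = 2 `^ (- (1 + 1)) :> R.
      by rewrite -[1 + 1]/(2%:R) powR_invn// -natrX.
    apply: npowR_le; [lra| |lra].
    by rewrite ltr_wpDr// mulr_ge0// ltW.
  apply: (le_trans K1); have := ler_wpM2l (ltW n0') W1; lra.
have Sgt0 : 0 < S.
  by move: S0; rewrite le_eqVlt => /predU1P[S0|//]; rewrite -S0 mulr0 in th1; lra.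
have th0 : 0 < n%:R * S by exact: mulr_gt0.
have N0 : (0 < N)%N by apply: leq_trans nN; rewrite muln_gt0 n0.
pose a k := if (k <= N)%N then poisson_seq n k else 0.
have -> : cosker N (poisson_seq n) x = cosker N.+1 a x.
  rewrite coskerS {2}/a ltnn mulr0 mul0r addr0.
  by apply: eq_bigr => k _; rewrite /a -ltnS ltn_ord.
have bva : bounded_variation N.-1 n%:R^-1 (fun k => a k - a k.+1).
  have aE k : (k <= N.-1)%N -> a k - a k.+1 = q ^+ k * (1 - q).
    move=> kN; have kN1 : (k < N)%N by rewrite -(prednK N0).
    by rewrite /a kN1 (ltnW kN1) !pX exprS; ring.
  have q1' : 0 <= 1 - q by apply: le_trans q2; rewrite invr_ge0.
  have qX k : 0 <= q ^+ k <= 1 by rewrite exprn_ge0 ?exprn_ile1 ?(ltW q0)//; lra.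
  apply: bv_nonincreasing => k kN.
    rewrite aE//; have /andP[h1 h2] := qX k; rewrite mulr_ge0//=.
    by apply: le_trans q1; rewrite ler_piMl.
  rewrite aE// aE ?(ltnW kN)// ler_wpM2r// exprS ler_piMl ?exprn_ge0 ?(ltW q0)//; lra.
have aS : a N.+1 = 0 by rewrite /a ltnn.
have aN : a N = poisson_seq n N by rewrite /a leqnn.
have lN : (N.-1 < N.+1)%N by rewrite prednK.
have := cosker_split lN aS Sgt0 bva.
rewrite prednK// big_nat1 aS aN subr0 -/S => KS.
have h1 : `|poisson_seq n N| <= (n%:R * S)^-1.
  rewrite ger0_norm ?poisson_seq_ge0// /poisson_seq expRN lef_pV2 ?posrE ?expR_gt0//.
  apply: (@le_trans _ _ n%:R); first by rewrite ler_piMr// ltW.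
  apply: (@le_trans _ _ (N%:R / n%:R)); first by rewrite ler_pdivlMr// -natrM ler_nat.
  have := expR_ge1Dx (N%:R / n%:R : R); lra.
have h2 : 2 * n%:R^-1 / S = 2 * (n%:R * S)^-1 by rewrite invfM; ring.
have h3 : `|cosker N.+1 a x| * S <= 3 * (n%:R * S)^-1 by lra.
rewrite -ler_pdivlMr// in h3; apply: (le_trans h3).
have := @powR_decay 1 (n%:R * S); rewrite powR_inv1 ?(ltW th0)// -/W.
move=> /(_ _ th1); rewrite ler01 lexx => /(_ isT) h4.
have -> : 3 / (n%:R * S) / S = 3 * n%:R * ((n%:R * S)^-1 / (n%:R * S)).
  by rewrite invfM; field; rewrite !gt_eqF.
apply: (@le_trans _ _ (3 * n%:R * (4 * W))).
  by rewrite ler_wpM2l// mulr_ge0// ltW.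
have := mulr_ge0 (ltW n0') W0; lra.
Qed.

Lemma riesz_factor g al n k : riesz g al 0 n k = riesz g al 1 n k * poisson_seq n k.
Proof.
rewrite /riesz; case: ifP => _; last by rewrite mul0r.
by rewrite /riesz_profile /poisson_seq mul0r expR0 mulr1 mul1r -mulrA -expRD subrr expR0 mulr1.
Qed.

(** The semigroup law. *)
Lemma poisson_seq_double n k : (0 < n)%N ->
  poisson_seq n k = poisson_seq n.*2 k * poisson_seq n.*2 k.
Proof.
move=> n0; rewrite /poisson_seq -expRD; congr expR.
by rewrite -muln2 natrM; field; rewrite pnatr_eq0 -lt0n.
Qed.

End RieszKernel.

(** * The maximal function of the circle *)

Section CircleMaximal.
Variable R : realType.
Local Notation mu := (@lebesgue_measure R).

Implicit Types delta n v y th : R.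

Definition circle : set R := `[- pi, pi]%classic.

Lemma measurable_circle : measurable circle.
Proof. exact: measurable_itv. Qed.

Lemma circle_measure : mu circle = (2 * pi)%:E.
Proof.
rewrite /circle lebesgue_measure_itv/= lte_fin gtrN ?pi_gt0//.
by rewrite -EFinD; congr EFin; ring.
Qed.

Lemma lebesgue_measure_shift (a : R) (A : set R) : measurable A ->
  mu [set x | A (x + a)] = mu A.
Proof.
move=> mA.
have mf : measurable_fun [set: measurableTypeR R]
  (fun x : measurableTypeR R => (x + a : measurableTypeR R)).
  by apply: measurable_realfun.measurable_funD.
pose mf_mixin := isMeasurableFun.Build _ _ _ _ _ mf.
pose m : {mfun measurableTypeR R >-> measurableTypeR R} :=
  HB.pack (fun x : measurableTypeR R => (x + a : measurableTypeR R)) mf_mixin.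
apply/esym; apply: (lebesgue_measure_unique (mu := pushforward mu m)) => //.
move=> _ [[b c]] _ <-.
transitivity (mu `]b - a, c - a]%classic); last first.
  congr (mu _).
  by apply/seteqP; split=> x /=; rewrite !in_itv/= ltrBlDr lerBrDr.
rewrite !lebesgue_measure_itv/= !lte_fin ltrD2r.
by case: ifP => // _; rewrite -!EFinD; congr EFin; ring.
Qed.

(** Halving the angle first leaves only angles up to [pi / 4], on which the cosine
is at least [cos (pi / 4)]. *)
Lemma sin_ge_half (v : R) : 0 <= v <= pi / 2 -> v / 2 <= sin v.
Proof.
move=> /andP[v0 v1].
have c2 : cos (pi / 4) ^+ 2 = 2^-1 :> R.
  have := cos_mulr2n (pi / 4 : R).
  have -> : (pi / 4) *+ 2 = pi / 2 :> R by rewrite -mulr_natr; field.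
  by rewrite cos_pihalf; lra.
have p0 := @pi_gt0 R.
have c0 : 0 < cos (pi / 4) :> R by apply: cos_gt0_pihalf; lra.
have vv : v = (v / 2) *+ 2 by rewrite -mulr_natr; field.
rewrite {2}vv sin_mulr2n.
have cc (w : R) : 0 <= w <= pi / 4 -> cos (pi / 4) <= cos w.
  move=> /andP[? ?]; rewrite leNgt; apply/negP => h.
  have : (pi / 4 : R) < w by rewrite -ltr_cos// in_itv/=; lra.
  lra.
have ss : v / 2 * cos (pi / 4) <= sin (v / 2).
  move: v0; rewrite le_eqVlt => /predU1P[<-|v0]; first by rewrite !mul0r sin0.
  have v2 : 0 < v / 2 by lra.
  have [|c] := @MVT R sin cos 0 (v / 2) v2.
    by apply: continuous_subspaceT; exact: continuous_sin.
  rewrite in_itv/= sin0 !subr0 => /andP[? ?] ->.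
  rewrite mulrC ler_wpM2r//; [lra|apply: cc; lra].
have ge : v / 2 * cos (pi / 4) * cos (pi / 4) <= cos (v / 2) * sin (v / 2).
  rewrite [leRHS]mulrC ler_pM//; first by rewrite mulr_ge0//; lra.
    exact: ltW.
  by apply: cc; lra.
have ge2 : v / 2 / 2 <= cos (v / 2) * sin (v / 2).
  by move: ge; rewrite -mulrA -expr2 c2.
by move: ge2; set P := _ * sin _; rewrite -mulr_natr => ?; lra.
Qed.

Lemma sinhalf_ge (th : R) : `|th| <= pi -> `|th| / 4 <= sinhalf th.
Proof.
move=> thpi.
have -> : sinhalf th = sinhalf `|th|.
  by case: (ger0P th) => // _; rewrite sinhalfN.
rewrite /sinhalf; apply: le_trans (ler_norm _).
have -> : `|th| / 4 = `|th| / 2 / 2 by field.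
apply: sin_ge_half; rewrite divr_ge0//; lra.
Qed.

Lemma sinhalf_periodic (th : R) : sinhalf (th + 2 * pi) = sinhalf th.
Proof.
rewrite /sinhalf; have -> : (th + 2 * pi) / 2 = th / 2 + pi by field.
by rewrite sinDpi normrN.
Qed.

Definition decay (delta n y : R) := n * (1 + n * sinhalf y) `^ (- (1 + delta)).

Lemma decay_ge0 delta n y : 0 <= n -> 0 <= decay delta n y.
Proof. by move=> n0; rewrite mulr_ge0// powR_ge0. Qed.

(** The analogue of [decay] for the distance of the line, which is at most
[4 * sinhalf] on the circle. *)
Definition line_decay (delta n y : R) := n * (1 + n * (`|y| / 4)) `^ (- (1 + delta)).

Lemma line_decay_ge0 delta n y : 0 <= n -> 0 <= line_decay delta n y.
Proof. by move=> n0; rewrite mulr_ge0// powR_ge0. Qed.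

(** A difference of two points of the circle is within [pi] of one of three
consecutive multiples of the period. *)
Lemma decay_le_line_decay delta (n th : R) : 0 <= delta -> 0 <= n -> `|th| <= 2 * pi ->
  decay delta n th <= line_decay delta n (th - 2 * pi) + line_decay delta n th +
                      line_decay delta n (th + 2 * pi).
Proof.
move=> d0 n0 th2; have p0 := @pi_gt0 R.
have K (y : R) : `|y| <= pi -> sinhalf y = sinhalf th ->
    decay delta n th <= line_decay delta n y.
  move=> ypi E; rewrite /decay /line_decay -E ler_wpM2l// npowR_le//; first lra.
    by rewrite ltr_wpDr// mulr_ge0// divr_ge0.
  by rewrite lerD2l ler_wpM2l// sinhalf_ge.
have b0 y := line_decay_ge0 delta y n0.
have [h|h] := leP `|th| pi.
  have := K th h erefl; have := b0 (th - 2 * pi); have := b0 (th + 2 * pi); lra.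
have [h2|h2] := leP 0 th.
  rewrite ger0_norm// in h th2.
  have E : sinhalf (th - 2 * pi) = sinhalf th.
    by rewrite -[LHS]sinhalf_periodic subrK.
  have := K (th - 2 * pi); rewrite ler_norml => /(_ _ E).
  have := b0 th; have := b0 (th + 2 * pi) => ? ? /(_ _) h3.
  suff : decay delta n th <= line_decay delta n (th - 2 * pi) by lra.
  by apply: h3; lra.
rewrite ltr0_norm// in h th2.
have h3 := K (th + 2 * pi) _ (sinhalf_periodic th).
have := b0 th; have := b0 (th - 2 * pi) => ? ?.
suff : decay delta n th <= line_decay delta n (th + 2 * pi) by lra.
by apply: h3; rewrite ler_norml; lra.
Qed.

(** A radially decreasing kernel is a superposition of normalised indicators of
intervals whose radii grow geometrically. *)
Lemma line_decay_le_sum delta (n v : R) (J : nat) : 0 < delta <= 1 -> 0 < n ->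
  n * `|v| < 4 * 2 ^+ J ->
  line_decay delta n v <= \sum_(j < J.+1) 16 * (2 `^ (- delta)) ^+ j *
    ((4 * 2 ^+ j / n)^-1 * (`|v| < 4 * 2 ^+ j / n)%R%:R).
Proof.
move=> /andP[d0 d1] n0 vJ.
have F0 (j : nat) : 0 <= 16 * (2 `^ (- delta)) ^+ j *
    ((4 * 2 ^+ j / n)^-1 * (`|v| < 4 * 2 ^+ j / n)%R%:R).
  by rewrite !mulr_ge0// ?exprn_ge0 ?powR_ge0// invr_ge0 divr_ge0 ?(ltW n0).
have exJ : exists j, n * `|v| < 4 * 2 ^+ j by exists J.
have [j jlt jmin] : exists2 j, n * `|v| < 4 * 2 ^+ j &
    forall k, n * `|v| < 4 * 2 ^+ k -> (j <= k)%N.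
  by exists (ex_minn exJ); case: ex_minnP.
have jJ : (j < J.+1)%N by rewrite ltnS jmin.
rewrite (bigD1 (Ordinal jJ))//= ler_wpDr ?sumr_ge0//.
have -> : `|v| < 4 * 2 ^+ j / n by rewrite ltr_pdivlMr// mulrC.
rewrite mulr1 invf_div.
have P2 k : 0 < 2 ^+ k :> R by rewrite exprn_gt0.
have base : 1 <= 1 + n * (`|v| / 4).
  by rewrite lerDl mulr_ge0 ?(ltW n0)// divr_ge0.
case: (posnP j) => [j0|jpos].
  rewrite j0 !expr0 /line_decay.
  have : (1 + n * (`|v| / 4)) `^ (- (1 + delta)) <= 1.
    rewrite -[leRHS](one_powR (- (1 + delta))).
    by apply: npowR_le => //; lra.
  move=> /(ler_wpM2l (ltW n0)); lra.
have jm : 4 * 2 ^+ j.-1 <= n * `|v|.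
  by rewrite leNgt; apply/negP => /jmin; rewrite -ltnS prednK// ltnn.
have E : 2 ^+ j = 2 * 2 ^+ j.-1 :> R by rewrite -exprS prednK.
have h : (1 + n * (`|v| / 4)) `^ (- (1 + delta)) <= (2 ^+ j.-1) `^ (- (1 + delta)).
  by apply: npowR_le => //; [lra|have := P2 j.-1; lra].
rewrite /line_decay; apply: (le_trans (ler_wpM2l (ltW n0) h)).
have -> : (2 ^+ j.-1 : R) `^ (- (1 + delta)) =
    2 `^ (1 + delta) * (2 `^ (- delta)) ^+ j * (2 ^+ j)^-1.
  have -> : 2 ^+ j.-1 = 2 ^+ j / 2 :> R by rewrite E; field.
  rewrite powRM ?invr_ge0 ?(ltW (P2 _))// -powR_inv1//.
  rewrite -(powRrM 2 (-1)) mulN1r opprK mulrC -mulrA; congr (_ * _).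
  rewrite -!powR_mulrn ?powR_ge0//.
  rewrite -!powRrM -powRN -powRD ?implybT//; last by rewrite pnatr_eq0 implybT.
  by congr (_ `^ _); ring.
have h2 : 2 `^ (1 + delta) <= 4 :> R.
  have -> : 4 = 2 `^ 2%:R :> R by rewrite powR_mulrn// -natrX.
  by rewrite ler_powR; lra.
have -> : 16 * (2 `^ (- delta)) ^+ j * (n / (4 * 2 ^+ j)) =
   n * (4 * (2 `^ (- delta)) ^+ j * (2 ^+ j)^-1).
  by field; rewrite gt_eqF.
rewrite ler_wpM2l ?(ltW n0)// ler_wpM2r ?invr_ge0 ?(ltW (P2 _))//.
by rewrite ler_wpM2r// exprn_ge0// powR_ge0.
Qed.

Local Notation HL := (@HL_maximal R).

Lemma ball_indicE (G : R -> R) y (r : R) : (forall w, 0 <= G w) ->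
  (\int[mu]_(w in circle) (G w * (`|y - w| < r)%R%:R)%:E =
   \int[mu]_(w in ball y r) `|((G \_ circle) w)%:E|)%E.
Proof.
move=> G0; rewrite integral_mkcond [RHS]integral_mkcond.
apply: eq_integral => w _; rewrite !patchE.
have -> : (w \in (ball y r : set R)) = (`|y - w| < r).
  by rewrite -ball_normE; apply/idP/idP; rewrite inE.
case: ifPn => wc; case: ifPn => wb //=; rewrite ?mulr1 ?mulr0 ?normr0//.
by rewrite ger0_norm.
Qed.

Lemma iavg_le_HL (f : R -> R) y (r : R) : 0 < r ->
  (\int[mu]_(w in ball y r) `|(f w)%:E| <= (2 * r)%:E * HL f y)%E.
Proof.
move=> r0.
have -> : (\int[mu]_(w in ball y r) `|(f w)%:E| = (2 * r)%:E * iavg f (ball y r))%E.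
  rewrite /iavg lebesgue_measure_ball ?(ltW r0)// mulr_natl muleA.
  rewrite inver gt_eqF ?mulrn_wgt0// -EFinM divff ?mul1e//.
  by rewrite gt_eqF ?mulrn_wgt0.
rewrite lee_pmul2l ?lte_fin ?mulr_gt0//.
by apply: ereal_sup_ubound => /=; exists r => //; rewrite in_itv/= andbT.
Qed.

Lemma HL_ge0 (f : R -> R) y : (0 <= HL f y)%E.
Proof.
apply: le_trans (ereal_sup_ubound _); last by exists 1 => //=; rewrite in_itv/= andbT.
exact: iavg_ge0.
Qed.

Lemma continuous_sinhalf : continuous (@sinhalf R).
Proof.
move=> x; apply: (@continuous_comp _ _ _ (fun x : R => sin (x / 2)) Num.norm).
  apply: (@continuous_comp _ _ _ (fun x : R => x / 2) sin).
    exact: mulrr_continuous.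
  exact: continuous_sin.
exact: norm_continuous.
Qed.

Lemma measurable_line_decay delta n y (D : set R) :
  measurable_fun D (fun w => line_decay delta n (y - w)).
Proof.
apply: (@measurable_funS _ _ _ _ setT) => //.
apply: measurable_funM => //.
apply: (@measurableT_comp _ _ _ _ _ _ (fun x : R => x `^ (- (1 + delta)))).
  exact: measurable_powR.
apply: measurable_funD => //; apply: measurable_funM => //.
apply: measurable_funM => //; apply: measurableT_comp => //.
exact: measurable_funB.
Qed.

(** Each of the intervals of [line_decay_le_sum] contributes an average, and the
weights form a geometric series. *)
Lemma line_decay_HL delta : 0 < delta <= 1 -> exists2 A : R, 0 < A &
  forall (G : R -> R) n y, measurable_fun circle G -> (forall w, 0 <= G w) ->
  0 < n ->
  (\int[mu]_(w in circle) (G w * line_decay delta n (y - w))%:E <=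
   A%:E * HL (G \_ circle) y)%E.
Proof.
move=> d01; have /andP[d0 d1] := d01.
set q : R := 2 `^ (- delta).
have q0 : 0 < q by exact: powR_gt0.
have q1 : q < 1.
  rewrite /q powRN invf_lt1 ?powR_gt0// -[ltLHS](one_powR delta).
  by rewrite gt0_ltr_powR ?nnegrE//; lra.
exists (32 / (1 - q)); first by rewrite divr_gt0// subr_gt0.
move=> G n y mG G0 n0.
pose J := Num.truncn (n * (`|y| + pi)).
have JP w : circle w -> n * `|y - w| < 4 * 2 ^+ J.
  rewrite /circle/= in_itv/= => wpi.
  have h1 : `|y - w| <= `|y| + pi.
    rewrite (le_trans (ler_normB _ _))// lerD2l ler_norml//.
  apply: (le_lt_trans (ler_wpM2l (ltW n0) h1)).
  apply: (lt_le_trans (truncnS_gt _)).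
  rewrite -/J; apply: (@le_trans _ _ (2 ^+ J)).
    by rewrite -natrX ler_nat ltn_expl.
  by rewrite ler_peMl ?exprn_ge0// ler1n.
pose r (j : nat) := 4 * 2 ^+ j / n.
have r0 j : 0 < r j by rewrite divr_gt0// mulr_gt0// exprn_gt0.
pose c (j : nat) := 16 * q ^+ j * (r j)^-1.
have c0 j : 0 <= c j.
  by rewrite !mulr_ge0// ?invr_ge0 ?(ltW (r0 _))// exprn_ge0// ltW.
have mball j : measurable_fun circle (fun w => (`|y - w| < r j)%R%:R : R).
  rewrite (_ : (fun w => _) = \1_(ball y (r j))); last first.
    apply/funext => w; rewrite indicE -ball_normE; congr ((nat_of_bool _)%:R).
    by apply/idP/idP; rewrite inE.
  by apply: measurable_indic; exact: measurable_ball.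
have mterm j : measurable_fun circle (fun w => G w * (`|y - w| < r j)%R%:R).
  by apply: measurable_funM => //; exact: mball.
have mcterm j : measurable_fun circle
    (fun w => (c j * (G w * (`|y - w| < r j)%R%:R))%:E).
  by apply/measurable_EFinP; apply: measurable_funM => //; exact: mterm.
apply: (@le_trans _ _ (\sum_(j < J.+1)
    \int[mu]_(w in circle) (c j * (G w * (`|y - w| < r j)%R%:R))%:E)%E).
  rewrite -ge0_integral_sum//.
  - apply: ge0_le_integral => //.
    + exact: measurable_circle.
    + by move=> w _; rewrite lee_fin mulr_ge0// line_decay_ge0// ltW.
    + by apply/measurable_EFinP/measurable_funM => //; exact: measurable_line_decay.
    + by apply: emeasurable_sum => j; exact: mcterm.
    + move=> w cw; rewrite sumEFin lee_fin.
      have := ler_wpM2l (G0 w) (line_decay_le_sum d01 n0 (JP w cw)).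
      move=> /le_trans; apply; rewrite mulr_sumr.
      by apply: ler_sum => j _; rewrite /c /r le_eqVlt; apply/orP; left; apply/eqP; ring.
  - exact: measurable_circle.
  - by move=> j; exact: mcterm.
  - move=> j w _; rewrite lee_fin; apply: mulr_ge0; first exact: c0.
    exact: mulr_ge0.
apply: (@le_trans _ _ (\sum_(j < J.+1) (32 * q ^+ j)%:E * HL (G \_ circle) y)%E).
  apply: lee_sum => j _.
  under eq_integral do rewrite EFinM.
  rewrite ge0_integralZl_EFin//.
  - rewrite ball_indicE//.
    apply: (@le_trans _ _ ((c j)%:E * ((2 * r j)%:E * HL (G \_ circle) y))%E).
      by rewrite lee_wpmul2l ?lee_fin// iavg_le_HL.
    rewrite muleA -EFinM /c; have -> : 16 * q ^+ j / r j * (2 * r j) = 32 * q ^+ j.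
      by field; rewrite gt_eqF.
    by [].
  - exact: measurable_circle.
  - by move=> w _; rewrite lee_fin mulr_ge0.
  - by apply/measurable_EFinP; exact: mterm.
rewrite -ge0_sume_distrl; last first.
  by move=> j _; rewrite lee_fin mulr_ge0// exprn_ge0// ltW.
rewrite lee_wpmul2r ?HL_ge0// sumEFin lee_fin -mulr_sumr.
have := subrX1 q J.+1; set s := \sum_(_ < _) _ => E.
rewrite ler_wpM2l// -[leRHS]mul1r ler_pdivlMr ?subr_gt0//.
have -> : s * (1 - q) = 1 - q ^+ J.+1 by rewrite -[RHS]opprB E; ring.
by rewrite gerBl exprn_ge0// ltW.
Qed.

(** Periodicity is replaced by the two neighbouring translates: they account for
the points that are close on the circle but not on the line. *)
Definition HL_circle (G : R -> R) (x : R) : \bar R :=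
  (HL (G \_ circle) (x - 2 * pi) + HL (G \_ circle) x +
   HL (G \_ circle) (x + 2 * pi))%E.

Lemma HL_circle_ge0 G x : (0 <= HL_circle G x)%E.
Proof. by rewrite !adde_ge0// HL_ge0. Qed.

Lemma decay_integral_le_HL_circle delta : 0 < delta <= 1 -> exists2 A : R, 0 < A &
  forall (G : R -> R) n x, measurable_fun circle G -> (forall w, 0 <= G w) ->
  0 < n -> circle x ->
  (\int[mu]_(w in circle) (G w * decay delta n (x - w))%:E <= A%:E * HL_circle G x)%E.
Proof.
move=> d01; have [A A0 AP] := line_decay_HL d01; exists A => // G n x mG G0 n0 cx.
have mb (y : R) : measurable_fun circle (fun w => (G w * line_decay delta n (y - w))%:E).
  by apply/measurable_EFinP; apply: measurable_funM => //; exact: measurable_line_decay.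
have b0 (y : R) w : circle w -> (0 <= (G w * line_decay delta n (y - w))%:E)%E.
  by move=> _; rewrite lee_fin mulr_ge0// line_decay_ge0// ltW.
have d0 w : circle w -> (0 <= (G w * decay delta n (x - w))%:E)%E.
  by move=> _; rewrite lee_fin mulr_ge0// decay_ge0// ltW.
have md : measurable_fun circle (fun w => (G w * decay delta n (x - w))%:E).
  apply/measurable_EFinP; apply: measurable_funM => //.
  apply: measurable_funM => //.
  apply: (@measurableT_comp _ _ _ _ _ _ (fun x : R => x `^ (- (1 + delta)))).
    exact: measurable_powR.
  apply: measurable_funD => //; apply: measurable_funM => //.
  apply: (@measurableT_comp _ _ _ _ _ _ (@sinhalf R)).
    exact: continuous_measurable_fun continuous_sinhalf.
  exact: measurable_funB.
apply: (@le_trans _ _ (\int[mu]_(w in circle)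
   ((G w * line_decay delta n (x - 2 * pi - w))%:E + (G w * line_decay delta n (x - w))%:E +
    (G w * line_decay delta n (x + 2 * pi - w))%:E))%E).
  apply: ge0_le_integral => //.
  - exact: measurable_circle.
  - by apply: emeasurable_funD; [apply: emeasurable_funD|]; exact: mb.
  - move=> w cw; rewrite -!EFinD lee_fin -mulrDr -mulrDr ler_wpM2l//.
    rewrite (addrAC x (- (2 * pi))) (addrAC x (2 * pi)).
    move: d01 => /andP[/ltW h _]; apply: decay_le_line_decay => //; first exact: ltW.
    move: cx cw; rewrite /circle/= !in_itv/= => ? ?.
    by rewrite ler_norml; lra.
rewrite ge0_integralD; first last.
  - exact: mb.
  - exact: b0.
  - by apply: emeasurable_funD; exact: mb.
  - by move=> w cw; apply: adde_ge0; exact: b0.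
  - exact: measurable_circle.
rewrite ge0_integralD; [|exact: measurable_circle|exact: b0|exact: mb|exact: b0|exact: mb].
rewrite /HL_circle !ge0_muleDr ?adde_ge0 ?HL_ge0//.
by apply: leeD; [apply: leeD|]; exact: AP.
Qed.

Lemma locally_integrable_circle (G : R -> R) :
  mu.-integrable circle (EFin \o G) -> locally_integrable setT (G \_ circle).
Proof. by apply: integrable_locally_restrict; exact: measurable_circle. Qed.

Lemma measurable_shift (a : R) :
  measurable_fun [set: R] (fun x : R => x + a).
Proof. exact: measurable_funD. Qed.

Lemma measurable_HL_circle (G : R -> R) (D : set R) :
  mu.-integrable circle (EFin \o G) -> measurable_fun D (HL_circle G).
Proof.
move=> iG; apply: (@measurable_funS _ _ _ _ setT) => //.
have mH : measurable_fun setT (HL (G \_ circle)).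
  by apply: measurable_HL_maximal; exact: locally_integrable_circle.
have mHs (a : R) : measurable_fun [set: R] (fun x : R => HL (G \_ circle) (x + a)).
  by apply: (measurableT_comp mH); exact: measurable_shift.
apply: emeasurable_funD; last exact: mHs.
by apply: emeasurable_funD; [exact: mHs|exact: mH].
Qed.

(** The constant is the product of the [3] of the maximal inequality on the line,
of the [3] that comes from requiring one of the three terms to exceed [rho / 3],
and of the number [3] of translates. *)
Lemma HL_circle_weak_type (G : R -> R) (rho : R) :
  mu.-integrable circle (EFin \o G) -> (forall w, 0 <= G w) -> 0 < rho ->
  (mu (circle `&` [set x | rho%:E < HL_circle G x]) <=
   (27 / rho)%:E * \int[mu]_(w in circle) (G w)%:E)%E.
Proof.
move=> iG G0 rho0; set f := G \_ circle.
have lf : locally_integrable setT f by exact: locally_integrable_circle.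
have mH : measurable_fun setT (HL f) by exact: measurable_HL_maximal.
pose E := [set x | ((rho / 3)%:E < HL f x)%E].
have mE : measurable E.
  by rewrite -[E]setTI; apply: emeasurable_fun_o_infty.
have mEs (a : R) : measurable [set x | E (x + a)].
  rewrite -[X in measurable X]setTI; apply: (measurable_shift a) => //.
have muE : (mu E <= (9 / rho)%:E * \int[mu]_(w in circle) (G w)%:E)%E.
  have r3 : 0 < rho / 3 by rewrite divr_gt0.
  have := maximal_inequality lf r3.
  have -> : 3 / (rho / 3) = 9 / rho by field; rewrite gt_eqF.
  move=> /le_trans; apply; rewrite lee_pmul2l ?lte_fin ?divr_gt0//.
  rewrite [leRHS]integral_mkcond le_eqVlt; apply/orP; left; apply/eqP.
  apply: eq_integral => w _; rewrite /f !patchE.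
  by case: ifPn => _ /=; rewrite ?normr0// ger0_norm.
apply: (@le_trans _ _ (mu ([set x | E (x + - (2 * pi))] `|` E `|` [set x | E (x + 2 * pi)]))).
  apply: le_measure; rewrite ?inE.
  - apply: measurableI; first exact: measurable_circle.
    rewrite -[X in measurable X]setTI; apply: emeasurable_fun_o_infty => //.
    exact: measurable_HL_circle.
  - apply: measurableU; last exact: mEs.
    by apply: measurableU; [exact: mEs|exact: mE].
  - move=> x [_ /= Hx]; apply: contrapT => /not_orP[/not_orP[/negP h1 /negP h2] /negP h3].
    rewrite -leNgt in h1; rewrite -leNgt in h2; rewrite -leNgt in h3.
    have := leeD (leeD h1 h2) h3; rewrite -/(HL_circle G x) -!EFinD leNgt => /negP; apply.
    by rewrite (_ : rho / 3 + rho / 3 + rho / 3 = rho)//; field.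
have -> : ((27 / rho)%:E * \int[mu]_(w in circle) (G w)%:E =
    (9 / rho)%:E * \int[mu]_(w in circle) (G w)%:E +
    (9 / rho)%:E * \int[mu]_(w in circle) (G w)%:E +
    (9 / rho)%:E * \int[mu]_(w in circle) (G w)%:E)%E.
  have I0 : (0 <= \int[mu]_(w in circle) (G w)%:E)%E.
    by apply: integral_ge0 => w _; rewrite lee_fin.
  rewrite -!ge0_muleDl ?lee_fin ?addr_ge0 ?divr_ge0 ?(ltW rho0)//.
  by congr (_ * _)%E; rewrite -!EFinD; congr EFin; field; rewrite gt_eqF.
have mEs1 := mEs (- (2 * pi)); have mEs2 := mEs (2 * pi).
have mEs1E : measurable ([set x | E (x + - (2 * pi))] `|` E).
  by apply: measurableU; [exact: mEs1|exact: mE].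
have := measureU2 mu mEs1E mEs2; move=> /le_trans; apply; apply: leeD; last first.
  by apply: le_trans muE; rewrite le_eqVlt; apply/orP; left; apply/eqP; exact: lebesgue_measure_shift.
have := measureU2 mu mEs1 mE; move=> /le_trans; apply; apply: leeD; last exact: muE.
by apply: le_trans muE; rewrite le_eqVlt; apply/orP; left; apply/eqP; exact: lebesgue_measure_shift.
Qed.

Implicit Types lambda : R.

(** The truncation used for interpolation: the part of [G] that it removes raises
the maximal function by a multiple of [lambda] only. *)
Definition above (lambda : R) (G : R -> R) (w : R) : R := G w * (lambda < G w)%R%:R.

Lemma above_ge0 lambda G : (forall w, 0 <= G w) -> forall w, 0 <= above lambda G w.
Proof. by move=> G0 w; rewrite mulr_ge0. Qed.

Lemma measurable_above lambda G (D : set R) : measurable D -> measurable_fun D G ->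
  measurable_fun D (above lambda G).
Proof.
move=> mD mG; rewrite /above; apply: measurable_funM => //.
rewrite (_ : (fun w => _) = (fun w => if lambda < G w then 1 else 0)); last first.
  by apply/funext => w; case: ifP.
apply: measurable_fun_if => //.
by apply: measurable_fun_ltr.
Qed.

Lemma HL_above_le (G : R -> R) lambda y : measurable_fun circle G ->
  (forall w, 0 <= G w) -> 0 < lambda ->
  (HL (G \_ circle) y <= HL (above lambda G \_ circle) y + lambda%:E)%E.
Proof.
move=> mG G0 l0; apply: ge_ereal_sup => z /= [r].
rewrite in_itv/= andbT => r0 <-{z}.
have mrest (F : R -> R) : measurable_fun circle F ->
    measurable_fun (ball y r : set R) (fun w => `|((F \_ circle) w)%:E|%E).
  move=> mF; apply: measurableT_comp => //; apply/measurable_EFinP.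
  apply: (@measurable_funS _ _ _ _ setT) => //.
  by apply/(measurable_restrictT F measurable_circle).
have m1 := mrest _ mG.
have m2 := mrest _ (measurable_above lambda measurable_circle mG).
have mb : measurable (ball y r : set R) by exact: measurable_ball.
have h : (\int[mu]_(w in ball y r) `|((G \_ circle) w)%:E| <=
   \int[mu]_(w in ball y r) `|((above lambda G \_ circle) w)%:E| +
   lambda%:E * mu (ball y r))%E.
  rewrite -integral_cst// -ge0_integralD//; last by move=> w _; rewrite lee_fin ltW.
  apply: ge0_le_integral => //.
    exact: emeasurable_funD.
  move=> w _; rewrite -EFinD lee_fin !patchE; case: ifPn => _; last first.
    by rewrite !normr0 add0r ltW.
  rewrite !ger0_norm ?above_ge0//; rewrite /above.
  by case: ltP => hl; rewrite ?mulr1 ?mulr0 ?add0r// lerDl ltW.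
apply: le_trans (lee_wpmul2l _ h) _; first by rewrite inve_ge0 lebesgue_measure_ball ?lee_fin ?mulrn_wge0 ?ltW.
rewrite muleDr//; last first.
  - by rewrite ge0_adde_def// inE ?integral_ge0// mule_ge0// lee_fin ltW.
  - by rewrite lebesgue_measure_ball ?(ltW r0)// inver gt_eqF ?mulrn_wgt0.
apply: leeD.
  by apply: ereal_sup_ubound => /=; exists r => //; rewrite in_itv/= andbT.
rewrite lebesgue_measure_ball ?(ltW r0)// inver gt_eqF ?mulrn_wgt0// -!EFinM.
by rewrite lee_fin mulrCA mulVf ?mulr1// gt_eqF// mulrn_wgt0.
Qed.

Lemma HL_circle_above_le (G : R -> R) lambda x : measurable_fun circle G ->
  (forall w, 0 <= G w) -> 0 < lambda ->
  (HL_circle G x <= HL_circle (above lambda G) x + (3 * lambda)%:E)%E.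
Proof.
move=> mG G0 l0; have H y := HL_above_le y mG G0 l0.
have := leeD (leeD (H (x - 2 * pi)) (H x)) (H (x + 2 * pi)).
move=> /le_trans; apply; rewrite /HL_circle.
rewrite (_ : 3 * lambda = lambda + lambda + lambda); last by ring.
rewrite !EFinD; set a := HL _ _; set b := HL _ _; set c := HL _ _; set l := lambda%:E.
by rewrite [in leLHS](addeACA a l b l) (addeACA (a + b) (l + l) c l)%E.
Qed.

Lemma HL_circle_bounded (G : R -> R) (D : R) x : measurable_fun circle G ->
  (forall w, 0 <= G w <= D) -> 0 < D -> (HL_circle G x <= (3 * D)%:E)%E.
Proof.
move=> mG GD D0; have G0 w : 0 <= G w by have /andP[] := GD w.
apply: le_trans (HL_circle_above_le x mG G0 D0) _.
suff -> : HL_circle (above D G) x = 0%E by rewrite add0e.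
have -> : above D G = cst 0.
  apply/funext => w; rewrite /above ltNge; have /andP[_ ->] := GD w.
  by rewrite mulr0.
have HL0 y : HL (cst 0 \_ circle) y = 0%E.
  apply/eqP; rewrite eq_le HL_ge0 andbT; apply: ge_ereal_sup => z /= [r _ <-{z}].
  rewrite /iavg integral0_eq ?mule0// => w _; rewrite patchE; case: ifP => _.
    by rewrite /= normr0.
  by rewrite /= normr0.
by rewrite /HL_circle !HL0 !adde0.
Qed.

(** Dyadic substitute for the integral of [e t^(e - 1)] over [t < g]. *)
Lemma sum_geometric_below (c e g : R) (J : nat) : 0 < c -> 0 < e -> 0 <= g ->
  \sum_(j < J) (c * 2 ^+ j) `^ e * (c * 2 ^+ j < g)%R%:R <=
  (1 - 2 `^ (- e))^-1 * g `^ e.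
Proof.
move=> c0 e0 g0; set t : R := 2 `^ (- e); set k := (1 - t)^-1.
have t0 : 0 < t by exact: powR_gt0.
have t1 : t < 1.
  rewrite /t powRN invf_lt1 ?powR_gt0// -[ltLHS](one_powR e).
  by rewrite gt0_ltr_powR ?nnegrE//; lra.
have k1 : 0 < k by rewrite invr_gt0 subr_gt0.
have kt : k * t + 1 = k by rewrite /k; field; rewrite subr_eq0 gt_eqF.
pose a (j : nat) := (c * 2 ^+ j) `^ e.
have aS j : a j = t * a j.+1.
  have c2 : 0 <= c * 2 ^+ j by rewrite mulr_ge0 ?exprn_ge0 ?(ltW c0).
  rewrite /a /t exprS (mulrCA c) (powRM e _ c2)// powRN mulrA mulVf ?mul1r//.
have a0 j : 0 <= a j by exact: powR_ge0.
have sa I : \sum_(j < I.+1) a j <= k * a I.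
  elim: I => [|I IH].
    by rewrite big_ord_recr big_ord0/= add0r ler_peMl// -kt lerDr mulr_ge0// ltW.
  rewrite big_ord_recr/=; apply: (le_trans (lerD IH (lexx _))).
  by rewrite aS mulrA -[X in _ + X]mul1r -mulrDl kt.
elim: J => [|J IH]; first by rewrite big_ord0 mulr_ge0 ?powR_ge0// ltW.
have [h|h] := ltP (c * 2 ^+ J) g; last first.
  by rewrite big_ord_recr/= (le_gtF h) mulr0 addr0.
apply: (@le_trans _ _ (\sum_(j < J.+1) a j)).
  by apply: ler_sum => j _; rewrite ler_piMr ?powR_ge0//; case: (_ < _).
apply: (le_trans (sa J)); rewrite ler_wpM2l ?(ltW k1)//.
rewrite ge0_ler_powR ?nnegrE ?(ltW e0) ?(ltW h)// mulr_ge0 ?exprn_ge0 ?ltW//.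
Qed.

(** Dyadic substitute for the layer cake formula: the levels [c 2^j] exhaust the
values up to [c 2^J], those below [c] being left to the first term. *)
Lemma powR_le_layers (c q v : R) (J : nat) : 0 < c -> 0 <= q -> 0 <= v ->
  v <= c * 2 ^+ J ->
  v `^ q <= c `^ q + \sum_(j < J) (c * 2 ^+ j.+1) `^ q * (c * 2 ^+ j < v)%R%:R.
Proof.
move=> c0 q0 v0; have c1 j : 0 <= c * 2 ^+ j by rewrite mulr_ge0 ?exprn_ge0 ?ltW.
elim: J => [|J IH] vJ.
  rewrite expr0 mulr1 in vJ.
  by rewrite big_ord0 addr0 ge0_ler_powR ?nnegrE ?(ltW c0).
rewrite big_ord_recr/=; have [h|h] := ltP (c * 2 ^+ J) v; last first.
  by rewrite mulr0 addr0 IH.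
rewrite mulr1 addrA ler_wpDl//.
  by rewrite addr_ge0 ?powR_ge0// sumr_ge0// => j _; rewrite mulr_ge0 ?powR_ge0.
by rewrite ge0_ler_powR ?nnegrE.
Qed.

Lemma integral_circle_cst (r : R) :
  (\int[mu]_(x in circle) r%:E = (2 * pi * r)%:E)%E.
Proof.
rewrite integral_cst; last exact: measurable_circle.
transitivity (r%:E * (2 * pi)%:E)%E; last by rewrite -EFinM mulrC.
congr (_ * _)%E; exact: circle_measure.
Qed.

(** Interpolation between the weak type inequality and the bound
[HL_circle_bounded]: the level set at height [l] is estimated by the weak type
inequality for the part of [G] above [l], and the resulting integrals are summed
over dyadic levels. The function [v] is scaled so that the other part of [G]
cannot reach the level by itself. The size [D] of [G] does not enter the constant;
it only ensures that finitely many levels suffice. *)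
Lemma HL_circle_strong_type (q : R) : 1 < q -> exists2 C : R, 0 < C &
  forall (G : R -> R) (D : R), measurable_fun circle G ->
  (forall w, 0 <= G w <= D) ->
  (\int[mu]_(x in circle) ((fine (HL_circle G x)) `^ q)%:E <=
   C%:E * \int[mu]_(x in circle) ((G x) `^ q)%:E)%E.
Proof.
move=> q1; have q0 : 0 < q by lra.
set k : R := (1 - 2 `^ (- (q - 1)))^-1.
have k0 : 0 < k.
  rewrite invr_gt0 subr_gt0 powRN invf_lt1 ?powR_gt0// -[ltLHS](one_powR (q - 1)).
  by rewrite gt0_ltr_powR ?nnegrE//; lra.
have q20 : 0 < 2 `^ q :> R by exact: powR_gt0.
pose K := 9 * 2 `^ q * k.
have K0 : 0 < K by rewrite !mulr_gt0.
exists (6 `^ q * K); first by rewrite mulr_gt0// powR_gt0.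
move=> G D' mG GD'; pose D := Num.max D' 1.
have D0 : 0 < D by rewrite lt_max ltr01 orbT.
have GD w : 0 <= G w <= D.
  by have /andP[-> h] := GD' w; rewrite le_max h.
have G0 w : 0 <= G w by have /andP[] := GD w.
have mc := measurable_circle.
have cfin : (mu circle < +oo)%E by rewrite circle_measure ltry.
have iG : mu.-integrable circle (EFin \o G).
  apply: measurable_bounded_integrable => //; exists D; split; first exact: num_real.
  move=> x Dx w _ /=; have /andP[? h] := GD w.
  by rewrite ger0_norm// (le_trans h)// ltW.
have iGa l : mu.-integrable circle (EFin \o above l G).
  apply: measurable_bounded_integrable => //; first exact: measurable_above.
  exists D; split; first exact: num_real.
  move=> x Dx w _ /=; have /andP[? h] := GD w.
  rewrite ger0_norm ?above_ge0// (le_trans _ (ltW Dx))// (le_trans _ h)//.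
  by rewrite /above ler_piMr//; case: (_ < _).
pose v x := fine (HL_circle G x) / 6.
have HE x : HL_circle G x = (fine (HL_circle G x))%:E.
  rewrite fineK// ge0_fin_numE ?HL_circle_ge0//.
  by rewrite (le_lt_trans (HL_circle_bounded x mG GD D0))// ltry.
have v0 x : 0 <= v x by rewrite divr_ge0// fine_ge0// HL_circle_ge0.
have vD x : v x <= D.
  have := HL_circle_bounded x mG GD D0; rewrite HE lee_fin /v => h; lra.
have mv : measurable_fun circle v.
  apply: measurable_funM => //.
  by apply: (measurableT_comp (@fine_measurable R setT measurableT)); exact: measurable_HL_circle.
have mvl l : measurable (circle `&` [set x | l < v x]).
  have /measurable_EFinP mve := mv.
  exact: (emeasurable_fun_o_infty mc mve l%:E).
have weak (l : R) : 0 < l -> (mu (circle `&` [set x | (l < v x)%R]) <=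
    (9 / l)%:E * \int[mu]_(x in circle) (above l G x)%:E)%E.
  move=> l0; have l3 : 0 < 3 * l by rewrite mulr_gt0.
  have := HL_circle_weak_type (iGa l) (above_ge0 l G0) l3.
  have -> : 27 / (3 * l) = 9 / l by field; rewrite gt_eqF.
  apply: le_trans; apply: le_measure; rewrite ?inE; [exact: mvl| |].
    apply: emeasurable_fun_o_infty => //; exact: measurable_HL_circle.
  move=> x [cx /= lv]; split => //=.
  have := HL_circle_above_le x mG G0 l0; rewrite HE.
  have : (6 * l < fine (HL_circle G x)) by move: lv; rewrite /v; lra.
  case: (HL_circle (above l G) x) => [z| |]; rewrite -?EFinD ?lee_fin ?lte_fin ?ltry//.
  by move=> ? ?; lra.
have mGq (F : R -> R) : measurable_fun circle F ->
    measurable_fun circle (fun x => (F x) `^ q).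
  move=> mF; apply: (@measurableT_comp _ _ _ _ _ _ (fun x : R => x `^ q)) => //.
(* The lowest level [c] is arbitrary, and tends to [0] at the end. *)
have mainc (c : R) : 0 < c -> (\int[mu]_(x in circle) ((v x) `^ q)%:E <=
    (2 * pi * c `^ q)%:E + K%:E * \int[mu]_(x in circle) ((G x) `^ q)%:E)%E.
  move=> c0; pose J := Num.truncn (D / c).
  have DJ : D <= c * 2 ^+ J.
    rewrite mulrC -ler_pdivrMr// (le_trans (ltW (truncnS_gt _)))//.
    by rewrite -/J -natrX ler_nat ltn_expl.
  pose a (j : nat) := c * 2 ^+ j.
  have a0 j : 0 < a j by rewrite mulr_gt0// exprn_gt0.
  have mind j : measurable_fun circle (fun x => (a j < v x)%R%:R : R).
    rewrite (_ : (fun x => _) = (fun x => if a j < v x then 1 else 0)); last first.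
      by apply/funext => w; case: ifP.
    by apply: measurable_fun_if => //; exact: measurable_fun_ltr.
  have mt j : measurable_fun circle
      (fun x => ((a j.+1) `^ q * (a j < v x)%R%:R)%:E).
    by apply/measurable_EFinP; apply: measurable_funM => //; exact: mind.
  apply: (@le_trans _ _ (\int[mu]_(x in circle) ((c `^ q)%:E +
      \sum_(j < J) ((a j.+1) `^ q * (a j < v x)%R%:R)%:E))%E).
    apply: ge0_le_integral => //.
    - by move=> x _; rewrite lee_fin powR_ge0.
    - by apply/measurable_EFinP; exact: mGq.
    - apply: emeasurable_funD => //; apply: emeasurable_sum => j; exact: mt.
    - move=> x _; rewrite sumEFin -EFinD lee_fin.
      by apply: powR_le_layers => //; [exact: ltW|exact: le_trans (vD x) DJ].
  have t0 j x : (0 <= ((a j.+1) `^ q * (a j < v x)%R%:R)%:E)%E.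
    by rewrite lee_fin mulr_ge0// powR_ge0.
  rewrite ge0_integralD//; first last.
  - by apply: emeasurable_sum => j; exact: mt.
  - by move=> x _; rewrite sume_ge0.
  - by move=> x _; rewrite lee_fin powR_ge0.
  rewrite integral_circle_cst; apply: leeD => //.
  rewrite ge0_integral_sum; [|exact: mc|by move=> j; exact: mt|by move=> j x _; exact: t0].
  apply: (@le_trans _ _ (\sum_(j < J) (9 * 2 `^ q)%:E *
      \int[mu]_(x in circle) ((a j) `^ (q - 1) * above (a j) G x)%:E)%E).
    apply: lee_sum => j _.
    under eq_integral do rewrite EFinM.
    rewrite ge0_integralZl_EFin//; first last.
    - exact: powR_ge0.
    - by apply/measurable_EFinP; exact: mind.
    - have -> : (\int[mu]_(x in circle) ((a j < v x)%R%:R)%:E =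
          mu (circle `&` [set x | (a j < v x)%R]))%E.
        pose E := circle `&` [set x | (a j < v x)%R].
        transitivity (\int[mu]_(x in circle) (\1_E x)%:E)%E.
          apply: eq_integral => x xc; rewrite indicE; congr ((nat_of_bool _)%:R%:E).
          apply/idP/idP; rewrite inE => h; last exact: h.2.
          by split=> //; exact/set_mem.
        rewrite integral_indic//; last exact: mvl.
        by congr (mu _); rewrite /E setIAC setIid.
      under [in leRHS]eq_integral do rewrite EFinM.
      rewrite ge0_integralZl_EFin//; first last.
      + exact: powR_ge0.
      + by apply/measurable_EFinP; exact: measurable_above.
      + by move=> x _; rewrite lee_fin above_ge0.
      apply: le_trans (lee_wpmul2l _ (weak _ (a0 j))) _.
        by rewrite lee_fin powR_ge0.
      rewrite !muleA -!EFinM le_eqVlt; apply/orP; left; apply/eqP; congr (_%:E * _)%E.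
      have -> : a j.+1 = 2 * a j by rewrite /a exprS; ring.
      rewrite powRM ?(ltW (a0 j))// -(mulr_powRB1 (ltW (a0 j)) q0).
      by field; rewrite gt_eqF.
  have mab j : measurable_fun circle
      (fun x => ((a j) `^ (q - 1) * above (a j) G x)%:E).
    by apply/measurable_EFinP; apply: measurable_funM => //; exact: measurable_above.
  have ab0 j x : (0 <= ((a j) `^ (q - 1) * above (a j) G x)%:E)%E.
    by rewrite lee_fin mulr_ge0 ?powR_ge0 ?above_ge0.
  rewrite -ge0_sume_distrr; last by move=> j _; apply: integral_ge0 => x _.
  rewrite -ge0_integral_sum; [|exact: mc|by move=> j; exact: mab|by move=> j x _; exact: ab0].
  have M0 : (0 < (9 * 2 `^ q)%:E)%E by rewrite lte_fin mulr_gt0.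
  rewrite /K (EFinM (9 * 2 `^ q) k) -muleA lee_pmul2l//.
  rewrite -ge0_integralZl_EFin//; first last.
  - exact: ltW.
  - by apply/measurable_EFinP; exact: mGq.
  - by move=> x _; rewrite lee_fin powR_ge0.
  apply: ge0_le_integral => //.
  - by move=> x _; rewrite sume_ge0.
  - by apply: emeasurable_sum => j; exact: mab.
  - by apply: measurable_funeM; apply/measurable_EFinP; exact: mGq.
  - move=> x _; rewrite sumEFin -EFinM lee_fin.
    rewrite -(mulr_powRB1 (G0 x) q0) mulrCA.
    have e0 : 0 < q - 1 by lra.
    have := ler_wpM2l (G0 x) (sum_geometric_below J c0 e0 (G0 x)).
    apply: le_trans; rewrite mulr_sumr; apply: ler_sum => j _.
    by rewrite /above le_eqVlt; apply/orP; left; apply/eqP; rewrite -/(a j); ring.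
have IG0 : (0 <= \int[mu]_(x in circle) ((G x) `^ q)%:E)%E.
  by apply: integral_ge0 => x _; rewrite lee_fin powR_ge0.
have mainv : (\int[mu]_(x in circle) ((v x) `^ q)%:E <=
    K%:E * \int[mu]_(x in circle) ((G x) `^ q)%:E)%E.
  apply/lee_addgt0Pr => e e0; rewrite addeC.
  have p0 := @pi_gt0 R.
  pose c := (e / (2 * pi)) `^ q^-1.
  have ep : 0 < e / (2 * pi) by rewrite divr_gt0// mulr_gt0.
  have c0 : 0 < c by exact: powR_gt0.
  have := mainc c c0.
  rewrite /c -powRrM mulVf ?gt_eqF// powRr1 ?(ltW ep)//.
  by rewrite mulrC divfK// gt_eqF// mulr_gt0.
rewrite EFinM -muleA.
apply: le_trans (lee_wpmul2l _ mainv); last by rewrite lee_fin powR_ge0.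
rewrite -ge0_integralZl_EFin//; first last.
- by apply/measurable_EFinP; exact: mGq.
- by move=> x _; rewrite lee_fin powR_ge0.
rewrite le_eqVlt; apply/orP; left; apply/eqP; apply: eq_integral => x _.
rewrite -EFinM -powRM//; congr (_ `^ q)%:E; rewrite /v.
by rewrite mulrCA divff ?mulr1.
Qed.

End CircleMaximal.

(** * Trigonometric polynomials in one variable *)

Section TrigonometricPolynomials.
Variable R : realType.
Local Notation mu := (@lebesgue_measure R).
Local Notation circle := (@circle R).

Definition idx (N : nat) := ('I_N.+1 * bool)%type.

Definition freq N (a : idx N) : nat := a.1.

(** The shift by a quarter of a period makes both the cosines and the sines
instances of a single formula. *)
Definition trig N (a : idx N) (x : R) : R :=
  cos ((freq a)%:R * x - (if a.2 then 0 else pi / 2)).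

(** The polynomial with coefficients [c], to which the multiplier [lam] is
applied. *)
Definition tpoly N (lam : nat -> R) (c : idx N -> R) (x : R) : R :=
  \sum_a lam (freq a) * c a * trig a x.

Lemma trig_norm_le1 N (a : idx N) x : `|trig a x| <= 1.
Proof. exact: cos_max. Qed.

Lemma continuous_cos_affine (k th : R) : continuous (fun x : R => cos (k * x + th)).
Proof.
move=> x; apply: (@continuous_comp _ _ _ (fun x : R => k * x + th) cos).
  by apply: cvgD; [exact: mulrl_continuous|exact: cvg_cst].
exact: continuous_cos.
Qed.

Lemma continuous_trig N (a : idx N) : continuous (trig a).
Proof. exact: continuous_cos_affine. Qed.

Lemma continuous_sum_seq I (s : seq I) (f : I -> R -> R) :
  (forall i, continuous (f i)) -> continuous (fun x => \sum_(i <- s) f i x).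
Proof.
move=> cf; elim: s => [|i s IH] x.
  rewrite (_ : (fun _ => _) = cst 0); first exact: cvg_cst.
  by apply/funext => y; rewrite big_nil.
rewrite (_ : (fun _ => _) = (fun y => f i y + \sum_(i <- s) f i y)); last first.
  by apply/funext => y; rewrite big_cons.
by apply: cvgD; [exact: cf|exact: IH].
Qed.

Lemma continuousM_fun (f g : R -> R) : continuous f -> continuous g ->
  continuous (fun x => f x * g x).
Proof. by move=> cf cg x; apply: cvgM; [exact: cf|exact: cg]. Qed.

Lemma continuous_tpoly N lam (c : idx N -> R) : continuous (tpoly lam c).
Proof.
apply: continuous_sum_seq => a.
by apply: continuousM_fun; [move=> x; exact: cvg_cst|exact: continuous_trig].
Qed.

Lemma continuous_cosker N lam z : continuous (fun w => @cosker R N lam (z - w)).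
Proof.
apply: continuous_sum_seq => k.
apply: continuousM_fun; first by move=> x; exact: cvg_cst.
rewrite (_ : (fun _ => _) = (fun w => cos (- (nat_of_ord k)%:R * w + (nat_of_ord k)%:R * z))).
  exact: continuous_cos_affine.
by apply/funext => w; congr cos; ring.
Qed.

Lemma continuous_integrable_circle (f : R -> R) : continuous f ->
  mu.-integrable circle (EFin \o f).
Proof.
move=> cf; apply: continuous_compact_integrable; first exact: segment_compact.
exact: continuous_subspaceT.
Qed.

Lemma Rintegral_sum_continuous I (s : seq I) (f : I -> R -> R) :
  (forall i, continuous (f i)) ->
  \int[mu]_(x in circle) (\sum_(i <- s) f i x) =
  \sum_(i <- s) \int[mu]_(x in circle) f i x.
Proof.
move=> cf; elim: s => [|i s IH].
  rewrite big_nil; under eq_Rintegral do rewrite big_nil.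
  by rewrite Rintegral_cst ?mul0r//; exact: measurable_circle.
under eq_Rintegral do rewrite big_cons.
rewrite RintegralD ?IH ?big_cons//; first exact: measurable_circle.
  exact: continuous_integrable_circle.
by apply: continuous_integrable_circle; exact: continuous_sum_seq.
Qed.

Lemma sin_natpi (n : nat) : sin (n%:R * pi) = 0 :> R.
Proof.
elim: n => [|n IH]; first by rewrite mul0r sin0.
by rewrite -natr1 mulrDl mul1r sinDpi IH oppr0.
Qed.

Lemma Rintegral_cos (j th : R) : j != 0 -> sin (j * pi) = 0 ->
  \int[mu]_(w in circle) cos (j * w + th) = 0.
Proof.
move=> j0 sj; pose F (w : R) : R := j^-1 * sin (j * w + th).
have dF (w : R) : is_derive w 1 F (cos (j * w + th)).
  have d1 : is_derive w 1 (fun w => j * w + th) (j * 1).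
    by apply: is_derive_eq; rewrite /GRing.scale/= addr0.
  have d2 := @is_derive1_comp R sin (fun w => j * w + th) w _ _ (is_derive_sin _) d1.
  rewrite /F; apply: (@is_derive_eq _ _ _ _ _ _ _ _ (is_deriveZ j^-1 d2)).
  by rewrite /GRing.scale/= mulr1 mulrC mulfK.
have cF : continuous F.
  move=> w; have /derivable1_diffP := @ex_derive _ _ _ _ _ _ _ (dF w).
  exact: differentiable_continuous.
have p0 := @pi_gt0 R.
rewrite /Rintegral (@continuous_FTC2 R _ F).
- rewrite /F -EFinB /= -mulrBr !sinD mulrN sinN cosN sj; ring.
- lra.
- by apply: continuous_subspaceT; exact: continuous_cos_affine.
- split.
  + by move=> w _; exact: (@ex_derive _ _ _ _ _ _ _ (dF w)).
  + exact: cvg_at_right_filter (cF _).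
  + exact: cvg_at_left_filter (cF _).
- by move=> w _; rewrite derive1E; apply: (@derive_val _ _ _ _ _ _ _ (dF w)).
Qed.

Lemma Rintegral_circle_cst (r : R) : \int[mu]_(w in circle) r = 2 * pi * r.
Proof. by rewrite /Rintegral (integral_circle_cst r). Qed.

Lemma Rintegral_cos0 (th : R) :
  \int[mu]_(w in circle) cos (0 * w + th) = 2 * pi * cos th.
Proof.
under eq_Rintegral do rewrite mul0r add0r.
exact: Rintegral_circle_cst.
Qed.

(** Orthogonality of the trigonometric system. *)
Lemma Rintegral_trig_cos N (a : idx N) (k : nat) z :
  \int[mu]_(w in circle) (trig a w * (mult_of_freq R k * cos (k%:R * (z - w)))) =
  2 * pi * (freq a == k)%:R * trig a z.
Proof.
set l := freq a; set eta : R := if a.2 then 0 else pi / 2.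
have E (w : R) : trig a w * (mult_of_freq R k * cos (k%:R * (z - w))) =
  mult_of_freq R k / 2 * cos ((l%:R - k%:R) * w + (k%:R * z - eta)) +
  mult_of_freq R k / 2 * cos ((l%:R + k%:R) * w + (- (k%:R * z) - eta)).
  rewrite /trig -/l -/eta.
  have -> : (l%:R - k%:R) * w + (k%:R * z - eta) =
    (l%:R * w - eta) + k%:R * (z - w) by ring.
  have -> : (l%:R + k%:R) * w + (- (k%:R * z) - eta) =
    (l%:R * w - eta) - k%:R * (z - w) by ring.
  by move: (l%:R * w - eta) (k%:R * (z - w)) => A B; rewrite !cosD sinN cosN; field.
under eq_Rintegral do rewrite E.
have ci (j th : R) : mu.-integrable circle
    (EFin \o (fun w => mult_of_freq R k / 2 * cos (j * w + th))).
  apply: continuous_integrable_circle; apply: continuousM_fun.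
    by move=> x; exact: cvg_cst.
  exact: continuous_cos_affine.
have ci' (j th : R) : mu.-integrable circle (EFin \o (fun w => cos (j * w + th))).
  by apply: continuous_integrable_circle; exact: continuous_cos_affine.
rewrite RintegralD//; last exact: measurable_circle.
rewrite !RintegralZl//; try exact: measurable_circle.
have [lk|lk] := eqVneq l k; last first.
  rewrite mulr0 mul0r !Rintegral_cos ?mulr0 ?addr0//.
  - by rewrite subr_eq0 eqr_nat.
  - by rewrite mulrBl sinD sinN !sin_natpi; ring.
  - by rewrite -natrD pnatr_eq0 addn_eq0; move: lk; case: (l) (k) => [|?] [|?].
  - by rewrite -natrD sin_natpi.
rewrite lk subrr.
rewrite Rintegral_cos0 /trig -/l -/eta lk mulr1.
case: (posnP k) => [k0|k0].
  rewrite k0 addr0 Rintegral_cos0 /mult_of_freq eqxx !mul0r oppr0.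
  by field.
rewrite Rintegral_cos; last 2 first.
- by rewrite -natrD pnatr_eq0 addn_eq0 andbb -lt0n.
- by rewrite -natrD sin_natpi.
by rewrite /mult_of_freq (gtn_eqF k0); field.
Qed.

(** By orthogonality; only the frequencies up to the degree [N] of the polynomial
matter, so that the kernel may be longer. *)
Lemma tpoly_convolution N N' (lam nu : nat -> R) (c : idx N -> R) z :
  (forall k, (N' < k)%N -> (k <= N)%N -> lam k = 0) ->
  tpoly (fun k => lam k * nu k) c z =
  (2 * pi)^-1 * \int[mu]_(w in circle) (tpoly nu c w * cosker N' lam (z - w)).
Proof.
move=> lam0.
have E (w : R) : tpoly nu c w * cosker N' lam (z - w) =
  \sum_(a : idx N) \sum_(k < N'.+1) nu (freq a) * c a * lam k *
    (trig a w * (mult_of_freq R k * cos (k%:R * (z - w)))).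
  rewrite /tpoly /cosker mulr_suml; apply: eq_bigr => a _.
  by rewrite mulr_sumr; apply: eq_bigr => k _; ring.
have ccos (k : nat) : continuous (fun w : R => mult_of_freq R k * cos (k%:R * (z - w))).
  apply: continuousM_fun; first by move=> x; exact: cvg_cst.
  rewrite (_ : (fun _ => _) = (fun w => cos (- k%:R * w + k%:R * z))).
    exact: continuous_cos_affine.
  by apply/funext => w; congr cos; ring.
have ct a (k : nat) : continuous (fun w => @trig N a w * (mult_of_freq R k * cos (k%:R * (z - w)))).
  by apply: continuousM_fun; [exact: continuous_trig|exact: ccos].
have ct' (b : R) a (k : nat) : continuous (fun w => b *
    (@trig N a w * (mult_of_freq R k * cos (k%:R * (z - w))))).
  by apply: continuousM_fun; [move=> x; exact: cvg_cst|exact: ct].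
under eq_Rintegral do rewrite E.
rewrite Rintegral_sum_continuous; last first.
  by move=> a; apply: continuous_sum_seq => k; exact: ct'.
rewrite mulr_sumr; apply: eq_bigr => a _.
rewrite Rintegral_sum_continuous; last by move=> k; exact: ct'.
have Ik (k : nat) : \int[mu]_(w in circle) (nu (freq a) * c a * lam k *
    (trig a w * (mult_of_freq R k * cos (k%:R * (z - w))))) =
    nu (freq a) * c a * lam k * (2 * pi * (freq a == k)%:R * trig a z).
  rewrite RintegralZl ?Rintegral_trig_cos//; first exact: measurable_circle.
  by apply: continuous_integrable_circle; exact: ct.
under eq_bigr do rewrite Ik.
have p0 := @pi_gt0 R.
have [h|h] := ltnP N' (freq a).
  rewrite big1 => [|k _]; last first.
    by rewrite gtn_eqF ?mulr0 ?mul0r ?mulr0// (leq_ltn_trans _ h)// -ltnS.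
  by rewrite lam0 ?mulr0 ?mul0r// -ltnS ltn_ord.
rewrite -ltnS in h.
rewrite (bigD1 (Ordinal h))//= eqxx big1 => [|k kh]; last first.
  rewrite (_ : (freq a == k) = false) ?mulr0 ?mul0r ?mulr0//.
  by apply: contra_neqF kh => /eqP ak; exact/val_inj.
rewrite (_ : true%:R = 1)// mulr1 addr0.
have pn0 : (2 * pi : R) != 0 by rewrite gt_eqF// mulr_gt0.
by rewrite [X in _ = _ * X](_ : _ = (2 * pi) * (lam (freq a) * nu (freq a) * c a * trig a z)) ?mulKf//; ring.
Qed.

End TrigonometricPolynomials.

(** * Riesz means against Poisson means on the circle *)

Section MaximalTransfer.
Variable R : realType.
Local Notation mu := (@lebesgue_measure R).
Local Notation circle := (@circle R).

(** The supremum of a countable family of functions, listed through its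
encoding by natural numbers, so that it is visibly measurable. *)
Definition msup (K : countType) (T : Type) (Phi : K -> T -> R) (x : T) : \bar R :=
  ereal_sup (range (fun n : nat =>
    if unpickle n is Some k then `|Phi k x|%:E else 0%E)).

Section Msup.
Context (K : countType) (T : Type) (Phi : K -> T -> R).

Lemma msup_ge k x : (`|Phi k x|%:E <= msup Phi x)%E.
Proof. by apply: ereal_sup_ubound; exists (pickle k) => //=; rewrite pickleK. Qed.

Lemma msup_le x (y : \bar R) : (0 <= y)%E ->
  (forall k, (`|Phi k x|%:E <= y)%E) -> (msup Phi x <= y)%E.
Proof. by move=> y0 h; apply: ge_ereal_sup => z /= [n _ <-]; case: unpickle. Qed.

Lemma msup_ge0 x : (0 <= msup Phi x)%E.
Proof.
apply: (@le_trans _ _ (if unpickle 0 is Some k then `|Phi k x|%:E else 0)%E).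
  by case: unpickle => // k; rewrite lee_fin.
by apply: ereal_sup_ubound; exists 0%N.
Qed.

End Msup.

Lemma measurable_msup (K : countType) d (T : measurableType d) (D : set T)
    (Phi : K -> T -> R) : (forall k, measurable_fun D (Phi k)) ->
  measurable_fun D (msup Phi).
Proof.
move=> mPhi.
pose f (n : nat) (x : T) : \bar R :=
  if unpickle n is Some k then (`|Phi k x|)%:E else 0%E.
have -> : msup Phi = (fun x => esups (f ^~ x) 0%N).
  apply/funext => x; rewrite /msup /esups; congr ereal_sup.
  by apply/seteqP; split=> z /= [n _ <-]; exists n.
have mf n : measurable_fun D (f n).
  rewrite /f; case: (unpickle n) => [k|]; last exact: measurable_cst.
  by apply/measurable_EFinP; apply: measurableT_comp.
exact: measurable_fun_esups.
Qed.

Lemma tpoly_norm_le N (lam : nat -> R) (c : idx N -> R) (D : R) x :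
  (forall k, `|lam k| <= 1) -> \sum_a `|c a| <= D -> `|tpoly lam c x| <= D.
Proof.
move=> lam1; apply: le_trans; rewrite (le_trans (ler_norm_sum _ _ _))//.
apply: ler_sum => a _; rewrite !normrM -[leRHS]mulr1.
rewrite ler_pM ?mulr_ge0// ?trig_norm_le1//.
by rewrite -[leRHS]mul1r ler_wpM2r.
Qed.

Lemma poisson_seq_le1 n k : `|poisson_seq R n k| <= 1.
Proof.
rewrite ger0_norm ?expR_ge0// -expR0 ler_expR oppr_le0.
by rewrite divr_ge0.
Qed.

Lemma riesz_seq_le1 (g al : R) n k : 0 <= g -> 0 <= al ->
  `|riesz g al 0 n k| <= 1.
Proof.
move=> g0 al0; rewrite /riesz; case: ifP => kn; last by rewrite normr0.
have kn01 : 0 <= (k%:R / n%:R : R) <= 1.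
  rewrite divr_ge0//=; case: n kn => [|n] kn; first by rewrite invr0 mulr0.
  by rewrite ler_pdivrMr ?ltr0n// mul1r ler_nat.
have p1 := powR_le1 g0 kn01; have p0 := powR_ge0 (k%:R / n%:R : R) g.
rewrite /riesz_profile mul0r expR0 mulr1 ger0_norm ?powR_ge0//.
by apply: powR_le1 => //; lra.
Qed.

Lemma Rintegral_norm_le (f g : R -> R) (W : R) : continuous f -> 
  measurable_fun circle g -> (forall w, 0 <= g w) ->
  (forall w, `|f w| <= g w) -> (\int[mu]_(w in circle) (g w)%:E <= W%:E)%E ->
  `|\int[mu]_(w in circle) f w| <= W.
Proof.
move=> cf mg g0 fg gW.
have mc : measurable (circle : set (measurableTypeR R)) := @measurable_circle R.
have icf : mu.-integrable circle (EFin \o f) by exact: continuous_integrable_circle.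
have := le_normr_Rintegral mc icf; move=> /le_trans; apply.
have h : (\int[mu]_(w in circle) `|f w|%:E <= W%:E)%E.
  apply: le_trans gW; apply: ge0_le_integral => //.
  - by move/integrableP: icf => [/measurable_EFinP mf _]; apply/measurable_EFinP; apply: measurableT_comp.
  - exact/measurable_EFinP.
  - by move=> w _; rewrite lee_fin.
rewrite /Rintegral -lee_fin fineK//.
rewrite ge0_fin_numE; first by rewrite (le_lt_trans h)// ltry.
by apply: integral_ge0 => w _; rewrite lee_fin.
Qed.

Lemma one_add_mul_ge1 (n s : R) : 0 <= n -> 0 <= s -> 1 <= 1 + n * s.
Proof. by move=> n0 s0; rewrite lerDl mulr_ge0. Qed.

Lemma two_pi_inv_le1 : (2 * pi : R)^-1 <= 1.
Proof. by rewrite invf_le1 ?mulr_gt0 ?pi_gt0//; have := @pi_ge2 R; lra. Qed.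

Lemma measurable_decay delta n x (D : set R) :
  measurable_fun D (fun w : R => decay delta n (x - w)).
Proof.
apply: (@measurable_funS _ _ _ _ setT) => //.
apply: measurable_funM => //.
apply: (@measurableT_comp _ _ _ _ _ _ (fun x : R => x `^ (- (1 + delta)))).
  exact: measurable_powR.
apply: measurable_funD => //; apply: measurable_funM => //.
apply: (@measurableT_comp _ _ _ _ _ _ (@sinhalf R)).
  exact: continuous_measurable_fun (@continuous_sinhalf R).
exact: measurable_funB.
Qed.

(** The mechanism common to the two steps of [riesz_pointwise]: in
[|u| = |u|^p |u|^(1 - p)] the first factor is left to the average of [U^p], and
the second one is replaced by the tangential bound, the growth of which costs
part of the decay of the kernel. *)
Lemma weighted_convolution_le (p delta F W B m : R) (u U K k : R -> R) x :
  0 < p -> p < 1 -> 0 <= F -> 0 <= B -> 0 < m ->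
  continuous u -> continuous K -> measurable_fun circle U ->
  (forall w, `|u w| <= U w) ->
  (forall w, `|u w| <= F * (1 + m * sinhalf (x - w)) ^+ 2) ->
  (forall w, `|K w| <= k w) ->
  (forall w, k w * (1 + m * sinhalf (x - w)) `^ (2 * (1 - p)) <=
             B * decay delta m (x - w)) ->
  (\int[mu]_(w in circle) (U w `^ p * decay delta m (x - w))%:E <= W%:E)%E ->
  `|\int[mu]_(w in circle) (u w * K w)| <= F `^ (1 - p) * B * W.
Proof.
move=> p0 p1 F0 B0 m0 cu cK mU uU uF Kk kB UW.
have X1 w : 1 <= 1 + m * sinhalf (x - w).
  by apply: one_add_mul_ge1; [exact: ltW|exact: sinhalf_ge0].
have U0 w : 0 <= U w by apply: le_trans (uU w).
have p1' : 0 <= 1 - p by lra.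
have d0 w : 0 <= decay delta m (x - w) by apply: decay_ge0; exact: ltW.
have FB : 0 <= F `^ (1 - p) * B by rewrite mulr_ge0 ?powR_ge0.
have UD w : 0 <= U w `^ p * decay delta m (x - w).
  by apply: mulr_ge0 => //; exact: powR_ge0.
apply: (@Rintegral_norm_le _ (fun w => F `^ (1 - p) * B * (U w `^ p * decay delta m (x - w)))).
- exact: continuousM_fun.
- apply: measurable_funM => //; apply: measurable_funM; last exact: measurable_decay.
  by apply: (@measurableT_comp _ _ _ _ _ _ (fun x : R => x `^ p)).
- by move=> w; exact: mulr_ge0.
- move=> w; rewrite normrM.
  have h1 : `|u w| `^ p <= U w `^ p by rewrite ge0_ler_powR ?nnegrE ?(ltW p0).
  have X0 : 0 <= 1 + m * sinhalf (x - w) by rewrite (le_trans ler01).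
  have h2 : `|u w| `^ (1 - p) <=
      F `^ (1 - p) * (1 + m * sinhalf (x - w)) `^ (2 * (1 - p)).
    rewrite powRrM (powR_mulrn 2 X0) -powRM ?exprn_ge0//.
    by rewrite ge0_ler_powR ?nnegrE ?mulr_ge0 ?exprn_ge0.
  have -> : `|u w| = `|u w| `^ p * `|u w| `^ (1 - p).
    rewrite -powRD ?subrKC ?powRr1//.
    by rewrite oner_eq0.
  apply: (@le_trans _ _ (U w `^ p * (F `^ (1 - p) *
      (1 + m * sinhalf (x - w)) `^ (2 * (1 - p))) * k w)).
    apply: ler_pM; [|exact: normr_ge0| |exact: Kk].
      by apply: mulr_ge0; exact: powR_ge0.
    by apply: ler_pM; [exact: powR_ge0|exact: powR_ge0| |].
  have := ler_wpM2l (mulr_ge0 (powR_ge0 (U w) p) (powR_ge0 F (1 - p))) (kB w).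
  move: (decay _ _ _) (U w `^ p) (F `^ _) (_ `^ (2 * (1 - p))) => d a b c H.
  have -> : a * (b * c) * k w = a * b * (k w * c) by ring.
  by have -> : b * B * (a * d) = a * b * (B * d) by ring.
rewrite (EFinM _ W).
under eq_integral do rewrite EFinM.
rewrite ge0_integralZl_EFin//.
- by rewrite lee_wpmul2l// lee_fin.
- exact: measurable_circle.
- by move=> w _; rewrite lee_fin; exact: UD.
- apply/measurable_EFinP; apply: measurable_funM; last exact: measurable_decay.
  by apply: (@measurableT_comp _ _ _ _ _ _ (fun x : R => x `^ p)).
Qed.

(** The supremum [F] of the Poisson means, taken over all points but with the
weight [(1 + n sinhalf (x - z))^2] against distant ones, is controlled by an
average [W] of the power [p] of their supremum [U]. Indeed, by the semigroup law,
a Poisson mean is an average of Poisson means at half the time, and splitting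
there [|u| = |u|^p |u|^(1-p)] yields [F <= C F^(1-p) W], where [F] is finite and can
be cancelled. The Riesz means are then obtained from the Poisson means in the
same way. *)
Lemma riesz_pointwise (g al : R) : 1 <= g -> 0 < al ->
  let delta := Num.min al 1 in let p := 1 - delta / 4 in
  exists2 C : R, 0 < C &
  forall N (I : Type) (c : I -> idx N -> R) (D : R) (U : R -> R),
  (forall i, \sum_a `|c i a| <= D) -> measurable_fun circle U ->
  (forall i n w, `|tpoly (poisson_seq R n.+1) (c i) w| <= U w) ->
  forall x W : R, (forall n, (0 < n)%N ->
    (\int[mu]_(w in circle) (U w `^ p * decay (delta / 2) n%:R (x - w))%:E <=
     W%:E)%E) ->
  forall i n, `|tpoly (riesz g al 0 n.+1) (c i) x| <= C * W `^ p^-1.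
Proof.
move=> g1 al0 delta p.
have dl0 : 0 < delta by rewrite lt_min al0 ltr01.
have dl1 : delta <= 1 by rewrite ge_min lexx orbT.
have p0 : 0 < p by rewrite /p; lra.
have p1 : p < 1 by rewrite /p; lra.
have [CK CK0 CKP] : exists2 C : R, 0 < C & forall n, (0 < n)%N ->
    kernel_bound C n%:R delta (cosker n (riesz g al 1 n)).
  by apply: riesz_kernel_bound => //; rewrite ler01 lexx.
exists (CK * 64 `^ ((1 - p) / p)); first by rewrite mulr_gt0// powR_gt0.
move=> N I c D U cD mU uU x W UW i0 n0.
pose u i n w := tpoly (poisson_seq R n.+1) (c i) w.
have cu i n : continuous (u i n) by exact: continuous_tpoly.
have pi2 : 0 < (2 * pi : R)^-1 by rewrite invr_gt0 mulr_gt0// pi_gt0.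
pose X (n : nat) w : R := 1 + n.+1%:R * sinhalf (x - w).
have X1 n w : 1 <= X n w by apply: one_add_mul_ge1 => //; exact: sinhalf_ge0.
have X0 n w : 0 < X n w by rewrite (lt_le_trans ltr01).
have uD i n w : `|u i n w| <= D.
  by apply: tpoly_norm_le => // k; exact: poisson_seq_le1.
pose S : set R := [set r | exists i n z, r = `|u i n z| / X n z ^+ 2].
have SD : ubound S D.
  move=> _ [i [n [z ->]]]; rewrite (le_trans _ (uD i n z))// ler_piMr//.
  by rewrite invf_le1 ?exprn_gt0// exprn_ege1.
have S0 : S !=set0 by exists (`|u i0 n0 0| / X n0 0 ^+ 2); exists i0, n0, 0.
have supS : has_sup S by split=> //; exists D.
set F := sup S.
have uF i n w : `|u i n w| <= F * X n w ^+ 2.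
  rewrite -ler_pdivrMr ?exprn_gt0//; apply: sup_upper_bound => //.
  by exists i, n, w.
have F0 : 0 <= F.
  have := uF i0 n0 0; rewrite -ler_pdivrMr ?exprn_gt0//; apply: le_trans.
  by rewrite divr_ge0// exprn_ge0// ltW.
have U0 w : 0 <= U w by apply: le_trans (uU i0 n0 w).
have W0 : 0 <= W.
  rewrite -lee_fin; apply: le_trans (UW 1%N isT); apply: integral_ge0 => w _.
  by rewrite lee_fin; apply: mulr_ge0; [exact: powR_ge0|exact: decay_ge0].
(* The self-improving inequality: a mean with parameter [n] is an average of
means with parameter [2 n], and the kernel carries the weight from [z] to [x]. *)
have FW : F <= 64 * F `^ (1 - p) * W.
  apply: ge_sup => // _ [i [n [z ->]]].
  rewrite ler_pdivrMr ?exprn_gt0//.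
  pose m := n.+1.*2; have mE : m = n.*2.+1.+1 by [].
  have m0 : 0 < m%:R :> R by rewrite ltr0n.
  have mn : m%:R = 2 * n.+1%:R :> R by rewrite /m -muln2 natrM mulrC.
  (* Frequencies beyond [N] do not occur in the polynomial, so that the kernel may
  be truncated as late as its estimate requires. *)
  pose N' := maxn N (m * m).
  have kb : kernel_bound 16 m%:R 1 (cosker N' (poisson_seq R m)).
    by apply: poisson_kernel_bound => //; rewrite leq_maxr.
  have conv : u i n z = (2 * pi)^-1 * \int[mu]_(w in circle)
      (u i n.*2.+1 w * cosker N' (poisson_seq R m) (z - w)).
    rewrite -(tpoly_convolution _ _ (N := N))//; last first.
      move=> k Nk kN; have := leq_ltn_trans (leq_trans kN (leq_maxl N (m * m))) Nk.
      by rewrite ltnn.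
    by rewrite /u /tpoly; apply: eq_bigr => a _; rewrite (poisson_seq_double R _ (ltn0Sn n)).
  rewrite conv normrM (ger0_norm (ltW pi2)).
  pose k w : R := 16 * m%:R * (1 + m%:R * sinhalf (z - w)) `^ (- (1 + 1)).
  have H : `|\int[mu]_(w in circle)
      (u i n.*2.+1 w * cosker N' (poisson_seq R m) (z - w))| <=
      F `^ (1 - p) * (64 * X n z ^+ 2) * W.
    apply: (@weighted_convolution_le p (delta / 2) F W _ m%:R _ U _ k x) => //.
    - by rewrite mulr_ge0// exprn_ge0// ltW.
    - exact: continuous_cosker.
    - by move=> w; exact: uU.
    - move=> w; rewrite /k; set Z := 1 + m%:R * sinhalf (z - w).
      have Z1 : 1 <= Z by apply: one_add_mul_ge1; [exact: ltW|exact: sinhalf_ge0].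
      set Y := X n z; set V := 1 + m%:R * sinhalf (x - w).
      have Y1 : 1 <= Y by exact: X1.
      have V1 : 1 <= V by apply: one_add_mul_ge1; [exact: ltW|exact: sinhalf_ge0].
      have V0 : 0 < V by lra.
      have VYZ : V <= 2 * Y * Z.
        have h := sinhalf_triangle (x - z) (z - w); rewrite subrKA in h.
        have h1 := ler_wpM2l (ltW m0) h.
        have a0 := mulr_ge0 (ltW m0) (sinhalf_ge0 (x - z)).
        have b0 := mulr_ge0 (ltW m0) (sinhalf_ge0 (z - w)).
        have YE : 2 * Y = 2 + m%:R * sinhalf (x - z) by rewrite /Y /X mn; ring.
        rewrite YE; have := mulr_ge0 a0 b0; rewrite /V /Z; nra.
      rewrite -[1 + 1]/(2%:R) powR_invn; last by lra.
      have -> : decay (delta / 2) m%:R (x - w) = m%:R * V `^ (- (1 + delta / 2)) by [].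
      have h1 : (Z ^+ 2)^-1 <= 4 * Y ^+ 2 / V ^+ 2.
        rewrite ler_pdivlMr ?exprn_gt0// mulrC ler_pdivrMr ?exprn_gt0//; last lra.
        have -> : 4 * Y ^+ 2 * Z ^+ 2 = (2 * Y * Z) ^+ 2 by ring.
        by rewrite lerXn2r ?nnegrE; lra.
      have h2 : V `^ (2 * (1 - p)) / V ^+ 2 <= V `^ (- (1 + delta / 2)).
        rewrite -powR_invn ?(ltW V0)// -powRD; last by rewrite (gt_eqF V0) implybT.
        by rewrite ler_powR// /p; lra.
      have h3 : (Z ^+ 2)^-1 * V `^ (2 * (1 - p)) <=
          4 * Y ^+ 2 * V `^ (- (1 + delta / 2)).
        apply: (le_trans (ler_wpM2r (powR_ge0 _ _) h1)).
        rewrite -[leLHS]mulrA (mulrC (V ^+ 2)^-1) ler_wpM2l// mulr_ge0// exprn_ge0//; lra.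
      have h4 : 0 <= 16 * m%:R :> R by rewrite mulr_ge0// ltW.
      have := ler_wpM2l h4 h3.
      move: (_ `^ (2 * _)) (_ `^ (- _)) => A B.
      have -> : 16 * m%:R * (Z ^- 2 * A) = 16 * m%:R / Z ^+ 2 * A by ring.
      by have -> : 16 * m%:R * (4 * Y ^+ 2 * B) = 64 * Y ^+ 2 * (m%:R * B) by ring.
    - exact: UW.
  apply: (@le_trans _ _ (1 * (F `^ (1 - p) * (64 * X n z ^+ 2) * W))).
    by apply: ler_pM => //; [exact: ltW|exact: two_pi_inv_le1].
  by rewrite mul1r le_eqVlt; apply/orP; left; apply/eqP; ring.
have FpW : F `^ (1 - p) <= (64 * W) `^ ((1 - p) / p).
  move: F0; rewrite le_eqVlt => /predU1P[<-|F0].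
    by rewrite powR0 ?powR_ge0// subr_eq0 gt_eqF.
  have h : F `^ p <= 64 * W.
    have Fp : 0 < F `^ (1 - p) by exact: powR_gt0.
    rewrite -(ler_pM2r Fp) -powRD; last by rewrite subrKC oner_eq0.
    by rewrite subrKC powRr1 ?(ltW F0)// mulrAC.
  have -> : F `^ (1 - p) = (F `^ p) `^ ((1 - p) / p).
    by rewrite -powRrM mulrCA divff ?mulr1// gt_eqF.
  rewrite ge0_ler_powR ?nnegrE ?powR_ge0//; last by rewrite mulr_ge0.
  by rewrite divr_ge0 ?(ltW p0)//; lra.
have m0 : 0 < n0.+1%:R :> R by rewrite ltr0n.
have conv : tpoly (riesz g al 0 n0.+1) (c i0) x = (2 * pi)^-1 *
    \int[mu]_(w in circle) (u i0 n0 w * cosker n0.+1 (riesz g al 1 n0.+1) (x - w)).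
  rewrite -(tpoly_convolution _ _ (N := N))//; last first.
    by move=> k kn _; rewrite /riesz leqNgt kn.
  by rewrite /tpoly; apply: eq_bigr => a _; rewrite riesz_factor.
pose k w : R := CK * n0.+1%:R * X n0 w `^ (- (1 + delta)).
have H : `|\int[mu]_(w in circle)
    (u i0 n0 w * cosker n0.+1 (riesz g al 1 n0.+1) (x - w))| <=
    F `^ (1 - p) * CK * W.
  apply: (@weighted_convolution_le p (delta / 2) F W CK n0.+1%:R _ U _ k x) => //.
  - exact: ltW.
  - exact: continuous_cosker.
  - by move=> w; exact: uU.
  - by move=> w; exact: CKP.
  - move=> w; rewrite /k /decay -/(X n0 w) -!mulrA.
    rewrite ler_wpM2l ?(ltW CK0)// ler_wpM2l ?(ltW m0)//.
    rewrite -powRD; last by rewrite (gt_eqF (X0 _ _)) implybT.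
    by rewrite ler_powR// /p; lra.
  - exact: UW.
rewrite conv normrM (ger0_norm (ltW pi2)).
apply: (@le_trans _ _ (1 * (F `^ (1 - p) * CK * W))).
  by apply: ler_pM => //; [exact: ltW|exact: two_pi_inv_le1].
rewrite mul1r.
apply: (@le_trans _ _ ((64 * W) `^ ((1 - p) / p) * CK * W)).
  by rewrite ler_wpM2r// ler_wpM2r// ltW.
rewrite powRM//.
have -> : W `^ p^-1 = W `^ ((1 - p) / p) * W.
  have E : p^-1 = (1 - p) / p + 1 by field; rewrite gt_eqF.
  rewrite [in LHS]E powRD ?powRr1//; apply/implyP => /eqP h; exfalso; move: h.
  by rewrite -E; apply/eqP; rewrite invr_eq0 gt_eqF.
by rewrite le_eqVlt; apply/orP; left; apply/eqP; ring.
Qed.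

Lemma msup_fin_num (K : countType) T (Phi : K -> T -> R) (D : R) x : 0 <= D ->
  (forall k, `|Phi k x| <= D) -> msup Phi x = (fine (msup Phi x))%:E.
Proof.
move=> D0 PD; rewrite fineK// ge0_fin_numE ?msup_ge0//.
by rewrite (le_lt_trans (msup_le (y := D%:E) _ _))// ltry.
Qed.

(** Fefferman-Stein inequality on the circle, for a whole family of
trigonometric polynomials at once: this uniformity is what lets the coordinates
be treated one after the other. *)
Lemma riesz_le_poisson_circle (g al : R) : 1 <= g -> 0 < al ->
  exists2 C : R, 0 < C &
  forall N (I : countType) (c : I -> idx N -> R) (D : R),
  (forall i, \sum_a `|c i a| <= D) ->
  (\int[mu]_(x in circle)
     msup (fun (k : I * nat) x => tpoly (riesz g al 0 k.2.+1) (c k.1) x) x <=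
   C%:E * \int[mu]_(x in circle)
     msup (fun (k : I * nat) x => tpoly (poisson_seq R k.2.+1) (c k.1) x) x)%E.
Proof.
move=> g1 al0; have [C1 C10 C1P] := riesz_pointwise g1 al0.
set delta := Num.min al 1 in C1P; set p := 1 - delta / 4 in C1P.
have dl0 : 0 < delta by rewrite lt_min al0 ltr01.
have dl1 : delta <= 1 by rewrite ge_min lexx orbT.
have p0 : 0 < p by rewrite /p; lra.
have p1 : p < 1 by rewrite /p; lra.
have q1 : 1 < p^-1 by rewrite invf_gt1.
have [A A0 AP] : exists2 A : R, 0 < A & forall (G : R -> R) n x,
    measurable_fun circle G -> (forall w, 0 <= G w) -> 0 < n -> circle x ->
    (\int[mu]_(w in circle) (G w * decay (delta / 2) n (x - w))%:E <=
     A%:E * HL_circle G x)%E.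
  by apply: decay_integral_le_HL_circle; lra.
have [C2 C20 C2P] := HL_circle_strong_type q1.
clearbody p; clear dl0 dl1.
exists (C1 * A `^ p^-1 * C2); first by rewrite !mulr_gt0// powR_gt0.
move=> N I c D cD.
set PhiA := fun (k : I * nat) x => tpoly (riesz g al 0 k.2.+1) (c k.1) x.
set PhiP := fun (k : I * nat) x => tpoly (poisson_seq R k.2.+1) (c k.1) x.
have mA : measurable_fun circle (msup PhiA).
  apply: measurable_msup => k; apply: (@measurable_funS _ _ _ _ setT) => //.
  by apply: continuous_measurable_fun; exact: continuous_tpoly.
have mP : measurable_fun circle (msup PhiP).
  apply: measurable_msup => k; apply: (@measurable_funS _ _ _ _ setT) => //.
  by apply: continuous_measurable_fun; exact: continuous_tpoly.
pose D' := Num.max D 0.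
have D'0 : 0 <= D' by rewrite le_max lexx orbT.
have PD k x : `|PhiP k x| <= D'.
  apply: tpoly_norm_le => [j|]; first exact: poisson_seq_le1.
  by rewrite (le_trans (cD _))// le_max lexx.
pose U x := fine (msup PhiP x).
have UE x : msup PhiP x = (U x)%:E by exact: (msup_fin_num D'0).
have U0 x : 0 <= U x by rewrite fine_ge0// msup_ge0.
have UD x : U x <= D' by rewrite -lee_fin -UE; apply: msup_le => [|k]; rewrite lee_fin.
have mU : measurable_fun circle U.
  by apply: (measurableT_comp (@fine_measurable R setT measurableT)).
pose G x := U x `^ p.
have G0 x : 0 <= G x by exact: powR_ge0.
have mG : measurable_fun circle G.
  by apply: (@measurableT_comp _ _ _ _ _ _ (fun x : R => x `^ p)).
pose D1 := Num.max (D' `^ p) 1.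
have D10 : 0 < D1 by rewrite lt_max ltr01 orbT.
have GD x : 0 <= G x <= D1.
  by rewrite G0 le_max ge0_ler_powR ?nnegrE ?(ltW p0).
have HE x : HL_circle G x = (fine (HL_circle G x))%:E.
  rewrite fineK// ge0_fin_numE ?HL_circle_ge0//.
  by rewrite (le_lt_trans (HL_circle_bounded x mG GD D10))// ltry.
have H0 x : 0 <= fine (HL_circle G x) by rewrite fine_ge0// HL_circle_ge0.
have point x : circle x ->
    (msup PhiA x <= (C1 * A `^ p^-1 * (fine (HL_circle G x)) `^ p^-1)%:E)%E.
  move=> cx; apply: msup_le => [|[i n]].
    by rewrite lee_fin !mulr_ge0 ?powR_ge0// ltW.
  rewrite lee_fin -mulrA -powRM ?(ltW A0)//.
  apply: (C1P N I c D U) => //.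
    by move=> j m w; rewrite -lee_fin -UE; exact: (msup_ge PhiP (j, m)).
  move=> m m0; rewrite EFinM -HE; apply: AP => //.
  by rewrite ltr0n.
have iG : mu.-integrable circle (EFin \o G).
  apply: measurable_bounded_integrable => //; first exact: measurable_circle.
    by have h : (mu circle < +oo)%E by rewrite circle_measure ltry.
  exists D1; split; first exact: num_real.
  move=> x Dx w _ /=; have /andP[? h] := GD w.
  by rewrite ger0_norm// (le_trans h)// ltW.
have mH : measurable_fun circle (fun x => (fine (HL_circle G x)) `^ p^-1).
  apply: (@measurableT_comp _ _ _ _ _ _ (fun x : R => x `^ p^-1)) => //.
  by apply: (measurableT_comp (@fine_measurable R setT measurableT)); exact: measurable_HL_circle.
have K0 : 0 <= C1 * A `^ p^-1 by rewrite mulr_ge0 ?powR_ge0// ltW.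
apply: (@le_trans _ _ (\int[mu]_(x in circle)
    ((C1 * A `^ p^-1)%:E * ((fine (HL_circle G x)) `^ p^-1)%:E))%E).
  apply: ge0_le_integral => //.
  - exact: measurable_circle.
  - by move=> x _; exact: msup_ge0.
  - by apply: measurable_funeM; exact/measurable_EFinP.
rewrite ge0_integralZl_EFin//; first last.
- exact/measurable_EFinP.
- by move=> x _; rewrite lee_fin powR_ge0.
- exact: measurable_circle.
rewrite [in leRHS]EFinM -muleA lee_wpmul2l ?lee_fin//.
apply: (le_trans (C2P G D1 mG GD)); rewrite lee_pmul2l ?lte_fin//.
rewrite le_eqVlt; apply/orP; left; apply/eqP; apply: eq_integral => x _.
by rewrite UE /G -powRrM divff ?gt_eqF// powRr1.
Qed.

End MaximalTransfer.

(** * Integration over the torus *)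

Section TorusIntegration.

Section Rectangles.
Local Open Scope ereal_scope.
Context d1 d2 (T1 : measurableType d1) (T2 : measurableType d2) (R : realType).
Variable m1 : {sigma_finite_measure set T1 -> \bar R}.
Variable m2 : {sigma_finite_measure set T2 -> \bar R}.
Variables (A : set T1) (B : set T2).
Hypotheses (mA : measurable A) (mB : measurable B).
Variable f : T1 * T2 -> \bar R.
Hypotheses (mf : measurable_fun setT f) (f0 : forall x, 0 <= f x).

Let g := f \_ (A `*` B).

Let mg : measurable_fun setT g.
Proof.
apply/(measurable_restrictT _ (measurableX mA mB)).
exact: (@measurable_funS _ _ _ _ setT).
Qed.

Let g0 x : 0 <= g x. Proof. exact: erestrict_ge0. Qed.

Let gxy x y : g (x, y) = if x \in A then (if y \in B then f (x, y) else 0) else 0.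
Proof.
rewrite /g patchE; case: ifPn => [/set_mem[/= xA yB]|h].
  by rewrite !mem_set.
case: ifPn => // xA; case: ifPn => // yB.
by exfalso; move/negP: h; apply; apply/mem_set; split=> /=; exact/set_mem.
Qed.

Let FE x : \int[m2]_y g (x, y) = ((fun x => \int[m2]_(y in B) f (x, y)) \_ A) x.
Proof.
rewrite patchE; case: ifPn => xA.
  rewrite [RHS]integral_mkcond; apply: eq_integral => y _.
  by rewrite gxy xA patchE.
by apply: integral0_eq => y _; rewrite gxy (negbTE xA).
Qed.

Let GE y : \int[m1]_x g (x, y) = ((fun y => \int[m1]_(x in A) f (x, y)) \_ B) y.
Proof.
rewrite patchE; case: ifPn => yB.
  rewrite [RHS]integral_mkcond; apply: eq_integral => x _.
  by rewrite gxy yB patchE.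
by apply: integral0_eq => x _; rewrite gxy (negbTE yB) if_same.
Qed.

Lemma integral_rectangle :
  \int[m1 \x m2]_(z in A `*` B) f z = \int[m1]_(x in A) \int[m2]_(y in B) f (x, y).
Proof.
rewrite integral_mkcond (fubini_tonelli1 _ mg g0) [RHS]integral_mkcond.
by apply: eq_integral => x _; exact: FE.
Qed.

Lemma integral_rectangle_swap :
  \int[m1]_(x in A) \int[m2]_(y in B) f (x, y) =
  \int[m2]_(y in B) \int[m1]_(x in A) f (x, y).
Proof.
rewrite -integral_rectangle integral_mkcond (fubini_tonelli2 _ mg g0).
rewrite [RHS]integral_mkcond.
by apply: eq_integral => x _; exact: GE.
Qed.

End Rectangles.

Lemma measurable_partial_integral d1 d2 (T1 : measurableType d1)
    (T2 : measurableType d2) (R : realType)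
    (m2 : {sigma_finite_measure set T2 -> \bar R}) (B : set T2)
    (f : T1 * T2 -> \bar R) :
  measurable B -> measurable_fun setT f -> (forall x, 0 <= f x)%E ->
  measurable_fun setT (fun x => \int[m2]_(y in B) f (x, y))%E.
Proof.
move=> mB mf f0.
have mg : measurable_fun setT (f \_ (setT `*` B)).
  apply/(measurable_restrictT _ (measurableX measurableT mB)).
  exact: (@measurable_funS _ _ _ _ setT).
have := measurable_fun_fubini_tonelli_F (m2 := m2) _ mg.
rewrite /fubini_F => h.
rewrite (_ : (fun x => _) = (fun x => \int[m2]_y ((f \_ (setT `*` B)) (x, y)))%E).
  by apply: h => x; exact: erestrict_ge0.
apply/funext => x; rewrite [LHS]integral_mkcond; apply: eq_integral => y _.
rewrite !patchE; case: ifPn => yB; case: ifPn => xyB//.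
  by exfalso; move/negP: xyB; apply; apply/mem_set; split=> //=; exact/set_mem.
by exfalso; move/negP: yB; apply; move/set_mem: xyB => [_ /= ?]; exact/mem_set.
Qed.

Variable R : realType.

Lemma circleP (s : R) : circle s <-> (- pi <= s <= pi).
Proof. by rewrite /circle/= in_itv. Qed.

Local Notation T := (measurableTypeR R).
Local Notation mu := (@lebesgue_measure R).
Local Notation circle := (@circle R : set T).
Local Notation lam := (lebesgue_tuple R).

Lemma measurable_circleT : measurable circle.
Proof. exact: measurable_circle. Qed.

Definition tcons (n : nat) (s : T) (y : n.-tuple T) : n.+1.-tuple T :=
  [tuple of s :: y].

Lemma measurable_tcons n :
  measurable_fun setT (fun z : T * n.-tuple T => tcons z.1 z.2).
Proof. exact: measurable_tuple_cons. Qed.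

Lemma measurable_torus n : measurable (torus R n).
Proof.
rewrite (_ : torus R n = \bigcap_(j in [set: 'I_n])
    ((fun x : n.-tuple T => tnth x j) @^-1` circle)); last first.
  apply/seteqP; split=> x /= Hx j; first by move=> _; apply/circleP; exact: Hx.
  by apply/circleP; exact: Hx.
apply: fin_bigcap_measurable => // j _.
by rewrite -[X in measurable X]setTI; apply: measurable_tnth => //; exact: measurable_circleT.
Qed.

Lemma torus_tcons n s (y : n.-tuple T) :
  torus R n.+1 (tcons s y) <-> circle s /\ torus R n y.
Proof.
split=> [H|[H1 H2] j].
  split; first by apply/circleP; have := H ord0; rewrite tnth0.
  by move=> j; have := H (lift ord0 j); rewrite tnthS.
case: (unliftP ord0 j) => [k ->|->]; rewrite ?tnthS ?tnth0; first exact: H2.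
exact/circleP.
Qed.

Lemma integral_torus_tcons n (F : n.+1.-tuple T -> \bar R) :
  measurable_fun setT F -> (forall x, 0 <= F x)%E ->
  (\int[lam n.+1]_(x in torus R n.+1) F x =
   \int[mu]_(s in circle) \int[lam n]_(y in torus R n) F (tcons s y))%E.
Proof.
move=> mF F0; have mt := measurable_tcons (n := n).
have mFt : measurable_fun setT (fun z : T * n.-tuple T => F (tcons z.1 z.2)).
  exact: (measurableT_comp mF mt).
have mFD : measurable_fun (torus R n.+1) F by exact: (@measurable_funS _ _ _ _ setT).
transitivity (\int[pushforward (mu \x lam n)%E (fun z : T * n.-tuple T => tcons z.1 z.2)]_(x in torus R n.+1) F x)%E.
  by apply: eq_measure_integral.
rewrite ge0_integral_pushforward//; last exact: measurable_torus.
rewrite (_ : _ @^-1` torus R n.+1 = circle `*` torus R n); last first.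
  by apply/seteqP; split=> -[s y] /= /torus_tcons.
rewrite integral_rectangle//; first exact: measurable_circleT.
  exact: measurable_torus.
by move=> x; exact: F0.
Qed.

Lemma integral_torus_swap n (F : T * n.-tuple T -> \bar R) :
  measurable_fun setT F -> (forall x, 0 <= F x)%E ->
  (\int[mu]_(s in circle) \int[lam n]_(y in torus R n) F (s, y) =
   \int[lam n]_(y in torus R n) \int[mu]_(s in circle) F (s, y))%E.
Proof.
move=> mF F0.
exact: (integral_rectangle_swap mu (lam n) measurable_circleT
  (@measurable_torus n) mF F0).
Qed.

Definition tins (n : nat) (i : 'I_n.+1) (s : T) (y : n.-tuple T) : n.+1.-tuple T :=
  [tuple (if unlift i j is Some l then tnth y l else s) | j < n.+1].

Lemma tnth_tins_lift n (i : 'I_n.+1) s (y : n.-tuple T) l :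
  tnth (tins i s y) (lift i l) = tnth y l.
Proof. by rewrite tnth_mktuple liftK. Qed.

Lemma tnth_tins n (i : 'I_n.+1) s (y : n.-tuple T) : tnth (tins i s y) i = s.
Proof. by rewrite tnth_mktuple unlift_none. Qed.

Lemma tins_ord0 n s (y : n.-tuple T) : tins ord0 s y = tcons s y.
Proof.
apply: eq_from_tnth => j; case: (unliftP ord0 j) => [k ->|->].
  by rewrite tnth_tins_lift tnthS.
by rewrite tnth_tins tnth0.
Qed.

Lemma tins_lift n (i : 'I_n.+1) s h (y : n.-tuple T) :
  tins (lift ord0 i) s (tcons h y) = tcons h (tins i s y).
Proof.
apply: eq_from_tnth => j; case: (unliftP (lift ord0 i) j) => [k ->|->]; last first.
  by rewrite tnth_tins tnthS tnth_tins.
rewrite tnth_tins_lift; case: (unliftP ord0 k) => [l ->|->].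
  have -> : lift (lift ord0 i) (lift ord0 l) = lift ord0 (lift i l).
    by apply/val_inj; rewrite /= /fintype.bump !leq0n !add1n ltnS; case: (leqP i l).
  by rewrite !tnthS tnth_tins_lift.
have -> : lift (lift ord0 i) ord0 = ord0 by apply/val_inj.
by rewrite !tnth0.
Qed.

Lemma measurable_tins n (i : 'I_n.+1) :
  measurable_fun setT (fun z : T * n.-tuple T => tins i z.1 z.2).
Proof.
apply/measurable_fun_tnthP => j; case: (unliftP i j) => [k ->|->].
  rewrite (_ : _ \o _ = (fun z : T * n.-tuple T => tnth z.2 k)).
    exact: (measurableT_comp (measurable_tnth k) measurable_snd).
  by apply/funext => z /=; rewrite tnth_tins_lift.
rewrite (_ : _ \o _ = fst); first exact: measurable_fst.
by apply/funext => z /=; rewrite tnth_tins.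
Qed.

Lemma torus_tins n (i : 'I_n.+1) s (y : n.-tuple T) :
  torus R n.+1 (tins i s y) <-> circle s /\ torus R n y.
Proof.
split=> [H|[H1 H2] j].
  split; first by apply/circleP; have := H i; rewrite tnth_tins.
  by move=> j; have := H (lift i j); rewrite tnth_tins_lift.
case: (unliftP i j) => [k ->|->]; rewrite ?tnth_tins_lift ?tnth_tins; first exact: H2.
exact/circleP.
Qed.

(** Any coordinate can be singled out, by moving it past the first one. *)
Lemma integral_torus_tins n (i : 'I_n.+1) (F : n.+1.-tuple T -> \bar R) :
  measurable_fun setT F -> (forall x, 0 <= F x)%E ->
  (\int[lam n.+1]_(x in torus R n.+1) F x =
   \int[mu]_(s in circle) \int[lam n]_(y in torus R n) F (tins i s y))%E.
Proof.
elim: n i F => [|n IH] i F mF F0.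
  rewrite (integral_torus_tcons mF F0).
  apply: eq_integral => s _; apply: eq_integral => y _.
  by rewrite (ord1 i) tins_ord0.
rewrite (integral_torus_tcons mF F0); case: (unliftP ord0 i) => [k ->|->]; last first.
  by apply: eq_integral => s _; apply: eq_integral => y _; rewrite tins_ord0.
have mFk (h : T) : measurable_fun setT (fun y => F (tcons h y)).
  apply: (measurableT_comp mF).
  apply: (measurableT_comp (@measurable_tcons n.+1) (g := fun y : n.+1.-tuple T => (h, y))).
  exact: measurable_pair1.
under eq_integral => h _ do rewrite (IH k (fun y => F (tcons h y)) (mFk h) (fun y => F0 _)).
pose H (z : (T * T) * n.-tuple T) := F (tcons z.1.1 (tins k z.1.2 z.2)).
have mH : measurable_fun setT H.
  apply: (measurableT_comp mF).
  apply: (measurableT_comp (@measurable_tcons n.+1)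
    (g := fun z : (T * T) * n.-tuple T => (z.1.1, tins k z.1.2 z.2))).
  apply/measurable_fun_pairP; split.
    exact: (measurableT_comp measurable_fst measurable_fst).
  apply: (measurableT_comp (@measurable_tins n k)
    (g := fun z : (T * T) * n.-tuple T => (z.1.2, z.2))).
  apply/measurable_fun_pairP; split; last exact: measurable_snd.
  exact: (measurableT_comp measurable_snd measurable_fst).
have mH2 : measurable_fun setT
    (fun w : T * T => \int[lam n]_(y in torus R n) H (w, y))%E.
  apply: measurable_partial_integral => //; first exact: measurable_torus.
  by move=> x; exact: F0.
rewrite [LHS](_ : _ = \int[mu]_(h in circle) \int[mu]_(s in circle)
    (fun w : T * T => \int[lam n]_(y in torus R n) H (w, y)) (h, s))%E//.
have H20 w : (0 <= \int[lam n]_(y in torus R n) H (w, y))%E.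
  by apply: integral_ge0 => y _; exact: F0.
rewrite (integral_rectangle_swap mu mu measurable_circleT measurable_circleT mH2 H20).
apply: eq_integral => s _.
have mFs : measurable_fun setT (fun y => F (tins (lift ord0 k) s y)).
  apply: (measurableT_comp mF).
  apply: (measurableT_comp (@measurable_tins n.+1 (lift ord0 k)) (g := fun y : n.+1.-tuple T => (s, y))).
  exact: measurable_pair1.
rewrite (integral_torus_tcons mFs); last by move=> y; exact: F0.
by apply: eq_integral => h _; apply: eq_integral => y _; rewrite tins_lift.
Qed.

End TorusIntegration.

(** * Iteration over the coordinates *)

Section TensorPolynomials.
Variable R : realType.
Local Notation T := (measurableTypeR R).
Local Notation mu := (@lebesgue_measure R).
Local Notation circle := (@circle R : set T).
Local Notation lam := (lebesgue_tuple R).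

Lemma big_tuple_cons (I : finType) m (F : m.+1.-tuple I -> R) :
  \sum_a F a = \sum_b \sum_(a' : m.-tuple I) F [tuple of b :: a'].
Proof.
rewrite pair_bigA/= (reindex (fun p : I * m.-tuple I => [tuple of p.1 :: p.2]))//.
exists (fun t => (thead t, [tuple of behead t])) => [[b a]|t] _ /=.
  by congr pair; exact/val_inj.
by rewrite [t in RHS]tuple_eta.
Qed.

(** The multipliers act coordinatewise. *)
Definition mtpoly N m (Lam : 'I_m -> nat -> R) (c : m.-tuple (idx N) -> R)
    (x : m.-tuple T) : R :=
  \sum_a c a * \prod_(j < m) (Lam j (freq (tnth a j)) * trig (tnth a j) (tnth x j)).

(** With respect to its last coordinates a polynomial is a polynomial whose
coefficients depend on the first one, and conversely. *)
Section Recursion.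
Context (N m : nat) (Lam : 'I_m.+1 -> nat -> R) (c : m.+1.-tuple (idx N) -> R).
Variables (s : T) (y : m.-tuple T).
Let Lam' j := Lam (lift ord0 j).

Lemma mtpoly_tcons_tail : mtpoly Lam c (tcons s y) =
  mtpoly Lam' (fun a' => tpoly (Lam ord0) (fun b => c [tuple of b :: a']) s) y.
Proof.
rewrite /mtpoly big_tuple_cons exchange_big; apply: eq_bigr => a' _ /=.
rewrite /tpoly mulr_suml; apply: eq_bigr => b _.
rewrite big_ord_recl (tnth0 b a') (tnth0 s y).
rewrite (eq_bigr (fun j => Lam' j (freq (tnth a' j)) * trig (tnth a' j) (tnth y j))).
  by ring.
by move=> j _; rewrite (tnthS b a') (tnthS s y).
Qed.

Lemma mtpoly_tcons_head : mtpoly Lam c (tcons s y) =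
  tpoly (Lam ord0) (fun b => mtpoly Lam' (fun a' => c [tuple of b :: a']) y) s.
Proof.
rewrite /mtpoly big_tuple_cons; apply: eq_bigr => b _ /=.
rewrite mulr_sumr mulr_suml; apply: eq_bigr => a' _.
rewrite big_ord_recl (tnth0 b a') (tnth0 s y).
rewrite (eq_bigr (fun j => Lam' j (freq (tnth a' j)) * trig (tnth a' j) (tnth y j))).
  by ring.
by move=> j _; rewrite (tnthS b a') (tnthS s y).
Qed.

End Recursion.

Lemma measurable_mtpoly N m Lam (c : m.-tuple (idx N) -> R) :
  measurable_fun setT (mtpoly Lam c).
Proof.
apply: measurable_sum => a; apply: measurable_funM; first exact: measurable_cst.
apply: measurable_prod => j _; apply: measurable_funM; first exact: measurable_cst.
apply: (@measurableT_comp _ _ _ _ _ _ (trig (tnth a j) : T -> R)).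
  exact: continuous_measurable_fun (@continuous_trig R N (tnth a j)).
exact: measurable_tnth.
Qed.

Lemma mtpoly_norm_le N m Lam (c : m.-tuple (idx N) -> R) x :
  (forall j k, `|Lam j k| <= 1) -> `|mtpoly Lam c x| <= \sum_a `|c a|.
Proof.
move=> L1; apply: le_trans (ler_norm_sum _ _ _) _; apply: ler_sum => a _.
rewrite normrM ler_piMr//; rewrite normr_prod; apply: prodr_ile1 => j _.
by rewrite normr_ge0 normrM mulr_ile1//= ?trig_norm_le1.
Qed.

Lemma msup_reindex (K K' : countType) S S' (Phi : K -> S -> R) (Phi' : K' -> S' -> R)
    (h : K -> K') x x' : (forall k, Phi k x = Phi' (h k) x') ->
  (msup Phi x <= msup Phi' x')%E.
Proof.
by move=> hP; apply: msup_le => [|k]; [exact: msup_ge0|rewrite hP msup_ge].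
Qed.

Lemma msup_bij (K K' : countType) S S' (Phi : K -> S -> R) (Phi' : K' -> S' -> R)
    (h : K -> K') (h' : K' -> K) x x' : cancel h' h ->
  (forall k, Phi k x = Phi' (h k) x') -> msup Phi x = msup Phi' x'.
Proof.
move=> hK hP; apply/le_anti/andP; split; first exact: msup_reindex hP.
by apply: (msup_reindex (h := h')) => k; rewrite hP hK.
Qed.

(** The first coordinate and its parameter are part of the family when the
induction hypothesis is applied to the other ones, and then the other ones are
part of the family when the inequality on the circle is applied to the first
one. *)
Lemma tensor_le (A P : nat -> nat -> R) (C : R) : 0 < C ->
  (forall n k, `|A n k| <= 1) -> (forall n k, `|P n k| <= 1) ->
  (forall N (I : countType) (c : I -> idx N -> R) (D : R),
    (forall i, \sum_a `|c i a| <= D) ->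
    (\int[mu]_(x in circle) msup (fun (k : I * nat) x => tpoly (A k.2) (c k.1) x) x <=
     C%:E * \int[mu]_(x in circle)
       msup (fun (k : I * nat) x => tpoly (P k.2) (c k.1) x) x)%E) ->
  forall m N (I : countType) (c : I -> m.-tuple (idx N) -> R) (D : R),
    (forall i, \sum_a `|c i a| <= D) ->
    (\int[lam m]_(x in torus R m)
       msup (fun (k : I * m.-tuple nat) x => mtpoly (fun j => A (tnth k.2 j)) (c k.1) x) x <=
     (C ^+ m)%:E * \int[lam m]_(x in torus R m)
       msup (fun (k : I * m.-tuple nat) x => mtpoly (fun j => P (tnth k.2 j)) (c k.1) x) x)%E.
Proof.
move=> C0 A1 P1 H1; elim=> [|m IH] N I c D cD.
  rewrite expr0 mul1e; apply: ge0_le_integral.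
  - exact: measurable_torus.
  - by move=> x _; exact: msup_ge0.
  - apply: (@measurable_funS _ _ _ _ setT) => //.
    by apply: measurable_msup => k; exact: measurable_mtpoly.
  - apply: (@measurable_funS _ _ _ _ setT) => //.
    by apply: measurable_msup => k; exact: measurable_mtpoly.
  - move=> x _; apply: (@msup_reindex _ _ _ _ _ _ id) => k.
    by apply: eq_bigr => a _; rewrite !big_ord0.
pose hull (z : T * m.-tuple T) := tcons z.1 z.2.
pose MA := msup (fun (k : I * m.+1.-tuple nat) x => mtpoly (fun j => A (tnth k.2 j)) (c k.1) x).
pose MP := msup (fun (k : I * m.+1.-tuple nat) x => mtpoly (fun j => P (tnth k.2 j)) (c k.1) x).
have mMA : measurable_fun setT MA.
  by apply: measurable_msup => k; exact: measurable_mtpoly.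
have mMP : measurable_fun setT MP.
  by apply: measurable_msup => k; exact: measurable_mtpoly.
rewrite -/MA -/MP.
rewrite (integral_torus_tcons mMA); last by move=> x; exact: msup_ge0.
rewrite (integral_torus_tcons mMP); last by move=> x; exact: msup_ge0.
(* Halfway, the means are [A] in the first variable and [P] in the other ones. *)
pose Lmix (k : I * (nat * m.-tuple nat)) (j : 'I_m.+1) :=
  if unlift ord0 j is Some l then P (tnth k.2.2 l) else A k.2.1.
have Lmix1 k j l : `|Lmix k j l| <= 1 by rewrite /Lmix; case: unlift => [?|]; [exact: P1|exact: A1].
pose MX := msup (fun (k : I * (nat * m.-tuple nat)) x => mtpoly (Lmix k) (c k.1) x).
have mMX : measurable_fun setT MX.
  by apply: measurable_msup => k; exact: measurable_mtpoly.
have mint F : measurable_fun setT F -> (forall x, 0 <= F x)%E ->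
    measurable_fun circle (fun s => \int[lam m]_(y in torus R m) F (tcons s y))%E.
  move=> mF F0; apply: (@measurable_funS _ _ _ _ setT) => //.
  exact: (measurable_partial_integral (lam m)
    (f := fun z : T * m.-tuple T => F (tcons z.1 z.2)) (@measurable_torus R m)
    (measurableT_comp mF (@measurable_tcons R m)) (fun z => F0 _)).
have mint2 F : measurable_fun setT F -> (forall x, 0 <= F x)%E ->
    measurable_fun (torus R m) (fun y => \int[mu]_(s in circle) F (tcons s y))%E.
  move=> mF F0; apply: (@measurable_funS _ _ _ _ setT) => //.
  have mF' : measurable_fun setT (fun z : m.-tuple T * T => F (tcons z.2 z.1)).
    apply: (measurableT_comp mF).
    apply: (measurableT_comp (@measurable_tcons R m) (g := fun z : m.-tuple T * T => (z.2, z.1))).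
    by apply/measurable_fun_pairP; split; [exact: measurable_snd|exact: measurable_fst].
  have h := measurable_partial_integral mu (f := fun z : m.-tuple T * T => F (tcons z.2 z.1)) (@measurable_circleT R).
  have h2 := h mF' (fun z => F0 _).
  exact: h2.
have step1 : (\int[mu]_(s in circle) \int[lam m]_(y in torus R m) MA (tcons s y) <=
    (C ^+ m)%:E * \int[mu]_(s in circle) \int[lam m]_(y in torus R m) MX (tcons s y))%E.
  rewrite -ge0_integralZl_EFin ?exprn_ge0 ?(ltW C0)//; first last.
  - by apply: (mint _ mMX (msup_ge0 _)).
  - by move=> s _; apply: integral_ge0 => y _; exact: msup_ge0.
  - exact: measurable_circleT.
  apply: ge0_le_integral.
  - exact: measurable_circleT.
  - by move=> s _; apply: integral_ge0 => y _; exact: msup_ge0.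
  - exact: (mint _ mMA (msup_ge0 _)).
  - apply: measurable_funeM; exact: (mint _ mMX (msup_ge0 _)).
  move=> s _.
  pose c' (i : I * nat) (a' : m.-tuple (idx N)) :=
    tpoly (A i.2) (fun b => c i.1 [tuple of b :: a']) s.
  have c'D i : \sum_a' `|c' i a'| <= D.
    apply: le_trans (cD i.1); rewrite big_tuple_cons exchange_big/=.
    by apply: ler_sum => a' _; apply: tpoly_norm_le.
  have := IH N _ c' D c'D.
  rewrite (_ : msup _ = fun y => MA (tcons s y)); last first.
    apply/funext => y; apply/esym.
    apply: (@msup_bij _ _ _ _ _ _
      (fun k : I * m.+1.-tuple nat => ((k.1, thead k.2), [tuple of behead k.2]))
      (fun k : (I * nat) * m.-tuple nat => (k.1.1, [tuple of k.1.2 :: k.2]))).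
      by move=> [[i n0] nu] /=; congr (_, _); exact/val_inj.
    move=> [i nu]; rewrite mtpoly_tcons_tail /=; congr mtpoly.
    apply/funext => j; rewrite [in LHS](tuple_eta nu) (tnthS (thead nu) [tuple of behead nu]).
    by [].
  rewrite (_ : msup _ = fun y => MX (tcons s y))//.
  apply/funext => y; apply/esym.
  apply: (@msup_bij _ _ _ _ _ _
      (fun k : I * (nat * m.-tuple nat) => ((k.1, k.2.1), k.2.2))
      (fun k : (I * nat) * m.-tuple nat => (k.1.1, (k.1.2, k.2)))).
    by move=> [[i n0] nu].
  move=> [i [n0 nu]]; rewrite mtpoly_tcons_tail /=; congr mtpoly.
    by apply/funext => j; rewrite /Lmix liftK.
  by apply/funext => a'; rewrite /c' /Lmix unlift_none.
have step2 : (\int[mu]_(s in circle) \int[lam m]_(y in torus R m) MX (tcons s y) <=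
    C%:E * \int[mu]_(s in circle) \int[lam m]_(y in torus R m) MP (tcons s y))%E.
  have mtc F : measurable_fun setT F ->
      measurable_fun setT (fun z : T * m.-tuple T => F (tcons z.1 z.2) : \bar R).
    by move=> mF; exact: (measurableT_comp mF (@measurable_tcons R m)).
  have sw F : measurable_fun setT F -> (forall x, 0 <= F x)%E ->
     (\int[mu]_(s in circle) \int[lam m]_(y in torus R m) F (tcons s y) =
      \int[lam m]_(y in torus R m) \int[mu]_(s in circle) F (tcons s y))%E.
    move=> mF F0; apply: (integral_torus_swap (F := fun z => F (tcons z.1 z.2))) => //.
    exact: mtc.
  rewrite (sw _ mMX); last by move=> x; exact: msup_ge0.
  rewrite (sw _ mMP); last by move=> x; exact: msup_ge0.
  rewrite -ge0_integralZl_EFin ?(ltW C0)//; first last.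
  - by apply: (mint2 _ mMP (msup_ge0 _)).
  - by move=> s _; apply: integral_ge0 => y _; exact: msup_ge0.
  - exact: measurable_torus.
  apply: ge0_le_integral.
  - exact: measurable_torus.
  - by move=> s _; apply: integral_ge0 => y _; exact: msup_ge0.
  - exact: (mint2 _ mMX (msup_ge0 _)).
  - apply: measurable_funeM; exact: (mint2 _ mMP (msup_ge0 _)).
  move=> y _.
  pose c' (i : I * m.-tuple nat) (b : idx N) :=
    mtpoly (fun j => P (tnth i.2 j)) (fun a' => c i.1 [tuple of b :: a']) y.
  have c'D i : \sum_b `|c' i b| <= D.
    apply: le_trans (cD i.1); rewrite big_tuple_cons.
    by apply: ler_sum => a' _; apply: mtpoly_norm_le.
  have := H1 N _ c' D c'D.
  rewrite (_ : msup _ = fun s => MX (tcons s y)); last first.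
    apply/funext => s; apply/esym.
    apply: (@msup_bij _ _ _ _ _ _
        (fun k : I * (nat * m.-tuple nat) => ((k.1, k.2.2), k.2.1))
        (fun k : (I * m.-tuple nat) * nat => (k.1.1, (k.2, k.1.2)))).
      by move=> [[i n0] nu].
    move=> [i [n0 nu]]; rewrite mtpoly_tcons_head /=; congr tpoly.
      by rewrite /Lmix unlift_none.
    apply/funext => a'; rewrite /c'; congr mtpoly.
    by apply/funext => j; rewrite /Lmix liftK.
  rewrite (_ : msup _ = fun s => MP (tcons s y))//.
  apply/funext => s; apply/esym.
  apply: (@msup_bij _ _ _ _ _ _
      (fun k : I * m.+1.-tuple nat => ((k.1, [tuple of behead k.2]), thead k.2))
      (fun k : (I * m.-tuple nat) * nat => (k.1.1, [tuple of k.2 :: k.1.2]))).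
    by move=> [[i nu] n0] /=; congr (_, _, _); exact/val_inj.
  move=> [i nu]; rewrite mtpoly_tcons_head /=; congr tpoly.
  apply/funext => a'; rewrite /c'; congr mtpoly.
  apply/funext => j /=; rewrite [in LHS](tuple_eta nu) (tnthS (thead nu) [tuple of behead nu]).
  by [].
rewrite exprSr EFinM -muleA; apply: (le_trans step1).
by apply: lee_wpmul2l; rewrite ?lee_fin ?exprn_ge0 ?(ltW C0).
Qed.

End TensorPolynomials.

(** * The Poisson kernel *)

Section PoissonKernel.
Variable R : realType.
Implicit Types (t x : R).

(** The periodic Poisson kernel in real form. *)
Definition pois t x : R := limn (fun N => cosker N (fun k => expR (- t * k%:R)) x).

Lemma expR_mul_le (t t0 : R) (k : nat) : t0 <= t ->
  `|expR (- t * k%:R)| <= expR (- t0) ^+ k.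
Proof.
move=> t0t; rewrite ger0_norm ?expR_ge0// -expRM_natl ler_expR -mulr_natl.
by rewrite [leRHS]mulrC ler_wpM2r// lerN2.
Qed.

(** Multipliers dominated by a geometric sequence, uniformly in the point. *)
Section GeometricTail.
Variable q : R.
Hypotheses (q0 : 0 < q) (q1 : q < 1).

Lemma cosker_tail N j L x : (forall k, `|L k| <= q ^+ k) ->
  `|cosker (N + j) L x - cosker N L x| <= 2 / (1 - q) * (q ^+ N - q ^+ (N + j)).
Proof.
move=> Lq; elim: j => [|j IH]; first by rewrite addn0 !subrr normr0 mulr0.
rewrite addnS coskerS addrAC (le_trans (ler_normD _ _))//.
have -> : q ^+ N - q ^+ (N + j).+1 =
    q ^+ N - q ^+ (N + j) + (q ^+ (N + j) - q ^+ (N + j).+1) by ring.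
rewrite mulrDr lerD//.
have -> : 2 / (1 - q) * (q ^+ (N + j) - q ^+ (N + j).+1) = 2 * q ^+ (N + j).
  by rewrite exprS; field; rewrite subr_eq0 gt_eqF.
rewrite !normrM (ger0_norm (ler0n _ _)) -mulrA ler_wpM2l//.
rewrite (@le_trans _ _ (q ^+ (N + j).+1 * 1))//.
  by rewrite ler_pM// cos_max.
by rewrite mulr1 exprS ler_piMl ?exprn_ge0 ?(ltW q0) ?(ltW q1).
Qed.

Lemma cosker_geometric_le N L x : (forall k, `|L k| <= q ^+ k) ->
  `|cosker N L x| <= 1 + 2 / (1 - q).
Proof.
move=> Lq; have h0 : `|cosker 0 L x| <= 1.
  rewrite /cosker big_ord_recl big_ord0 addr0 /mult_of_freq/= mul1r mul0r cos0 mulr1.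
  by have := Lq 0%N; rewrite expr0.
have := cosker_tail 0 N x Lq; rewrite add0n expr0 => h1.
rewrite -(subrK (cosker 0 L x) (cosker N L x)) addrC (le_trans (ler_normD _ _))// lerD//.
rewrite (le_trans h1)// ler_piMr ?divr_ge0 ?subr_ge0 ?(ltW q1)//.
by rewrite lerBlDr lerDl exprn_ge0// ltW.
Qed.

Lemma cosker_geometric_cvg L x : (forall k, `|L k| <= q ^+ k) ->
  cvgn (fun N => cosker N L x).
Proof.
move=> Lq; pose u k := mult_of_freq R k * L k * cos (k%:R * x).
have -> : (fun N => cosker N L x) = (fun N => series u (N + 1)%N).
  by apply/funext => N; rewrite /series/= addn1 big_mkord.
have hu : cvgn (series u).
  have h1 n : 0 <= `|u n| by exact: normr_ge0.
  have h2 n : 0 <= geometric 2 q n.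
    by rewrite /geometric/= mulr_ge0// exprn_ge0// ltW.
  have h3 n : `|u n| <= geometric 2 q n.
    rewrite /geometric/= /u !normrM -[leRHS]mulr1.
    rewrite ler_pM ?mulr_ge0 ?cos_max// ler_pM//.
    by rewrite /mult_of_freq; case: ifP; rewrite ger0_norm// ler1n.
  have h4 : cvgn (series (geometric 2 q)).
    by apply: is_cvg_geometric_series; rewrite gtr0_norm.
  exact: normed_cvg (series_le_cvg h1 h2 h3 h4).
move/cvg_ex : hu => [l hl]; apply/cvg_ex; exists l.
by rewrite (cvg_shiftn 1 (series u)).
Qed.

End GeometricTail.

Lemma expRN_lt1 t : 0 < t -> expR (- t) < 1.
Proof. by move=> t0; rewrite -expR0 ltr_expR oppr_lt0. Qed.

Lemma pois_cvg t x : 0 < t ->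
  (fun N => cosker N (fun k => expR (- t * k%:R)) x) @ \oo --> pois t x.
Proof.
move=> t0; apply: (cosker_geometric_cvg (q := expR (- t))) => [||k].
- exact: expR_gt0.
- exact: expRN_lt1.
- exact: expR_mul_le.
Qed.

Lemma pois_cosker_le t0 t N x : 0 < t0 -> t0 <= t ->
  `|pois t x - cosker N (fun k => expR (- t * k%:R)) x| <=
  2 / (1 - expR (- t0)) * expR (- t0) ^+ N.
Proof.
move=> t00 t0t; have t0' : 0 < t by exact: lt_le_trans t0t.
set L := fun k => _.
have q0 : 0 < expR (- t0) := expR_gt0 _; have q1 := expRN_lt1 t00.
have h : (fun j => `|cosker (j + N) L x - cosker N L x|) @ \oo -->
    `|pois t x - cosker N L x|.
  apply: cvg_norm; apply: cvgB; last exact: cvg_cst.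
  by rewrite (cvg_shiftn N (fun j => cosker j L x)); exact: pois_cvg.
have <- := cvg_lim (@Rhausdorff R) h.
apply: limr_le; first by apply/cvg_ex; eexists; exact: h.
apply: nearW => j; rewrite addnC.
apply: (le_trans (cosker_tail q0 q1 N j x (fun k => expR_mul_le k t0t))).
rewrite ler_wpM2l ?divr_ge0 ?subr_ge0 ?(ltW q1)//.
by rewrite lerBlDr lerDl exprn_ge0// ltW.
Qed.

Lemma pois_norm_le t0 t x : 0 < t0 -> t0 <= t ->
  `|pois t x| <= 1 + 2 / (1 - expR (- t0)).
Proof.
move=> t00 t0t; have t0' : 0 < t by exact: lt_le_trans t0t.
have h : (fun N => `|cosker N (fun k => expR (- t * k%:R)) x|) @ \oo --> `|pois t x|.
  by apply: cvg_norm; exact: pois_cvg.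
have <- := cvg_lim (@Rhausdorff R) h.
apply: limr_le; first by apply/cvg_ex; eexists; exact: h.
apply: nearW => j; apply: (cosker_geometric_le (expR_gt0 _) (expRN_lt1 t00)) => k.
exact: expR_mul_le.
Qed.

Lemma continuous_cosker1 N L : continuous (@cosker R N L).
Proof.
have := @continuous_cosker R N L 0; move=> h x.
have -> : cosker N L = (fun w => @cosker R N L (0 - w)) \o -%R.
  by apply/funext => w /=; rewrite sub0r opprK.
by apply: continuous_comp; [exact: oppr_continuous|exact: h].
Qed.

Lemma measurable_pois t : 0 < t -> measurable_fun setT (pois t).
Proof.
move=> t0; apply: (measurable_fun_cvg (h := fun N => cosker N (fun k => expR (- t * k%:R)))).
  by move=> N; apply: continuous_measurable_fun; exact: continuous_cosker1.
by move=> x _; exact: pois_cvg.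
Qed.

End PoissonKernel.

(** * Convolutions on the torus *)

Section TorusConvolution.
Variable R : realType.
Local Notation T := (measurableTypeR R).
Local Notation lam := (lebesgue_tuple R).
Local Notation circle := (@circle R : set T).

Lemma big_prod_sum_tuple (I : finType) m (F : 'I_m -> I -> R) :
  \prod_(j < m) \sum_a F j a = \sum_(t : m.-tuple I) \prod_(j < m) F j (tnth t j).
Proof.
elim: m F => [|m IH] F.
  rewrite big_ord0 (eq_bigr (fun=> 1)); last by move=> t _; rewrite big_ord0.
  by rewrite sumr_const card_tuple expn0.
rewrite big_tuple_cons big_ord_recl IH mulr_suml; apply: eq_bigr => b _.
rewrite mulr_sumr; apply: eq_bigr => t _; rewrite big_ord_recl (tnth0 b t).
by congr (_ * _); apply: eq_bigr => j _; rewrite (tnthS b t).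
Qed.

Lemma prod_diff_le m (a b : 'I_m -> R) (B d : R) : 1 <= B -> 0 <= d ->
  (forall j, `|a j| <= B) -> (forall j, `|b j| <= B) ->
  (forall j, `|a j - b j| <= d) ->
  `|\prod_j a j - \prod_j b j| <= m%:R * B ^+ m * d.
Proof.
move=> B1 d0; elim: m a b => [|m IH] a b aB bB ab.
  by rewrite !big_ord0 subrr normr0 !mul0r.
have B0 : 0 <= B by rewrite (le_trans ler01).
rewrite !big_ord_recl.
set A := \prod_(i < m) _; set A' := \prod_(i < m) b _.
have -> : a ord0 * A - b ord0 * A' = (a ord0 - b ord0) * A + b ord0 * (A - A') by ring.
have hA : `|A| <= B ^+ m.
  rewrite normr_prod -[m in leRHS]card_ord -prodr_const.
  by apply: ler_prod => j _; rewrite normr_ge0 aB.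
rewrite (le_trans (ler_normD _ _))// !normrM.
have h1 : `|a ord0 - b ord0| * `|A| <= d * B ^+ m by rewrite ler_pM.
have h2 : `|b ord0| * `|A - A'| <= B * (m%:R * B ^+ m * d).
  by apply: ler_pM => //; apply: IH => j; [exact: aB|exact: bB|exact: ab].
rewrite (le_trans (lerD h1 h2))// -natr1 exprS.
have : B ^+ m <= B * B ^+ m by rewrite ler_peMl// exprn_ge0.
have := mulr_ge0 d0 (exprn_ge0 m B0).
move: (B ^+ m) => X dX /(ler_wpM2r d0).
nra.
Qed.

Lemma torus_measure m : lam m (torus R m) = ((2 * pi) ^+ m)%:E.
Proof.
rewrite (_ : torus R m = [set x | forall j, circle (tnth x j)]).
  rewrite (lebesgue_tuple_box (A := fun=> circle)); last by move=> _; exact: measurable_circleT.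
  under eq_bigr do rewrite circle_measure.
  by rewrite prodEFin prodr_const card_ord.
by apply/seteqP; split=> x /= h j; apply/circleP; exact: h.
Qed.

Section Fixed.
Variables (m : nat) (g : m.-tuple T -> R).
Hypothesis ig : (lam m).-integrable (torus R m) (EFin \o g).

Let mg : measurable_fun (torus R m) g.
Proof. by move/integrableP : ig => [/measurable_EFinP]. Qed.

Definition L1norm : R := \int[lam m]_(y in torus R m) `|g y|.

Lemma integrable_mul_bounded (h : m.-tuple T -> R) (B : R) :
  measurable_fun setT h -> (forall y, `|h y| <= B) ->
  (lam m).-integrable (torus R m) (EFin \o (fun y => g y * h y)).
Proof.
move=> mh hB.
have iB : (lam m).-integrable (torus R m) (fun y => B%:E * (EFin \o g) y)%E.
  by apply: integrableZl => //; exact: measurable_torus.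
apply: (le_integrable _ _ _ iB) => //.
- exact: measurable_torus.
- apply/measurable_EFinP; apply: measurable_funM => //.
  exact: (@measurable_funS _ _ _ _ setT).
- move=> y _ /=; rewrite lee_fin !normrM mulrC ler_wpM2r//.
  by rewrite (le_trans (hB y)) ?ler_norm.
Qed.

Lemma Rintegral_mul_bounded_le (h : m.-tuple T -> R) (B : R) :
  measurable_fun setT h -> (forall y, `|h y| <= B) ->
  `|\int[lam m]_(y in torus R m) (g y * h y)| <= B * L1norm.
Proof.
move=> mh hB; have mt := @measurable_torus R m.
have igh := integrable_mul_bounded mh hB.
have := le_normr_Rintegral mt igh; move=> /le_trans; apply.
rewrite /L1norm -RintegralZl//; last first.
  by apply: (integrable_norm ig).
apply: le_Rintegral => //.
- by apply: (integrable_norm igh).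
- exact: (integrableZl mt B (integrable_norm ig)).
- by move=> y _; rewrite normrM mulrC ler_wpM2r.
Qed.

(** Convolution with a tensor product of kernels, for normalised Lebesgue
measure. *)
Definition tconv (K : 'I_m -> R -> R) (x : m.-tuple T) : R :=
  (2 * pi) ^- m *
  \int[lam m]_(y in torus R m) (g y * \prod_(j < m) K j (tnth x j - tnth y j)).

Lemma measurable_kernel_prod (K : 'I_m -> R -> R) x :
  (forall j, measurable_fun setT (K j)) ->
  measurable_fun setT (fun y : m.-tuple T => \prod_(j < m) K j (tnth x j - tnth y j)).
Proof.
move=> mK; apply: measurable_prod => j _.
apply: (@measurableT_comp _ _ _ _ _ _ (K j)) => //.
by apply: measurable_funB => //; exact: measurable_tnth.
Qed.

Lemma kernel_prod_le (K : 'I_m -> R -> R) (B : R) (x y : m.-tuple T) :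
  (forall j s, `|K j s| <= B) ->
  `|\prod_(j < m) K j (tnth x j - tnth y j)| <= B ^+ m.
Proof.
move=> KB; rewrite normr_prod -[m in leRHS]card_ord -prodr_const.
by apply: ler_prod => j _; rewrite normr_ge0 KB.
Qed.

Lemma two_pi_expV_le1 : 0 <= (2 * pi : R) ^- m <= 1.
Proof.
have p0 : 0 <= 2 * pi :> R by rewrite mulr_ge0// pi_ge0.
rewrite invr_ge0 exprn_ge0//= -exprVn exprn_ile1 ?invr_ge0//.
exact: two_pi_inv_le1.
Qed.

(** Uniform closeness of the kernels is enough, since [g] is integrable; this is
how every approximation of a mean is estimated. *)
Lemma tconv_diff_le (K K' : 'I_m -> R -> R) (B d : R) x : 1 <= B -> 0 <= d ->
  (forall j, measurable_fun setT (K j)) -> (forall j, measurable_fun setT (K' j)) ->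
  (forall j s, `|K j s| <= B) -> (forall j s, `|K' j s| <= B) ->
  (forall j s, `|K j s - K' j s| <= d) ->
  `|tconv K x - tconv K' x| <= m%:R * B ^+ m * d * L1norm.
Proof.
move=> B1 d0 mK mK' KB K'B KK'.
have mt := @measurable_torus R m.
have i1 := integrable_mul_bounded (measurable_kernel_prod x mK) (fun y => kernel_prod_le x y KB).
have i2 := integrable_mul_bounded (measurable_kernel_prod x mK') (fun y => kernel_prod_le x y K'B).
rewrite /tconv -mulrBr -RintegralB// normrM.
have /andP[p0 p1] := two_pi_expV_le1; rewrite ger0_norm//.
apply: le_trans (ler_piMl _ p1) _; first exact: normr_ge0.
under eq_Rintegral do rewrite -mulrBr.
apply: Rintegral_mul_bounded_le => [|y].
  by apply: measurable_funB; exact: measurable_kernel_prod.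
exact: prod_diff_le.
Qed.

(** Fourier coefficients in real form. *)
Definition tcoef N (t : m.-tuple (idx N)) : R :=
  (2 * pi) ^- m * \int[lam m]_(y in torus R m)
    (g y * \prod_(j < m) (mult_of_freq R (freq (tnth t j)) * trig (tnth t j) (tnth y j))).

Lemma cosker_sub N (L : nat -> R) (s w : R) : cosker N L (s - w) =
  \sum_(a : idx N) mult_of_freq R (freq a) * trig a w * (L (freq a) * trig a s).
Proof.
rewrite -(pair_bigA _ (fun k b => mult_of_freq R (freq (k, b)) * trig (k, b) w *
  (L (freq (k, b)) * trig (k, b) s)))/=.
apply: eq_bigr => k _; rewrite big_bool /= /trig /freq/=.
by rewrite !subr0 mulrBr cosB !cosB cos_pihalf sin_pihalf; ring.
Qed.

Lemma Rintegral_sum_bounded (I : Type) (r : seq I) (h : I -> m.-tuple T -> R) (B : I -> R) :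
  (forall i, measurable_fun setT (h i)) -> (forall i y, `|h i y| <= B i) ->
  \int[lam m]_(y in torus R m) (g y * \sum_(i <- r) h i y) =
  \sum_(i <- r) \int[lam m]_(y in torus R m) (g y * h i y).
Proof.
move=> mh hB; have mt := @measurable_torus R m.
elim: r => [|i r IH].
  rewrite big_nil; under eq_Rintegral do rewrite big_nil mulr0.
  by rewrite Rintegral_cst ?mul0r.
rewrite big_cons -IH -RintegralD//; first last.
- apply: (integrable_mul_bounded (B := \sum_(i <- r) B i)).
    exact: measurable_sum.
  by move=> y; rewrite (le_trans (ler_norm_sum _ _ _))// ler_sum.
- exact: (integrable_mul_bounded (B := B i)).
by apply: eq_Rintegral => y _; rewrite big_cons mulrDr.
Qed.

Lemma mult_of_freq_bound k : 0 <= mult_of_freq R k <= 2.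
Proof. by rewrite /mult_of_freq; case: ifP => _; rewrite ?ler0n ?ler01 ?lexx ?ler1n. Qed.

Lemma tconv_mtpoly N (L : 'I_m -> nat -> R) x :
  tconv (fun j => cosker N (L j)) x = mtpoly L (@tcoef N) x.
Proof.
pose tr (t : m.-tuple (idx N)) (y : m.-tuple T) : R :=
  \prod_(j < m) (mult_of_freq R (freq (tnth t j)) * trig (tnth t j) (tnth y j)).
have mtr t : measurable_fun setT (tr t).
  apply: measurable_prod => j _; apply: measurable_funM; first exact: measurable_cst.
  apply: (@measurableT_comp _ _ _ _ _ _ (trig (tnth t j) : T -> R)).
    exact: continuous_measurable_fun (@continuous_trig R N (tnth t j)).
  exact: measurable_tnth.
have btr t y : `|tr t y| <= 2 ^+ m.
  rewrite normr_prod -[m in leRHS]card_ord -prodr_const.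
  apply: ler_prod => j _; rewrite normr_ge0 normrM/=.
  have /andP[h1 h2] := mult_of_freq_bound (freq (tnth t j)).
  by rewrite -[leRHS]mulr1 ler_pM// ?trig_norm_le1// ger0_norm.
pose cx (t : m.-tuple (idx N)) :=
  \prod_(j < m) (L j (freq (tnth t j)) * trig (tnth t j) (tnth x j)).
have E : \int[lam m]_(y in torus R m) (g y * \sum_t tr t y * cx t) =
    \sum_t \int[lam m]_(y in torus R m) (g y * (tr t y * cx t)).
  apply: (@Rintegral_sum_bounded _ _ (fun t y => tr t y * cx t)
    (fun t => 2 ^+ m * `|cx t|)) => [t|t y].
    by apply: measurable_funM; [exact: mtr|exact: measurable_cst].
  by rewrite normrM ler_wpM2r// btr.
rewrite /tconv (_ : (fun y => _) = fun y => g y * \sum_t tr t y * cx t).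
  rewrite E.
  rewrite mulr_sumr; apply: eq_bigr => t _; rewrite /tcoef -mulrA; congr (_ * _).
  under eq_Rintegral do rewrite mulrA.
  rewrite RintegralZr//.
    exact: measurable_torus.
  exact: (integrable_mul_bounded (mtr t) (btr t)).
apply/funext => y; congr (_ * _).
rewrite (eq_bigr _ (fun j _ => cosker_sub _ _ _ _)) big_prod_sum_tuple.
by apply: eq_bigr => t _; rewrite big_split.
Qed.

End Fixed.
End TorusConvolution.

(** * Riesz means against Poisson means on the torus *)

Section RieszLePoisson.
Variable R : realType.
Local Notation T := (measurableTypeR R).
Local Notation lam := (lebesgue_tuple R).

Lemma limn_einf_ge (u : (\bar R)^nat) (y : \bar R) N :
  (forall n, (N <= n)%N -> (y <= u n)%E) -> (y <= limn_einf u)%E.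
Proof.
move=> h; rewrite limn_einf_lim.
have -> := cvg_lim (@ereal_hausdorff R) (@cvg_einfs_sup R u).
apply: (@le_trans _ _ (einfs u N)); last by apply: ereal_sup_ubound; exists N.
by apply: le_ereal_inf_tmp => z /= [n Nn <-]; exact: h.
Qed.

Lemma limn_einf_le (u : (\bar R)^nat) (y : \bar R) :
  (forall n, (u n <= y)%E) -> (limn_einf u <= y)%E.
Proof.
move=> h; rewrite limn_einf_lim.
have -> := cvg_lim (@ereal_hausdorff R) (@cvg_einfs_sup R u).
apply: ge_ereal_sup => z /= [n _ <-]; apply: (@le_trans _ _ (u n)) => //.
by apply: ereal_inf_lbound; exists n => //=.
Qed.

Definition riesz_conv (ga al : R) m (g : m.-tuple T -> R) (nu : m.-tuple nat) :=
  tconv g (fun j => cosker (tnth nu j).+1 (riesz ga al 0 (tnth nu j).+1)).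

(** The parameter [1 / (nu_j + 1)] of the Poisson mean, delayed by the time
[1 / (r + 1)] during which the function has been smoothed, where
[k = (r, nu)]. *)
Definition poisson_time m (k : nat * m.-tuple nat) (j : 'I_m) : R :=
  (tnth k.2 j).+1%:R^-1 + k.1.+1%:R^-1.

Definition pois_conv m (g : m.-tuple T -> R) (k : nat * m.-tuple nat) :=
  tconv g (fun j => pois (poisson_time k j)).

Lemma poisson_time_gt0 m (k : nat * m.-tuple nat) j : 0 < poisson_time k j.
Proof. by rewrite /poisson_time addr_gt0// invr_gt0 ltr0n. Qed.

Lemma cosker_eq N (L L' : nat -> R) x :
  (forall k, (k <= N)%N -> L k = L' k) -> cosker N L x = cosker N L' x.
Proof. by move=> h; apply: eq_bigr => k _; rewrite h// -ltnS. Qed.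

Lemma cosker_vanish N j (L : nat -> R) x :
  (forall k, (N < k)%N -> L k = 0) -> cosker (N + j) L x = cosker N L x.
Proof.
move=> h; elim: j => [|j IH]; first by rewrite addn0.
by rewrite addnS coskerS IH h ?mulr0 ?mul0r ?addr0// ltnS leq_addr.
Qed.

Lemma measurable_cosker N (L : nat -> R) : measurable_fun setT (cosker N L).
Proof. by apply: continuous_measurable_fun; exact: continuous_cosker1. Qed.

Section Approximation.
Context (m : nat) (g : m.-tuple T -> R).
Hypothesis ig : (lam m).-integrable (torus R m) (EFin \o g).

(** The coefficients of the smoothed function, up to the degree [N] in each
variable. *)
Definition smooth_coef r N (t : m.-tuple (idx N)) : R :=
  tcoef g t * \prod_(j < m) poisson_seq R r.+1 (freq (tnth t j)).

Lemma mtpoly_smooth_coef r N (L : 'I_m -> nat -> R) x :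
  mtpoly L (@smooth_coef r N) x =
  tconv g (fun j => cosker N (fun k => L j k * poisson_seq R r.+1 k)) x.
Proof.
rewrite tconv_mtpoly//; apply: eq_bigr => t _.
rewrite /smooth_coef -mulrA -big_split/=; congr (_ * _).
by apply: eq_bigr => j _; ring.
Qed.

Let q r : R := expR (- r.+1%:R^-1).
Let q0 r : 0 < q r. Proof. exact: expR_gt0. Qed.
Let q1 r : q r < 1. Proof. by apply: expRN_lt1; rewrite invr_gt0 ltr0n. Qed.
Let B r : R := 1 + 2 / (1 - q r).
Let B1 r : 1 <= B r.
Proof. by rewrite lerDl divr_ge0// subr_ge0 ltW. Qed.

(** The quantity to be made small is the error made by truncating the Poisson
kernels in the convolution with [g]; it decreases geometrically in [N], and
[N r >= r] ensures that every Riesz mean is eventually unaffected. *)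
Lemma truncation_exists (eps : R) : 0 < eps -> exists N : nat -> nat, forall r,
  (r <= N r)%N /\ m%:R * B r ^+ m * (2 / (1 - q r) * q r ^+ N r) * L1norm g <= eps.
Proof.
move=> e0; suff H r : exists N, (r <= N)%N /\
    m%:R * B r ^+ m * (2 / (1 - q r) * q r ^+ N) * L1norm g <= eps.
  by have [N NP] := choice H; exists N.
have h : (fun N => m%:R * B r ^+ m * (2 / (1 - q r) * q r ^+ N) * L1norm g) @ \oo --> 0.
  rewrite [X in _ --> X](_ : 0 = m%:R * B r ^+ m * (2 / (1 - q r) * 0) * L1norm g).
    apply: cvgMl; apply: cvgMr; apply: cvgMr; apply: cvg_expr.
    by rewrite gtr0_norm.
  by rewrite !mulr0 mul0r.
have /cvgrPdist_le /(_ _ e0) [N0 _ hN] := h.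
exists (maxn r N0); split; first exact: leq_maxl.
have := hN (maxn r N0) (leq_maxr _ _); rewrite sub0r normrN.
by apply: le_trans; exact: ler_norm.
Qed.

Lemma poisson_product n r k :
  poisson_seq R n.+1 k * poisson_seq R r.+1 k =
  expR (- (n.+1%:R^-1 + r.+1%:R^-1) * k%:R).
Proof. by rewrite -expRD; congr expR; move: (n.+1%:R^-1) (r.+1%:R^-1) (k%:R : R) => a b c; ring. Qed.

Lemma poisson_approx (eps : R) (N : nat -> nat) r (nu : m.-tuple nat) x :
  m%:R * B r ^+ m * (2 / (1 - q r) * q r ^+ N r) * L1norm g <= eps ->
  `|mtpoly (fun j => poisson_seq R (tnth nu j).+1) (@smooth_coef r (N r)) x -
    pois_conv g (r, nu) x| <= eps.
Proof.
apply: le_trans; rewrite mtpoly_smooth_coef /pois_conv.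
have r0 : 0 < r.+1%:R^-1 :> R by rewrite invr_gt0 ltr0n.
have tr j : r.+1%:R^-1 <= poisson_time (r, nu) j.
  by rewrite /poisson_time lerDr invr_ge0.
apply: tconv_diff_le => //.
- by rewrite mulr_ge0 ?divr_ge0 ?subr_ge0 ?exprn_ge0 ?(ltW (q1 r)) ?(ltW (q0 r)).
- by move=> j; exact: measurable_cosker.
- by move=> j; apply: measurable_pois; exact: poisson_time_gt0.
- move=> j s; apply: (cosker_geometric_le (q0 r) (q1 r)) => k.
  by rewrite poisson_product; exact: (expR_mul_le k (tr j)).
- by move=> j s; exact: pois_norm_le.
- move=> j s; rewrite distrC.
  rewrite (_ : (fun k => poisson_seq R (tnth nu j).+1 k * poisson_seq R r.+1 k) =
      fun k => expR (- poisson_time (r, nu) j * k%:R)).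
    exact: pois_cosker_le.
  by apply/funext => k; exact: poisson_product.
Qed.

(** A Riesz mean involves finitely many frequencies, on which the smoothing tends
to the identity. *)
Lemma riesz_approx (ga al : R) (N : nat -> nat) (nu : m.-tuple nat) x (eps : R) :
  0 <= ga -> 0 <= al -> (forall r, (r <= N r)%N) -> 0 < eps ->
  exists r0, forall r, (r0 <= r)%N ->
  `|mtpoly (fun j => riesz ga al 0 (tnth nu j).+1) (@smooth_coef r (N r)) x -
    riesz_conv ga al g nu x| <= eps.
Proof.
move=> ga0 al0 rN e0.
pose n := \max_(j < m) (tnth nu j).+1.
have nun j : ((tnth nu j).+1 <= n)%N by exact: (@leq_bigmax _ (fun j => (tnth nu j).+1)).
pose Bn : R := 2 * n.+1%:R.
have Bn1 : 1 <= Bn.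
  by rewrite /Bn -natrM ler1n.
pose d r : R := Bn * (1 - q r ^+ n).
have h : (fun r => m%:R * Bn ^+ m * d r * L1norm g) @ \oo --> 0.
  rewrite [X in _ --> X](_ : 0 = m%:R * Bn ^+ m * (Bn * (1 - 1 ^+ n)) * L1norm g); last first.
    by rewrite expr1n subrr !mulr0 mul0r.
  apply: cvgMl; apply: cvgMr; apply: cvgMr; apply: cvgB; first exact: cvg_cst.
  have cq : q @ \oo --> (1 : R).
    rewrite -(expR0 R) -[X in expR X]oppr0.
    apply: (@cvg_comp _ _ _ (fun r => - r.+1%:R^-1 : R) (@expR R)); last exact: continuous_expR.
    by apply: cvgN; exact: cvg_harmonic.
  apply: (@cvg_comp _ _ _ q (fun x : R => x ^+ n) _ _ _ cq).
  exact: exprn_continuous.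
have /cvgrPdist_le /(_ _ e0) [r0 _ hr] := h.
exists (maxn r0 n) => r; rewrite geq_max => /andP[r0r nr].
have := hr r r0r; rewrite sub0r normrN => /(le_trans (ler_norm _)); apply: le_trans.
rewrite mtpoly_smooth_coef /riesz_conv.
have q01 : 0 <= q r <= 1 by rewrite (ltW (q0 r)) (ltW (q1 r)).
have pq k : poisson_seq R r.+1 k = q r ^+ k by exact: poisson_seqX.
have Lz j k : ((tnth nu j).+1 < k)%N -> riesz ga al 0 (tnth nu j).+1 k = 0 :> R.
  by move=> h1; rewrite /riesz leqNgt h1.
have L1 j k : `|riesz ga al 0 (tnth nu j).+1 k| <= 1 :> R by exact: riesz_seq_le1.
have mono j : (fun s => cosker (N r) (fun k => riesz ga al 0 (tnth nu j).+1 k * poisson_seq R r.+1 k) s) =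
    cosker (tnth nu j).+1 (fun k => riesz ga al 0 (tnth nu j).+1 k * q r ^+ k).
  have h1 : ((tnth nu j).+1 <= N r)%N by rewrite (leq_trans (nun j))// (leq_trans nr).
  apply/funext => s; rewrite -(subnKC h1) cosker_vanish; last by move=> k /Lz ->; rewrite mul0r.
  by apply: cosker_eq => k _; rewrite pq.
rewrite (_ : (fun j => cosker (N r) _) = fun j => cosker (tnth nu j).+1
    (fun k => riesz ga al 0 (tnth nu j).+1 k * q r ^+ k)); last exact/funext.
have bd j s (L : nat -> R) (b : R) : 0 <= b -> (forall k, (k <= (tnth nu j).+1)%N -> `|L k| <= b) ->
    `|cosker (tnth nu j).+1 L s| <= Bn * b.
  move=> b0 Lb; apply: le_trans (cosker_norm_le _ Lb) _.
  by rewrite ler_wpM2r// ler_wpM2l// ler_nat ltnS.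
apply: tconv_diff_le => //.
- by rewrite mulr_ge0 ?subr_ge0 ?exprn_ile1 ?(ltW (q1 r)) ?(ltW (q0 r))// (le_trans ler01).
- by move=> j; exact: measurable_cosker.
- by move=> j; exact: measurable_cosker.
- move=> j s; rewrite -[leRHS]mulr1; apply: bd => // k _.
  rewrite normrM mulr_ile1 ?normr_ge0 ?L1// normrX ger0_norm ?(ltW (q0 r))//.
  by rewrite exprn_ile1 ?(ltW (q1 r)) ?(ltW (q0 r)).
- by move=> j s; rewrite -[leRHS]mulr1; apply: bd.
- move=> j s; rewrite /cosker -sumrB.
  have -> : \sum_(k < (tnth nu j).+2) (mult_of_freq R k * (riesz ga al 0 (tnth nu j).+1 k * q r ^+ k) * cos (k%:R * s) -
      mult_of_freq R k * riesz ga al 0 (tnth nu j).+1 k * cos (k%:R * s)) =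
      cosker (tnth nu j).+1 (fun k => riesz ga al 0 (tnth nu j).+1 k * (q r ^+ k - 1)) s.
    by apply: eq_bigr => k _; ring.
  apply: bd; first by rewrite subr_ge0 exprn_ile1 ?(ltW (q1 r)) ?(ltW (q0 r)).
  move=> k kn; rewrite normrM -[leRHS]mul1r ler_pM ?normr_ge0 ?L1//.
  rewrite distrC ger0_norm ?subr_ge0 ?exprn_ile1 ?(ltW (q1 r)) ?(ltW (q0 r))//.
  rewrite lerD2l lerN2; apply: ler_wiXn2l; [exact: ltW (q0 r)|exact: ltW (q1 r)|].
  exact: leq_trans kn (nun j).
Qed.

End Approximation.

Lemma measurable_tconv_cosker m (g : m.-tuple T -> R) (N : 'I_m -> nat) L :
  (lam m).-integrable (torus R m) (EFin \o g) ->
  measurable_fun setT (tconv g (fun j => cosker (N j) (L j))).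
Proof.
move=> ig.
pose M := \max_(j < m) N j.
have NM j : (N j <= M)%N by exact: (@leq_bigmax _ N).
pose L' j k := if (k <= N j)%N then L j k else 0.
have -> : (fun j => cosker (N j) (L j)) = (fun j => @cosker R M (L' j)).
  apply/funext => j; apply/funext => s; rewrite -(subnKC (NM j)) cosker_vanish.
    by apply: cosker_eq => k kN; rewrite /L' kN.
  by move=> k; rewrite /L' ltnNge => /negbTE ->.
rewrite (_ : tconv g _ = mtpoly L' (@tcoef R m g M)); first exact: measurable_mtpoly.
by apply/funext => x; rewrite tconv_mtpoly.
Qed.

Lemma measurable_riesz_conv ga al m (g : m.-tuple T -> R) nu :
  (lam m).-integrable (torus R m) (EFin \o g) ->
  measurable_fun setT (riesz_conv ga al g nu).
Proof. by move=> ig; exact: measurable_tconv_cosker. Qed.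

(** A uniform limit of trigonometric polynomials. *)
Lemma measurable_pois_conv m (g : m.-tuple T -> R) k :
  (lam m).-integrable (torus R m) (EFin \o g) ->
  measurable_fun setT (pois_conv g k).
Proof.
move=> ig; set t0 := (k.1.+1)%:R^-1 : R.
have t00 : 0 < t0 by rewrite invr_gt0 ltr0n.
have tk j : t0 <= poisson_time k j by rewrite /poisson_time lerDr invr_ge0.
set q := expR (- t0).
have q0 : 0 < q by exact: expR_gt0.
have q1 : q < 1 by exact: expRN_lt1.
set B := 1 + 2 / (1 - q).
have B1 : 1 <= B by rewrite lerDl divr_ge0// subr_ge0 ltW.
pose K N (j : 'I_m) := cosker N (fun l => expR (- poisson_time k j * l%:R)).
apply: (measurable_fun_cvg (h := fun N => tconv g (K N))).
  by move=> N; exact: measurable_tconv_cosker.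
move=> x _; apply/cvgrPdist_le => e e0.
have h : (fun N => m%:R * B ^+ m * (2 / (1 - q) * q ^+ N) * L1norm g) @ \oo --> 0.
  rewrite [X in _ --> X](_ : 0 = m%:R * B ^+ m * (2 / (1 - q) * 0) * L1norm g).
    apply: cvgMl; apply: cvgMr; apply: cvgMr; apply: cvg_expr.
    by rewrite gtr0_norm.
  by rewrite !mulr0 mul0r.
have /cvgrPdist_le /(_ _ e0) := h; apply: filterS => N.
rewrite sub0r normrN => /(le_trans (ler_norm _)); apply: le_trans.
apply: tconv_diff_le => //.
- by rewrite mulr_ge0 ?divr_ge0 ?subr_ge0 ?exprn_ge0 ?(ltW q1) ?(ltW q0).
- by move=> j; apply: measurable_pois; exact: poisson_time_gt0.
- by move=> j; exact: measurable_cosker.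
- by move=> j s; exact: pois_norm_le.
- move=> j s; apply: (cosker_geometric_le q0 q1) => l.
  exact: (expR_mul_le l (tk j)).
- by move=> j s; exact: pois_cosker_le.
Qed.

(** The smoothed functions [r] satisfy the inequality by [tensor_le]; their Poisson
means are Poisson means of [g] up to [eps], and their Riesz means converge to
those of [g], so that Fatou's lemma applies. *)
Lemma riesz_le_poisson_torus (ga al : R) m : 1 <= ga -> 0 < al ->
  exists2 C : R, 0 < C & forall g : m.-tuple T -> R,
  (lam m).-integrable (torus R m) (EFin \o g) ->
  (\int[lam m]_(x in torus R m) msup (riesz_conv ga al g) x <=
   C%:E * \int[lam m]_(x in torus R m) msup (pois_conv g) x)%E.
Proof.
move=> ga1 al0; have [C C0 CP] := riesz_le_poisson_circle ga1 al0.
have ga0 : 0 <= ga by rewrite (le_trans ler01).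
have al0' := ltW al0.
have TL := tensor_le C0 (A := fun n => riesz ga al 0 n.+1) (P := fun n => poisson_seq R n.+1)
  (fun n k => riesz_seq_le1 n.+1 k ga0 al0') (fun n k => poisson_seq_le1 R n.+1 k) CP (m := m).
exists (C ^+ m); first by rewrite exprn_gt0.
move=> g ig.
have mt := @measurable_torus R m.
have CM0 : (0 <= (C ^+ m)%:E)%E by rewrite lee_fin exprn_ge0// ltW.
have mS : measurable_fun (torus R m) (msup (pois_conv g)).
  apply: (@measurable_funS _ _ _ _ setT) => //.
  by apply: measurable_msup => k; exact: measurable_pois_conv.
set S := (\int[lam m]_(x in torus R m) msup (pois_conv g) x)%E.
set V : R := (2 * pi) ^+ m.
have V0 : 0 < V by rewrite exprn_gt0// mulr_gt0// pi_gt0.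
suff H eps : 0 < eps -> (\int[lam m]_(x in torus R m) msup (riesz_conv ga al g) x <=
   (C ^+ m)%:E * (S + eps%:E * V%:E))%E.
  apply/lee_addgt0Pr => e e0.
  have CV : 0 < C ^+ m * V by rewrite mulr_gt0// exprn_gt0.
  have := H (e / (C ^+ m * V)) (divr_gt0 e0 CV); move=> /le_trans; apply.
  rewrite ge0_muleDr; first last.
  - by rewrite -EFinM lee_fin mulr_ge0 ?divr_ge0 ?(ltW e0) ?(ltW CV) ?(ltW V0).
  - by apply: integral_ge0 => x _; exact: msup_ge0.
  rewrite leeD2l// lee_fin.
  by have -> : C ^+ m * (e / (C ^+ m * V) * V) = e by field; rewrite !gt_eqF// exprn_gt0.
move=> e0; have [N NP] := truncation_exists g e0.
pose MA r := msup (fun (k : unit * m.-tuple nat) x =>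
  mtpoly (fun j => riesz ga al 0 (tnth k.2 j).+1) (@smooth_coef m g r (N r)) x).
pose MP r := msup (fun (k : unit * m.-tuple nat) x =>
  mtpoly (fun j => poisson_seq R (tnth k.2 j).+1) (@smooth_coef m g r (N r)) x).
have mMA r : measurable_fun (torus R m) (MA r).
  apply: (@measurable_funS _ _ _ _ setT) => //.
  by apply: measurable_msup => k; exact: measurable_mtpoly.
have mMP r : measurable_fun (torus R m) (MP r).
  apply: (@measurable_funS _ _ _ _ setT) => //.
  by apply: measurable_msup => k; exact: measurable_mtpoly.
have MPS r x : (MP r x <= msup (pois_conv g) x + eps%:E)%E.
  apply: msup_le => [|[[] nu]]; first by rewrite adde_ge0 ?msup_ge0// lee_fin ltW.
  apply: le_trans (leeD2r _ (msup_ge _ (r, nu) x)); rewrite -EFinD lee_fin -lerBlDl.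
  apply: le_trans (lerB_dist _ _) _.
  by apply: poisson_approx => //; exact: (NP r).2.
have iMA r : (\int[lam m]_(x in torus R m) MA r x <= (C ^+ m)%:E * (S + eps%:E * V%:E))%E.
  apply: (le_trans (TL (N r) unit (fun _ => @smooth_coef m g r (N r)) _ (fun _ => lexx _))).
  apply: lee_wpmul2l => //.
  have -> : (S + eps%:E * V%:E = \int[lam m]_(x in torus R m) (msup (pois_conv g) x + eps%:E))%E.
    rewrite ge0_integralD//=; last 2 first.
    - by move=> x _; exact: msup_ge0.
    - by move=> x _; rewrite lee_fin ltW.
    congr (_ + _)%E; rewrite [RHS]integral_cst//; congr (_ * _)%E.
    exact/esym/torus_measure.
  apply: ge0_le_integral => //.
  - by move=> x _; exact: msup_ge0.
  - exact: mMP.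
  - by apply: emeasurable_funD => //; exact: measurable_cst.
  - by move=> x _; exact: MPS.
apply: (@le_trans _ _ (\int[lam m]_(x in torus R m) limn_einf (fun r => MA r x))%E); last first.
  apply: (le_trans (fatou _ mt mMA _)); last exact: limn_einf_le.
  by move=> r x _; exact: msup_ge0.
apply: ge0_le_integral => //.
- by move=> x _; exact: msup_ge0.
- apply: (@measurable_funS _ _ _ _ setT) => //.
  by apply: measurable_msup => k; exact: measurable_riesz_conv.
- apply: (@emeasurable_fun_cvg _ _ _ _ (fun n x => einfs (fun r => MA r x) n)).
    by apply: measurable_fun_einfs.
  by move=> x _; rewrite limn_einf_lim; exact: is_cvg_einfs.
move=> x _; apply: msup_le => [|nu].
  by apply: (@limn_einf_ge _ _ 0) => r _; exact: msup_ge0.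
apply/lee_addgt0Pr => e e0'.
rewrite -leeBlDr// -EFinB.
have [r0 r0P] := riesz_approx ig nu x ga0 al0' (fun r => (NP r).1) e0'.
apply: (@limn_einf_ge _ _ r0) => r /r0P h.
apply: le_trans (msup_ge _ (tt, nu) x); rewrite lee_fin lerBlDr -lerBlDl.
by apply: le_trans (lerB_dist _ _) _; rewrite distrC.
Qed.

End RieszLePoisson.

(** * Slices of an integrable function *)

Section Slicing.
Variable R : realType.
Local Notation T := (measurableTypeR R).
Local Notation mu := (@lebesgue_measure R).
Local Notation circle := (@circle R : set T).
Local Notation lam := (lebesgue_tuple R).

Section PartialIntegral.
Context d1 d2 (T1 : measurableType d1) (T2 : measurableType d2).
Context (m2 : {sigma_finite_measure set T2 -> \bar R}) (B : set T2) (f : T1 * T2 -> R).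
Hypotheses (mB : measurable B) (mf : measurable_fun setT f).

Lemma measurable_partial_integral_EFin :
  measurable_fun setT (fun x => \int[m2]_(y in B) (f (x, y))%:E)%E.
Proof.
have mf' : measurable_fun setT (EFin \o f) by exact/measurable_EFinP.
rewrite (_ : (fun x => _) = (fun x => \int[m2]_(y in B) (EFin \o f)^\+ (x, y) -
    \int[m2]_(y in B) (EFin \o f)^\- (x, y))%E); last first.
  apply/funext => x; rewrite [LHS]integralE.
  by congr (_ - _)%E; apply: eq_integral => y _; rewrite ?funeposE ?funenegE.
apply: emeasurable_funB.
- exact: (measurable_partial_integral m2 mB (measurable_funepos mf')
    (fun x => funepos_ge0 _ x)).
- exact: (measurable_partial_integral m2 mB (measurable_funeneg mf')
    (fun x => funeneg_ge0 _ x)).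
Qed.

Lemma measurable_partial_Rintegral :
  measurable_fun setT (fun x => \int[m2]_(y in B) f (x, y)).
Proof.
apply: (measurableT_comp (@fine_measurable R setT measurableT)).
exact: measurable_partial_integral_EFin.
Qed.

End PartialIntegral.

Variables (n : nat) (i : 'I_n.+1).

Definition slice (u : n.+1.-tuple T -> R) (b : T) (y : n.-tuple T) : R := u (tins i b y).

Lemma measurable_slice2 d (S : measurableType d) (u : n.+1.-tuple T -> \bar R)
    (b : S -> T) (y : S -> n.-tuple T) :
  measurable_fun setT u -> measurable_fun setT b -> measurable_fun setT y ->
  measurable_fun setT (fun z => u (tins i (b z) (y z))).
Proof.
move=> mu' mb my; apply: (measurableT_comp mu').
apply: (measurableT_comp (@measurable_tins R n i) (g := fun z => (b z, y z))).
exact/measurable_fun_pairP.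
Qed.

Lemma measurable_slice2_real d (S : measurableType d) (u : n.+1.-tuple T -> R)
    (b : S -> T) (y : S -> n.-tuple T) :
  measurable_fun setT u -> measurable_fun setT b -> measurable_fun setT y ->
  measurable_fun setT (fun z => slice u (b z) (y z)).
Proof.
move=> /measurable_EFinP mu' mb my; apply/measurable_EFinP.
exact: (measurable_slice2 (u := EFin \o u)).
Qed.

Section Integrable.
Variable W : n.+1.-tuple T -> R.
Hypotheses (mW : measurable_fun setT W)
  (iW : (lam n.+1).-integrable (torus R n.+1) (EFin \o W)).

Let mc : measurable circle. Proof. exact: measurable_circleT. Qed.
Let mt : measurable (torus R n). Proof. exact: measurable_torus. Qed.

Let mp (F : n.+1.-tuple T -> \bar R) : measurable_fun setT F -> (forall x, 0 <= F x)%E ->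
  measurable_fun circle (fun b => \int[lam n]_(y in torus R n) F (tins i b y))%E.
Proof.
move=> mF F0; apply: (@measurable_funS _ _ _ _ setT) => //.
apply: (measurable_partial_integral (lam n) (f := fun z : T * n.-tuple T => F (tins i z.1 z.2)) mt).
  exact: measurable_slice2.
by move=> z; exact: F0.
Qed.

Let mWp : measurable_fun setT (EFin \o W). Proof. exact/measurable_EFinP. Qed.

Lemma ae_slice_integrable :
  {ae mu, forall b, circle b -> (lam n).-integrable (torus R n) (EFin \o slice W b)}.
Proof.
have mA : measurable_fun setT (fun x => `|W x|%:E).
  by apply/measurable_EFinP; apply: measurableT_comp.
have fin : (\int[mu]_(b in circle) \int[lam n]_(y in torus R n) `|W (tins i b y)|%:E < +oo)%E.
  rewrite -(integral_torus_tins i mA); last by move=> x; rewrite lee_fin.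
  by move/integrableP : iW => [].
have iA : mu.-integrable circle (fun b => \int[lam n]_(y in torus R n) `|W (tins i b y)|%:E)%E.
  apply/integrableP; split; first exact: (mp mA).
  rewrite (_ : integral _ _ _ = \int[mu]_(b in circle) \int[lam n]_(y in torus R n) `|W (tins i b y)|%:E)%E//.
  by apply: eq_integral => b _; rewrite gee0_abs// integral_ge0// => y _; rewrite lee_fin.
have := integrable_ae mc iA; apply: filterS => b /[apply] h.
apply/integrableP; split.
  apply: (@measurable_funS _ _ _ _ setT) => //.
  apply: (measurableT_comp mWp).
  apply: (measurableT_comp (@measurable_tins R n i) (g := fun y : n.-tuple T => (b, y))).
  exact: measurable_pair1.
by rewrite -ge0_fin_numE// integral_ge0// => y _; rewrite lee_fin.
Qed.

(** The inner integral is kept extended-valued, since it makes sense for almost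
every [b] only. *)
Lemma Rintegral_torus_tins_le :
  (`|\int[lam n.+1]_(x in torus R n.+1) W x|%:E <=
   \int[mu]_(b in circle) `|\int[lam n]_(y in torus R n) (W (tins i b y))%:E|)%E.
Proof.
have mt1 := @measurable_torus R n.+1.
pose P b := (\int[lam n]_(y in torus R n) (EFin \o W)^\+ (tins i b y))%E.
pose Q b := (\int[lam n]_(y in torus R n) (EFin \o W)^\- (tins i b y))%E.
have m1 : measurable_fun setT ((EFin \o W)^\+)%E by exact: measurable_funepos.
have m2 : measurable_fun setT ((EFin \o W)^\-)%E by exact: measurable_funeneg.
have intP : mu.-integrable circle P.
  apply/integrableP; split; first by apply: (mp m1) => x; exact: funepos_ge0.
  have := integrable_funepos mt1 iW; move/integrableP => [_].
  under eq_integral do rewrite gee0_abs ?funepos_ge0//.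
  rewrite (integral_torus_tins i m1); last by move=> x; exact: funepos_ge0.
  have P0 b : (0 <= P b)%E by apply: integral_ge0 => y _; exact: funepos_ge0.
  by under [in X in _ -> X]eq_integral do rewrite gee0_abs//.
have intQ : mu.-integrable circle Q.
  apply/integrableP; split; first by apply: (mp m2) => x; exact: funeneg_ge0.
  have := integrable_funeneg mt1 iW; move/integrableP => [_].
  under eq_integral do rewrite gee0_abs ?funeneg_ge0//.
  rewrite (integral_torus_tins i m2); last by move=> x; exact: funeneg_ge0.
  have Q0 b : (0 <= Q b)%E by apply: integral_ge0 => y _; exact: funeneg_ge0.
  by under [in X in _ -> X]eq_integral do rewrite gee0_abs//.
have E : (\int[lam n.+1]_(x in torus R n.+1) (W x)%:E = \int[mu]_(b in circle) (P b - Q b))%E.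
  rewrite integralE (integral_torus_tins i m1); last by move=> x; exact: funepos_ge0.
  rewrite (integral_torus_tins i m2); last by move=> x; exact: funeneg_ge0.
  by rewrite (integralB mc intP intQ).
have fW : (\int[lam n.+1]_(x in torus R n.+1) (W x)%:E)%E \is a fin_num.
  exact: integrable_fin_num.
rewrite /Rintegral -[X in (X <= _)%E]/(`|(fine _)%:E|)%E fineK// E.
have mPQ : measurable_fun circle (fun b => P b - Q b)%E.
  by apply: emeasurable_funB; [move/integrableP: intP => []|move/integrableP: intQ => []].
apply: (le_trans (le_abse_integral mu mc mPQ)).
rewrite (_ : integral _ _ _ = \int[mu]_(b in circle) `|\int[lam n]_(y in torus R n) (W (tins i b y))%:E|)%E//.
apply: eq_integral => b _; rewrite [in RHS]integralE; congr (`| _ - _ |)%E.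
  by apply: eq_integral => y _; rewrite !funeposE.
by apply: eq_integral => y _; rewrite !funenegE.
Qed.

End Integrable.

Lemma measurable_slice_tconv (u : n.+1.-tuple T -> R) (K : 'I_n -> R -> R) :
  measurable_fun setT u -> (forall l, measurable_fun setT (K l)) ->
  measurable_fun setT (fun z : T * n.-tuple T => tconv (slice u z.1) K z.2).
Proof.
move=> mu' mK; apply: measurable_funM; first exact: measurable_cst.
apply: (measurable_partial_Rintegral (lam n) (f := fun w : (T * n.-tuple T) * n.-tuple T =>
  slice u w.1.1 w.2 * \prod_(l < n) K l (tnth w.1.2 l - tnth w.2 l))).
  exact: measurable_torus.
have m1 : measurable_fun setT (fun w : (T * n.-tuple T) * n.-tuple T => w.1.1).
  exact: (measurableT_comp measurable_fst measurable_fst).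
have m2 : measurable_fun setT (fun w : (T * n.-tuple T) * n.-tuple T => w.1.2).
  exact: (measurableT_comp measurable_snd measurable_fst).
have m3 : measurable_fun setT (fun w : (T * n.-tuple T) * n.-tuple T => w.2).
  exact: measurable_snd.
apply: measurable_funM; first exact: measurable_slice2_real.
apply: measurable_prod => l _; apply: (measurableT_comp (mK l)).
apply: measurable_funB.
  exact: (measurableT_comp (measurable_tnth l) m2).
exact: (measurableT_comp (measurable_tnth l) m3).
Qed.

Lemma tconv_slice (u : n.+1.-tuple T -> R) (K : 'I_n.+1 -> R -> R) s x' b y :
  u (tins i b y) * \prod_j K j (tnth (tins i s x') j - tnth (tins i b y) j) =
  K i (s - b) * (slice u b y * \prod_(l < n) K (lift i l) (tnth x' l - tnth y l)).
Proof.
rewrite (bigD1_ord i)//= !tnth_tins mulrCA; congr (_ * (_ * _)).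
by apply: eq_bigr => l _; rewrite !tnth_tins_lift.
Qed.

End Slicing.

(** * The weak type inequality for real functions *)

Section WeakType.
Variable R : realType.
Local Notation T := (measurableTypeR R).
Local Notation mu := (@lebesgue_measure R).
Local Notation circle := (@circle R : set T).
Local Notation lam := (lebesgue_tuple R).
Context (n : nat) (i : 'I_n.+1) (ga al : R).
Hypotheses (ga1 : 1 <= ga) (al0 : 0 < al).

Definition slice_max (u : n.+1.-tuple T -> R) (b : T) (y : n.-tuple T) : \bar R :=
  msup (riesz_conv ga al (slice i u b)) y.

Lemma measurable_slice_max u : measurable_fun setT u ->
  measurable_fun setT (fun z : T * n.-tuple T => slice_max u z.1 z.2).
Proof.
move=> mu'.
rewrite (_ : (fun _ => _) = msup (fun nu z => riesz_conv ga al (slice i u z.1) nu z.2))//.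
apply: measurable_msup => nu; apply: measurable_slice_tconv => // l.
exact: measurable_cosker.
Qed.

Lemma measurable_slice_max1 u y : measurable_fun setT u ->
  measurable_fun setT (slice_max u ^~ y).
Proof.
move=> mu'; apply: (measurableT_comp (measurable_slice_max mu') (g := fun b => (b, y))).
exact: measurable_pair2.
Qed.

(** For almost every [b], the integral over the other coordinates is a Riesz mean
of the slice at [b], hence at most [slice_max u b y], whatever the parameters; the
remaining kernel in the [i]-th coordinate is bounded by [decay]. *)
Lemma riesz_conv_le_HL_circle : exists2 C : R, 0 < C & forall u : n.+1.-tuple T -> R,
  measurable_fun setT u -> (lam n.+1).-integrable (torus R n.+1) (EFin \o u) ->
  forall y, mu.-integrable circle (slice_max u ^~ y) -> forall s, circle s ->
  (msup (riesz_conv ga al u) (tins i s y) <=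
   C%:E * HL_circle (fun b => fine (slice_max u b y)) s)%E.
Proof.
have ga0 : 0 <= ga by rewrite (le_trans ler01).
have al0' := ltW al0.
have [C1 C10 C1P] := riesz_kernel_bound (ka := 0) ga1 al0 (introT andP (conj (lexx 0) ler01)).
set delta := Num.min al 1 in C1P.
have dl : 0 < delta <= 1 by rewrite lt_min al0 ltr01/= ge_min lexx orbT.
have [A A0 AP] := @decay_integral_le_HL_circle R _ dl.
exists (C1 * A); first exact: mulr_gt0.
move=> u mu' iu y iV s cs.
have mc := @measurable_circleT R; have mt := @measurable_torus R n.
set V := slice_max u ^~ y; pose G b := fine (V b).
have V0 b : (0 <= V b)%E by exact: msup_ge0.
have G0 b : 0 <= G b by rewrite fine_ge0.
have mG : measurable_fun circle G.
  apply: (measurableT_comp (@fine_measurable R setT measurableT)).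
  by move/integrableP : iV => [].
apply: msup_le => [|nu]; first by rewrite mule_ge0 ?HL_circle_ge0// lee_fin mulr_ge0// ltW.
pose K j := cosker (tnth nu j).+1 (riesz ga al 0 (tnth nu j).+1).
pose nu' := [tuple tnth nu (lift i l) | l < n].
pose Nx := \max_(j < n.+1) (tnth nu j).+2.
have NK j x : `|K j x| <= 2 * Nx%:R.
  rewrite (le_trans (cosker_norm_le _ (fun k _ => riesz_seq_le1 _ k ga0 al0')))// mulr1.
  by rewrite ler_wpM2l// ler_nat (@leq_bigmax _ (fun j => (tnth nu j).+2)).
have mK j : measurable_fun setT (K j) by exact: measurable_cosker.
pose x := tins i s y.
pose W z := u z * \prod_j K j (tnth x j - tnth z j).
have mW : measurable_fun setT W.
  by apply: measurable_funM => //; exact: measurable_kernel_prod.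
have iW : (lam n.+1).-integrable (torus R n.+1) (EFin \o W).
  apply: (integrable_mul_bounded iu (measurable_kernel_prod x mK)) => z.
  exact: kernel_prod_le.
have P0 : 0 < (2 * pi : R) ^+ n.+1 by rewrite exprn_gt0// mulr_gt0// pi_gt0.
pose H b := C1 * (G b * decay delta (tnth nu i).+1%:R (s - b)).
have H0 b : 0 <= H b.
  by apply: mulr_ge0; [exact: ltW|apply: mulr_ge0 => //; apply: decay_ge0].
have mD : measurable_fun circle (fun b => (G b * decay delta (tnth nu i).+1%:R (s - b))%:E).
  by apply/measurable_EFinP; apply: measurable_funM => //; exact: measurable_decay.
have D0 b : (0 <= (G b * decay delta (tnth nu i).+1%:R (s - b))%:E)%E.
  by rewrite lee_fin mulr_ge0//; apply: decay_ge0.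
have key : (\int[mu]_(b in circle) `|\int[lam n]_(z in torus R n) (W (tins i b z))%:E| <=
    \int[mu]_(b in circle) (((2 * pi) ^+ n.+1 * H b)%:E))%E.
  apply: ae_ge0_le_integral => //.
  - apply: (@measurable_funS _ _ _ _ setT) => //; apply: measurableT_comp => //.
    apply: (measurable_partial_integral_EFin (lam n)
      (f := fun z : T * n.-tuple T => W (tins i z.1 z.2)) mt).
    exact: (measurableT_comp mW (@measurable_tins R n i)).
  - by move=> b _; rewrite lee_fin; apply: mulr_ge0; [exact: ltW|exact: H0].
  - apply/measurable_EFinP; apply: measurable_funM => //.
    by apply: measurable_funM => //; exact/measurable_EFinP.
  have h1 := ae_slice_integrable i mu' iu.
  have h2 := integrable_ae mc iV.
  near=> b => cb.
  have ib : (lam n).-integrable (torus R n) (EFin \o slice i u b).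
    by move: cb; near: b.
  have Vb : V b = (G b)%:E.
    by rewrite fineK//; move: cb; near: b.
  have mK' l : measurable_fun setT (K (lift i l)) by [].
  have ibK : (lam n).-integrable (torus R n) (EFin \o (fun z => slice i u b z *
      \prod_(l < n) K (lift i l) (tnth y l - tnth z l))).
    apply: (integrable_mul_bounded ib (measurable_kernel_prod y mK')) => z.
    exact: (kernel_prod_le y z (fun l => NK (lift i l))).
  have E : (\int[lam n]_(z in torus R n) (W (tins i b z))%:E =
      (K i (s - b) * \int[lam n]_(z in torus R n) (slice i u b z *
        \prod_(l < n) K (lift i l) (tnth y l - tnth z l)))%:E)%E.
    under eq_integral do rewrite /W tconv_slice EFinM.
    rewrite integralZl// EFinM; congr (_ * _)%E.
    by rewrite /Rintegral fineK//; exact: integrable_fin_num.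
  rewrite E abse_EFin lee_fin normrM.
  have hV : `|riesz_conv ga al (slice i u b) nu' y| <= G b.
    by rewrite -lee_fin -Vb msup_ge.
  have -> : \int[lam n]_(z in torus R n) (slice i u b z *
      \prod_(l < n) K (lift i l) (tnth y l - tnth z l)) =
      (2 * pi) ^+ n * riesz_conv ga al (slice i u b) nu' y.
    rewrite /riesz_conv /tconv mulVKf; last by rewrite gt_eqF// exprn_gt0// mulr_gt0// pi_gt0.
    apply: eq_Rintegral => z _; congr (_ * _); apply: eq_bigr => l _.
    by rewrite tnth_mktuple.
  have hK : `|K i (s - b)| <= C1 * decay delta (tnth nu i).+1%:R (s - b).
    by have := C1P (tnth nu i).+1 (ltn0Sn _) (s - b); rewrite /decay mulrA.
  have p0 : 0 <= (2 * pi : R) ^+ n by rewrite exprn_ge0// mulr_ge0// pi_ge0.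
  rewrite normrM (ger0_norm p0) exprS /H.
  have pp : 1 <= 2 * pi :> R by have := @pi_ge2 R; lra.
  apply: (@le_trans _ _ (C1 * decay delta (tnth nu i).+1%:R (s - b) * ((2 * pi) ^+ n * G b))).
    by apply: ler_pM => //; [apply: mulr_ge0|apply: ler_wpM2l].
  have -> : 2 * pi * (2 * pi) ^+ n * (C1 * (G b * decay delta (tnth nu i).+1%:R (s - b))) =
    (2 * pi) * (C1 * decay delta (tnth nu i).+1%:R (s - b) * ((2 * pi) ^+ n * G b)) by ring.
  apply: ler_peMl => //; apply: mulr_ge0.
    by apply: mulr_ge0; [exact: ltW|exact: decay_ge0].
  by apply: mulr_ge0.
have E1 : (\int[mu]_(b in circle) (((2 * pi) ^+ n.+1 * H b)%:E) =
    ((2 * pi) ^+ n.+1)%:E * (C1%:E * \int[mu]_(b in circle)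
      (G b * decay delta (tnth nu i).+1%:R (s - b))%:E))%E.
  under eq_integral do rewrite EFinM.
  rewrite ge0_integralZl_EFin ?(ltW P0)//; last 2 first.
  - by move=> b _; rewrite lee_fin; exact: H0.
  - by apply/measurable_EFinP; apply: measurable_funM => //; exact/measurable_EFinP.
  congr (_ * _)%E; under eq_integral do rewrite EFinM.
  by rewrite ge0_integralZl_EFin ?(ltW C10).
have h := le_trans (Rintegral_torus_tins_le i mW iW) key.
rewrite E1 in h.
rewrite /riesz_conv /tconv normrM EFinM (ger0_norm (ltW _)) ?invr_gt0//.
rewrite (EFinM C1) -muleA.
have hA := AP G (tnth nu i).+1%:R s mG G0 (ltr0Sn _ _) cs.
apply: (le_trans _ (lee_wpmul2l _ hA)); last by rewrite lee_fin ltW.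
by rewrite lee_pdivrMl.
Unshelve. all: by end_near. Qed.

Lemma indic_comp (S S' : Type) (h : S -> S') (A : set S') s :
  \1_A (h s) = \1_[set s | A (h s)] s :> R.
Proof. by rewrite !indicE. Qed.

(** The maximal inequality is applied on each line parallel to the [i]-th axis,
and [riesz_le_poisson_torus] on almost every slice. *)
Lemma riesz_weak_type : exists2 C : R, 0 < C & forall u : n.+1.-tuple T -> R,
  measurable_fun setT u -> (lam n.+1).-integrable (torus R n.+1) (EFin \o u) ->
  forall rho, 0 < rho ->
  (lam n.+1 (torus R n.+1 `&` [set x | rho%:E < msup (riesz_conv ga al u) x]) <=
   (C / rho)%:E * \int[mu]_(b in circle) \int[lam n]_(y in torus R n)
     msup (pois_conv (slice i u b)) y)%E.
Proof.
have [C1 C10 C1P] := riesz_conv_le_HL_circle.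
have [C2 C20 C2P] := riesz_le_poisson_torus n ga1 al0.
exists (27 * C1 * C2); first by rewrite !mulr_gt0.
move=> u mu' iu rho rho0.
have mc := @measurable_circleT R; have mt := @measurable_torus R n.
have mt1 := @measurable_torus R n.+1.
have mR : measurable_fun setT (msup (riesz_conv ga al u)).
  by apply: measurable_msup => nu; exact: measurable_riesz_conv.
set E := [set x | _].
have mE : measurable E.
  rewrite -[E]setTI; exact: emeasurable_fun_o_infty.
pose chi (x : n.+1.-tuple T) : \bar R := (\1_E x)%:E.
have mchi : measurable_fun setT chi.
  by apply/measurable_EFinP; exact: measurable_indic.
have chi0 x : (0 <= chi x)%E by rewrite lee_fin.
have LE : (lam n.+1 (torus R n.+1 `&` E) = \int[lam n.+1]_(x in torus R n.+1) chi x)%E.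
  by rewrite integral_indic// setIC.
rewrite LE (integral_torus_tins i mchi chi0).
have mchi2 : measurable_fun setT (fun z : T * n.-tuple T => chi (tins i z.1 z.2)).
  exact: (measurableT_comp mchi (@measurable_tins R n i)).
rewrite (integral_torus_swap mchi2 (fun z => chi0 _)).
have mV := measurable_slice_max mu'.
have V0 z : (0 <= slice_max u z.1 z.2)%E by exact: msup_ge0.
have mswap (F : T * n.-tuple T -> \bar R) : measurable_fun setT F -> (forall x, 0 <= F x)%E ->
    measurable_fun (torus R n) (fun y => \int[mu]_(s in circle) F (s, y))%E.
  move=> mF F0; apply: (@measurable_funS _ _ _ _ setT) => //.
  have mF' : measurable_fun setT (fun z : n.-tuple T * T => F (z.2, z.1)).
    apply: (measurableT_comp mF).
    by apply/measurable_fun_pairP; split; [exact: measurable_snd|exact: measurable_fst].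
  have h := measurable_partial_integral mu (f := fun z : n.-tuple T * T => F (z.2, z.1)) mc.
  by have h2 := h mF' (fun z => F0 _); exact: h2.
have mVy := mswap _ mV V0.
apply: (@le_trans _ _ (\int[lam n]_(y in torus R n) ((27 * C1 / rho)%:E *
    \int[mu]_(b in circle) slice_max u b y))%E).
  apply: ge0_le_integral => //.
  - by move=> y _; apply: integral_ge0 => b _; exact: chi0.
  - exact: (mswap _ mchi2 (fun z => chi0 _)).
  - by apply: measurable_funeM; exact: mVy.
  move=> y _; have [Vfin|] := ltP (\int[mu]_(b in circle) slice_max u b y)%E +oo%E; last first.
    by rewrite leye_eq => /eqP ->; rewrite gt0_muley ?leey// lte_fin divr_gt0// mulr_gt0.
  have iV : mu.-integrable circle (slice_max u ^~ y).
    apply/integrableP; split.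
      by apply: (@measurable_funS _ _ _ _ setT) => //; exact: measurable_slice_max1.
    by under eq_integral do rewrite gee0_abs ?msup_ge0//.
  pose G b := fine (slice_max u b y).
  have G0 b : 0 <= G b by rewrite fine_ge0// msup_ge0.
  have iG : mu.-integrable circle (EFin \o G).
    apply: (le_integrable mc _ _ iV).
      apply/measurable_EFinP; apply: (measurableT_comp (@fine_measurable R setT measurableT)).
      by move/integrableP : iV => [].
    by move=> b _; rewrite /= /G; case: (slice_max u b y) => [r| |]//=; rewrite ?normr0 ?leey.
  have GV : (\int[mu]_(b in circle) (G b)%:E = \int[mu]_(b in circle) slice_max u b y)%E.
    apply: ae_eq_integral => //.
    - by move/integrableP : iG => [].
    - by move/integrableP : iV => [].
    - have := integrable_ae mc iV; apply: filterS => b /[apply] h.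
      by rewrite /G fineK.
  have rC : 0 < rho / C1 by exact: divr_gt0.
  have := HL_circle_weak_type iG G0 rC; rewrite GV.
  have -> : 27 / (rho / C1) = 27 * C1 / rho by field; rewrite !gt_eqF.
  apply: le_trans.
  have mEy : measurable [set s | E (tins i s y)].
    rewrite -[X in measurable X]setTI.
    by apply: (measurableT_comp (@measurable_tins R n i) (g := fun s : T => (s, y))).
  have -> : (\int[mu]_(s in circle) chi (tins i s y) = mu (circle `&` [set s | E (tins i s y)]))%E.
    rewrite setIC -(integral_indic mu mc mEy).
    by apply: eq_integral => s _; congr EFin; exact: indic_comp.
  apply: le_measure.
  - by rewrite inE; exact: measurableI.
  - rewrite inE; apply: emeasurable_fun_o_infty => //.
    exact: (measurable_HL_circle iG).
  - move=> s [cs Es]; split => //=.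
    have := C1P u mu' iu y iV s cs; move/(lt_le_trans Es).
    by rewrite -lte_pdivrMl// -EFinM mulrC.
rewrite ge0_integralZl_EFin//; first last.
- by rewrite divr_ge0 ?(ltW rho0)// mulr_ge0// ltW.
- by move=> y _; apply: integral_ge0 => b _; exact: msup_ge0.
rewrite -(integral_torus_swap mV V0).
have -> : 27 * C1 * C2 / rho = 27 * C1 / rho * C2 by ring.
rewrite (EFinM _ C2) -muleA; apply: lee_wpmul2l.
  by rewrite lee_fin divr_ge0 ?(ltW rho0)// mulr_ge0// ltW.
have mS : measurable_fun circle
    (fun b => \int[lam n]_(y in torus R n) msup (pois_conv (slice i u b)) y)%E.
  apply: (@measurable_funS _ _ _ _ setT) => //.
  apply: (measurable_partial_integral (lam n)
    (f := fun z : T * n.-tuple T => msup (pois_conv (slice i u z.1)) z.2) mt).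
    rewrite (_ : (fun _ => _) = msup (fun k z => pois_conv (slice i u z.1) k z.2))//.
    apply: measurable_msup => k; apply: measurable_slice_tconv => // l.
    by apply: measurable_pois; exact: poisson_time_gt0.
  by move=> z; exact: msup_ge0.
have S0 b : (0 <= \int[lam n]_(y in torus R n) msup (pois_conv (slice i u b)) y)%E.
  by apply: integral_ge0 => y _; exact: msup_ge0.
rewrite -ge0_integralZl_EFin ?(ltW C20)//.
pose F1 (b : T) := (\int[lam n]_(y in torus R n) slice_max u b y)%E.
pose F2 (b : T) :=
  (C2%:E * \int[lam n]_(y in torus R n) msup (pois_conv (slice i u b)) y)%E.
have F10 b : circle b -> (0 <= F1 b)%E.
  by move=> _; apply: integral_ge0 => y _; exact: msup_ge0.
have F20 b : circle b -> (0 <= F2 b)%E.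
  by move=> _; apply: mule_ge0; [rewrite lee_fin ltW|exact: S0].
have mF1 : measurable_fun circle F1.
  apply: (@measurable_funS _ _ _ _ setT); [exact: measurableT|by []|].
  exact: (measurable_partial_integral (lam n) mt mV V0).
have mF2 : measurable_fun circle F2 by exact: measurable_funeM.
apply: (ae_ge0_le_integral mc F10 mF1 F20 mF2).
by have := ae_slice_integrable i mu' iu; apply: filterS => b /[apply]; exact: C2P.
Qed.

End WeakType.

(** * Sums over boxes of frequencies *)

Section ComplexSums.
Variable R : realType.
Local Notation C := (complex R).
Local Notation T := (measurableTypeR R).
Local Notation lam := (lebesgue_tuple R).
Local Notation toC := (real_complex R).

Lemma cisD (a b : R) : cis (a + b) = cis a * cis b.
Proof. by apply/eqP; rewrite eq_complex /= cosD sinD; apply/andP; split; apply/eqP; ring. Qed.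

Lemma cis0 : cis (0 : R) = 1.
Proof. by rewrite /cis cos0 sin0. Qed.

Lemma cis_sum I (r : seq I) (F : I -> R) : cis (\sum_(i <- r) F i) = \prod_(i <- r) cis (F i).
Proof.
elim: r => [|i r IH]; first by rewrite !big_nil cis0.
by rewrite !big_cons cisD IH.
Qed.

Lemma cisDN (a : R) : cis a + cis (- a) = toC (2 * cos a).
Proof.
by apply/eqP; rewrite eq_complex /= cosN sinN; apply/andP; split; apply/eqP; ring.
Qed.

(** Explicit enumerations of the ranges of summation, over which sums can be
computed by induction. *)
Definition zrange (N : nat) : seq int := map Posz (iota 0 N.+1) ++ map Negz (iota 0 N).

Lemma zrange_uniq N : uniq (zrange N).
Proof.
rewrite cat_uniq !map_inj_uniq ?iota_uniq//=; [|by move=> ? ? []|by move=> ? ? []].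
by rewrite andbT; apply/hasPn => z /mapP[k _ ->]; apply/mapP => -[].
Qed.

Lemma mem_zrange N (k : int) : (k \in zrange N) = (`|k| <= N)%N.
Proof.
have hN (s : seq nat) j : (Negz j \in map Posz s) = false by apply/negP => /mapP[].
have hP (s : seq nat) j : (Posz j \in map Negz s) = false by apply/negP => /mapP[].
rewrite mem_cat; case: k => k; rewrite ?hN ?hP ?orbF.
  by rewrite mem_map ?mem_iota ?add0n ?ltnS// => ? ? [].
by rewrite (mem_map (f := Negz)) ?mem_iota ?add0n// => ? ? [].
Qed.

Lemma big_zrange N (F : int -> C) :
  \sum_(k <- zrange N) F k = \sum_(k < N.+1) F (Posz k) + \sum_(k < N) F (Negz k).
Proof.
rewrite -(big_mkord xpredT (F \o Posz)) -(big_mkord xpredT (F \o Negz)).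
by rewrite /index_iota !subn0 big_cat !big_map.
Qed.

Lemma sum_zrange_cis N (L : nat -> R) (x : R) :
  \sum_(k <- zrange N) toC (L `|k|%N) * cis (k%:~R * x) = toC (cosker N L x).
Proof.
rewrite big_zrange; elim: N => [|N IH].
  rewrite /cosker !big_ord_recl !big_ord0 !addr0 /mult_of_freq/= !mul0r cis0 cos0.
  by rewrite mulr1 mulr1 mul1r.
rewrite coskerS big_ord_recr [X in _ + X]big_ord_recr /= addrACA IH rmorphD; congr (_ + _).
rewrite -mulrDr NegzE mulrNz mulNr cisDN -rmorphM; congr toC.
by rewrite -[(Posz _)%:~R]/(N.+1%:R); ring.
Qed.

Fixpoint box_seq (d : nat) : d.-tuple nat -> seq (d.-tuple int) :=
  if d is d'.+1 then fun n => [seq [tuple of a :: t] | a : int <- zrange (thead n),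
    t : d'.-tuple int <- box_seq [tuple of behead n]]
  else fun=> [:: [tuple]].

Lemma box_seqS d (n : d.+1.-tuple nat) : box_seq n =
  [seq [tuple of a :: t] | a : int <- zrange (thead n),
    t : d.-tuple int <- box_seq [tuple of behead n]].
Proof. by []. Qed.

Lemma box_seq_uniq d (n : d.-tuple nat) : uniq (box_seq n).
Proof.
elim: d n => [//|d IH] n.
apply: (@allpairs_uniq _ _ _ (fun (a : int) (t : d.-tuple int) => [tuple of a :: t])).
- exact: zrange_uniq.
- exact: IH.
by move=> [a s] [b t] _ _ /= [-> /val_inj ->].
Qed.

Lemma mem_box_seq d (n : d.-tuple nat) k :
  (k \in box_seq n) = [forall j, (`|tnth k j| <= tnth n j)%N].
Proof.
elim: d n k => [|d IH] n k.
  by apply/idP/forallP => [_ [] //|_]; rewrite inE; apply/eqP; exact: (tuple0 k).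
rewrite box_seqS; apply/allpairsP/forallP => [[[a t] /= [ha ht ->]] j|h].
  rewrite mem_zrange in ha; rewrite IH in ht; move/forallP: ht => ht.
  rewrite (tuple_eta n); case: (unliftP ord0 j) => [l ->|->]; first by rewrite !tnthS.
  by rewrite !tnth0.
exists (thead k, [tuple of behead k]) => /=; split.
- by rewrite mem_zrange; have := h ord0; rewrite (tuple_eta n) (tuple_eta k) !tnth0.
- rewrite IH; apply/forallP => l; have := h (lift ord0 l).
  by rewrite [X in tnth X (lift _ _)](tuple_eta k) [X in (_ <= tnth X (lift _ _))%N](tuple_eta n) !tnthS.
- exact: tuple_eta.
Qed.

Lemma sum_box_seq d (n : d.-tuple nat) (F : 'I_d -> int -> C) :
  \sum_(k <- box_seq n) \prod_j F j (tnth k j) =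
  \prod_j \sum_(a <- zrange (tnth n j)) F j a.
Proof.
elim: d n F => [|d IH] n F; first by rewrite big_seq1 !big_ord0.
rewrite box_seqS big_allpairs_dep big_ord_recl mulr_suml; apply: eq_bigr => a _.
have h := IH [tuple of behead n] (fun l => F (lift ord0 l)).
rewrite (eq_bigr (fun l : 'I_d => \sum_(b <- zrange (tnth [tuple of behead n] l)) F (lift ord0 l) b)).
  rewrite -h mulr_sumr; apply: eq_bigr => t _; rewrite big_ord_recl (tnth0 a t).
  by congr (_ * _); apply: eq_bigr => l _; rewrite (tnthS a t).
by move=> l _; rewrite [in LHS](tuple_eta n) (tnthS (thead n) [tuple of behead n]).
Qed.

Lemma fsbig_box d (n : d.-tuple nat) (F : d.-tuple int -> C) :
  \sum_(k \in [set k : d.-tuple int | forall j, (`|tnth k j| <= tnth n j)%N]) F k =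
  \sum_(k <- box_seq n) F k.
Proof.
rewrite (fsbig_seq _ _ (box_seq_uniq n)); apply: eq_fsbigl; apply/seteqP; split=> k /=.
  by move=> h; rewrite mem_box_seq; exact/forallP.
by rewrite mem_box_seq => /forallP.
Qed.

Lemma fsbig_zrange N (F : int -> C) :
  \sum_(k \in [set k : int | (`|k| <= N)%N]) F k = \sum_(k <- zrange N) F k.
Proof.
rewrite (fsbig_seq _ _ (zrange_uniq N)); apply: eq_fsbigl.
by apply/seteqP; split=> k /=; rewrite mem_zrange.
Qed.

End ComplexSums.

(** * Complex Riesz means *)

Section ComplexMeans.
Variable R : realType.
Local Notation C := (complex R).
Local Notation T := (measurableTypeR R).
Local Notation lam := (lebesgue_tuple R).
Local Notation toC := (real_complex R).
Local Notation Re := (@complex.Re R).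
Local Notation Im := (@complex.Im R).
Variable d : nat.
Implicit Types (f F G : d.-tuple T -> C) (z : C).

Let mt : measurable (torus R d). Proof. exact: measurable_torus. Qed.

Lemma ReM (z w : C) : Re (z * w) = Re z * Re w - Im z * Im w.
Proof. by case: z w => [a b] [a' b']. Qed.

Lemma ImM (z w : C) : Im (z * w) = Re z * Im w + Im z * Re w.
Proof. by case: z w => [a b] [a' b']. Qed.

Lemma ReD (z w : C) : Re (z + w) = Re z + Re w.
Proof. by case: z w => [a b] [a' b']. Qed.

Lemma ImD (z w : C) : Im (z + w) = Im z + Im w.
Proof. by case: z w => [a b] [a' b']. Qed.

Lemma real_cintegral (c : R) F (P : d.-tuple T -> R) :
  toC c * cintegral (torus R d) (fun y => F y * toC (P y)) =
  Complex (c * \int[lam d]_(y in torus R d) (Re (F y) * P y))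
          (c * \int[lam d]_(y in torus R d) (Im (F y) * P y)).
Proof.
apply/eqP; rewrite eq_complex; apply/andP; split; apply/eqP.
  rewrite ReM/= mul0r subr0; congr (_ * _); apply: eq_Rintegral => y _.
  by rewrite ReM/= mulr0 subr0.
rewrite ImM/= mul0r addr0; congr (_ * _); apply: eq_Rintegral => y _.
by rewrite ImM/= mulr0 add0r.
Qed.

Lemma L1_torusD F G : L1_torus F -> L1_torus G -> L1_torus (fun x => F x + G x).
Proof.
move=> [F1 F2] [G1 G2]; split.
  under [X in _.-integrable _ X]eq_fun do rewrite ReD.
  exact: (integrableD mt F1 G1).
under [X in _.-integrable _ X]eq_fun do rewrite ImD.
exact: (integrableD mt F2 G2).
Qed.

Lemma L1_torus0 : L1_torus (fun _ : d.-tuple T => 0 : C).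
Proof. by split; exact: integrable0. Qed.

Lemma cintegralD F G : L1_torus F -> L1_torus G ->
  cintegral (torus R d) (fun x => F x + G x) =
  cintegral (torus R d) F + cintegral (torus R d) G.
Proof.
move=> [F1 F2] [G1 G2]; rewrite /cintegral.
under eq_Rintegral do rewrite ReD.
under [X in Complex _ X]eq_Rintegral do rewrite ImD.
by rewrite !RintegralD.
Qed.

Lemma cintegral_sum I (r : seq I) (F : I -> d.-tuple T -> C) :
  (forall k, L1_torus (F k)) ->
  cintegral (torus R d) (fun x => \sum_(k <- r) F k x) =
  \sum_(k <- r) cintegral (torus R d) (F k).
Proof.
move=> LF; elim: r => [|k r IH].
  rewrite big_nil /cintegral; under eq_Rintegral do rewrite big_nil.
  under [X in Complex _ X]eq_Rintegral do rewrite big_nil.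
  by rewrite !Rintegral_cst//= !mul0r.
rewrite big_cons -IH -cintegralD//.
  by congr cintegral; apply/funext => x; rewrite big_cons.
elim: r {IH} => [|l r IH].
  under [X in L1_torus X]eq_fun do rewrite big_nil.
  exact: L1_torus0.
under [X in L1_torus X]eq_fun do rewrite big_cons.
exact: L1_torusD.
Qed.

Lemma cintegralZr F z : L1_torus F ->
  cintegral (torus R d) (fun x => F x * z) = cintegral (torus R d) F * z.
Proof.
move=> [F1 F2]; rewrite /cintegral; apply/eqP; rewrite eq_complex; apply/andP; split; apply/eqP.
  rewrite ReM/= -!RintegralZr// -RintegralB//.
  - by apply: eq_Rintegral => x _; rewrite ReM.
  - by under [X in _.-integrable _ X]eq_fun do rewrite EFinM muleC; exact: integrableZl.
  - by under [X in _.-integrable _ X]eq_fun do rewrite EFinM muleC; exact: integrableZl.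
rewrite ImM/= -!RintegralZr// -RintegralD//.
- by apply: eq_Rintegral => x _; rewrite ImM.
- by under [X in _.-integrable _ X]eq_fun do rewrite EFinM muleC; exact: integrableZl.
- by under [X in _.-integrable _ X]eq_fun do rewrite EFinM muleC; exact: integrableZl.
Qed.

Lemma L1_torus_cis f (th : d.-tuple T -> R) (z : C) :
  L1_torus f -> measurable_fun setT th -> L1_torus (fun x => f x * (z * cis (th x))).
Proof.
move=> [f1 f2] mth.
have mc : measurable_fun setT (cos \o th).
  apply: measurableT_comp => //; apply: continuous_measurable_fun; exact: continuous_cos.
have ms : measurable_fun setT (sin \o th).
  apply: measurableT_comp => //; apply: continuous_measurable_fun; exact: continuous_sin.
have mre : measurable_fun setT (fun x => Re (z * cis (th x))).
  under eq_fun do rewrite ReM.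
  by apply: measurable_funB; apply: measurable_funM => //; exact: measurable_cst.
have mim : measurable_fun setT (fun x => Im (z * cis (th x))).
  under eq_fun do rewrite ImM.
  by apply: measurable_funD; apply: measurable_funM => //; exact: measurable_cst.
have bre x : `|Re (z * cis (th x))| <= `|Re z| + `|Im z|.
  rewrite ReM/= (le_trans (ler_normB _ _))// !normrM lerD//.
    by rewrite ler_piMr// cos_max.
  by rewrite ler_piMr// sin_max.
have bim x : `|Im (z * cis (th x))| <= `|Re z| + `|Im z|.
  rewrite ImM/= (le_trans (ler_normD _ _))// !normrM lerD//.
    by rewrite ler_piMr// sin_max.
  by rewrite ler_piMr// cos_max.
have i1 := integrable_mul_bounded f1 mre bre.
have i2 := integrable_mul_bounded f2 mim bim.
have i3 := integrable_mul_bounded f1 mim bim.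
have i4 := integrable_mul_bounded f2 mre bre.
split.
  under [X in _.-integrable _ X]eq_fun do rewrite ReM.
  exact: (integrableB mt i1 i2).
under [X in _.-integrable _ X]eq_fun do rewrite ImM.
exact: (integrableD mt i3 i4).
Qed.

Lemma measurable_dot (k : d.-tuple int) : measurable_fun setT (dot (R := R) k).
Proof.
apply: measurable_sum => j; apply: measurable_funM; first exact: measurable_cst.
exact: measurable_tnth.
Qed.

(** The multiplier being even in each frequency, the kernel is a product of real
cosine sums. *)
Lemma riesz_mean_conv (ga al : R) f (n : d.-tuple nat) x : L1_torus f ->
  let K j := cosker (tnth n j)
    (fun k => (1 - (k%:R / (tnth n j)%:R) `^ ga) `^ al) in
  riesz_mean ga al n f x = Complex (tconv (Re \o f) K x) (tconv (Im \o f) K x).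
Proof.
move=> Lf K; rewrite /riesz_mean fsbig_box.
pose a (k : d.-tuple int) : R := \prod_(j < d)
  (1 - (`|tnth k j|%N%:R / (tnth n j)%:R) `^ ga) `^ al.
have E k : toC (a k) * fourier f k * cis (dot k x) =
    toC ((2 * pi) ^- d) * cintegral (torus R d)
      (fun y => f y * (toC (a k) * cis (dot k x) * cis (- dot k y))).
  have -> : (fun y => f y * (toC (a k) * cis (dot k x) * cis (- dot k y))) =
      (fun y => f y * (1 * cis (- dot k y)) * (toC (a k) * cis (dot k x))).
    by apply/funext => y; rewrite mul1r; ring.
  rewrite cintegralZr; last first.
    by apply: L1_torus_cis => //; apply: measurableT_comp => //; exact: measurable_dot.
  rewrite /fourier; under [in RHS]eq_fun do rewrite mul1r.
  by ring.
rewrite (eq_bigr _ (fun k _ => E k)) -mulr_sumr -cintegral_sum; last first.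
  move=> k; apply: L1_torus_cis => //; apply: measurableT_comp => //.
  exact: measurable_dot.
have -> : (fun y => \sum_(k <- box_seq n)
      f y * (toC (a k) * cis (dot k x) * cis (- dot k y))) =
    (fun y => f y * toC (\prod_(j < d) K j (tnth x j - tnth y j))).
  apply/funext => y; rewrite -mulr_sumr; congr (_ * _).
  pose F (j : 'I_d) (k : int) := toC ((1 - (`|k|%N%:R / (tnth n j)%:R) `^ ga) `^ al) *
    cis (k%:~R * (tnth x j - tnth y j)).
  rewrite rmorph_prod (eq_bigr (fun j => \sum_(k <- zrange (tnth n j)) F j k)); last first.
    by move=> j _; exact/esym/sum_zrange_cis.
  rewrite -sum_box_seq; apply: eq_bigr => k _.
  rewrite big_split/= -cis_sum /a rmorph_prod -mulrA -cisD; congr (_ * cis _).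
  by rewrite /dot -sumrB; apply: eq_bigr => j _; rewrite mulrBr.
by rewrite real_cintegral.
Qed.

End ComplexMeans.

(** * Poisson means and the Hardy norm *)

Section PoissonMeans.
Variable R : realType.
Local Notation C := (complex R).
Local Notation T := (measurableTypeR R).
Local Notation lam := (lebesgue_tuple R).
Local Notation toC := (real_complex R).
Local Notation Re := (@complex.Re R).
Local Notation Im := (@complex.Im R).
Local Notation normc := (@ComplexField.Normc.normc R).

Lemma cvg_real_complex (u : nat -> R) (l : R) : u @ \oo --> l ->
  (fun N => toC (u N) : C^o) @ \oo --> (toC l : C^o).
Proof.
move=> /cvgrPdist_lt h; apply/cvgrPdist_lt => e e0.
have [e' e'0 ->] : exists2 e', 0 < e' & e = toC e'.
  by case: e e0 => [a b]; rewrite ltcE/= => /andP[/eqP -> a0]; exists a.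
have := h e' e'0; apply: filterS => N.
by rewrite -rmorphB normc_def/= expr0n/= addr0 sqrtr_sqr ltcR.
Qed.

Lemma poissonE (t x : R) : 0 < t -> poisson t x = toC (pois t x).
Proof.
move=> t0; rewrite /poisson.
rewrite (_ : (fun N : nat => _) = (fun N => toC (cosker N (fun k => expR (- t * k%:R)) x) : C^o)).
  have h := cvg_real_complex (@pois_cvg R t x t0).
  exact: (cvg_lim (@norm_hausdorff _ C^o) h).
by apply/funext => N; rewrite fsbig_zrange -sum_zrange_cis.
Qed.

Lemma poisson_conv_tins n (i : 'I_n.+1) (t : 'I_n -> R) (f : n.+1.-tuple T -> C) s y :
  (forall l, 0 < t l) ->
  poisson_conv i t f (tins i s y) =
  Complex (tconv (slice i (Re \o f) s) (fun l => pois (t l)) y)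
          (tconv (slice i (Im \o f) s) (fun l => pois (t l)) y).
Proof.
move=> t0; rewrite /tconv -real_cintegral; congr (_ * cintegral _ _).
apply/funext => z; congr (_ * _).
  by congr f; apply: eq_from_tnth => j; rewrite !tnth_mktuple unlift_none.
rewrite rmorph_prod; apply: eq_bigr => l _.
by rewrite poissonE// tnth_tins_lift.
Qed.

Lemma normc_ge_Re (z : C) : `|Re z| <= normc z.
Proof. by case: z => a b /=; rewrite -sqrtr_sqr ler_sqrt ?addr_ge0 ?sqr_ge0// lerDl sqr_ge0. Qed.

Lemma normc_ge_Im (z : C) : `|Im z| <= normc z.
Proof. by case: z => a b /=; rewrite -sqrtr_sqr ler_sqrt ?addr_ge0 ?sqr_ge0// lerDr sqr_ge0. Qed.

Lemma normc_ge0 (z : C) : 0 <= normc z.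
Proof. exact: le_trans (normr_ge0 _) (normc_ge_Re z). Qed.

Lemma normc_le_ReIm (z : C) : normc z <= `|Re z| + `|Im z|.
Proof.
case: z => a b /=; rewrite -[leRHS]ger0_norm ?addr_ge0// -sqrtr_sqr ler_sqrt ?sqr_ge0//.
rewrite sqrrD !real_normK ?num_real// addrAC lerDl mulrn_wge0// mulr_ge0//.
Qed.

(** The simple functions below [f] are below [g], however irregular [g] is. This
allows a comparison with the supremum over all positive times that defines the
Hardy norm. *)
Lemma integral_le_nonmeasurable d (S : measurableType d) (m : {measure set S -> \bar R})
    (D : set S) (f g : S -> \bar R) :
  (forall x, D x -> (0 <= f x)%E) -> (forall x, D x -> (f x <= g x)%E) ->
  (\int[m]_(x in D) f x <= \int[m]_(x in D) g x)%E.
Proof.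
move=> f0 fg.
have g0 x : D x -> (0 <= g x)%E by move=> Dx; exact: le_trans (f0 x Dx) (fg x Dx).
rewrite integral_mkcond [leRHS]integral_mkcond.
rewrite !ge0_integralTE; [|exact: erestrict_ge0..].
apply: le_ereal_sup => z /= [h hf <-]; exists h => // x; apply: (le_trans (hf x)).
by rewrite !patchE; case: ifPn => // /set_mem; exact: fg.
Qed.

Lemma measure_le_setU d (S : measurableType d) (m : {measure set S -> \bar R})
    (E A B : set S) : measurable E -> measurable A -> measurable B ->
  E `<=` A `|` B -> (m E <= m A + m B)%E.
Proof.
move=> mE mA mB EAB; apply: (@le_trans _ _ (m (A `|` B))); last exact: measureU2.
by apply: le_measure; rewrite ?inE//; exact: measurableU.
Qed.

Section Final.
Context (n : nat) (i : 'I_n.+1) (ga al : R).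
Hypotheses (ga1 : 1 <= ga) (al0 : 0 < al).

Lemma riesz_mean_succ (f : n.+1.-tuple T -> C) (nu : n.+1.-tuple nat) x : L1_torus f ->
  riesz_mean ga al [tuple (tnth nu j).+1 | j < n.+1] f x =
  Complex (riesz_conv ga al (Re \o f) nu x) (riesz_conv ga al (Im \o f) nu x).
Proof.
move=> Lf; rewrite riesz_mean_conv//.
set K := fun j => _; have -> : K = fun j => cosker (tnth nu j).+1 (riesz ga al 0 (tnth nu j).+1).
  apply/funext => j; apply/funext => s; rewrite /K tnth_mktuple.
  by apply: cosker_eq => k kN; rewrite /riesz kN /riesz_profile mul0r expR0 mulr1.
by [].
Qed.

Lemma riesz_maxE (f : n.+1.-tuple T -> C) x : L1_torus f ->
  riesz_max ga al f x = msup (fun nu x =>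
    normc (Complex (riesz_conv ga al (Re \o f) nu x) (riesz_conv ga al (Im \o f) nu x))) x.
Proof.
move=> Lf; apply/le_anti/andP; split.
  apply: ge_ereal_sup => z /= [k k1 <-].
  pose nu := [tuple (tnth k j).-1 | j < n.+1].
  have -> : k = [tuple (tnth nu j).+1 | j < n.+1].
    by apply: eq_from_tnth => j; rewrite !tnth_mktuple prednK// k1.
  rewrite riesz_mean_succ//.
  apply: le_trans (msup_ge _ nu x); rewrite lee_fin.
  by rewrite ger0_norm//; exact: normc_ge0.
apply: msup_le => [|nu].
  apply: (@le_trans _ _ (normc (riesz_mean ga al [tuple 1%N | j < n.+1] f x))%:E).
    by rewrite lee_fin; exact: normc_ge0.
  by apply: ereal_sup_ubound; exists [tuple 1%N | j < n.+1] => //= j; rewrite tnth_mktuple.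
rewrite -riesz_mean_succ// ger0_norm; last exact: normc_ge0.
apply: ereal_sup_ubound; exists [tuple (tnth nu j).+1 | j < n.+1] => //= j.
by rewrite tnth_mktuple.
Qed.

(** The maximal Poisson mean over the countable family of times that occurs in
[riesz_weak_type], as a function of the whole point. *)
Definition slice_pois (u : n.+1.-tuple T -> R) (x : n.+1.-tuple T) : \bar R :=
  msup (fun k (z : n.+1.-tuple T) =>
    pois_conv (slice i u (tnth z i)) k [tuple tnth z (lift i l) | l < n]) x.

Lemma slice_pois_tins u s y :
  slice_pois u (tins i s y) = msup (pois_conv (slice i u s)) y.
Proof.
have E : [tuple tnth (tins i s y) (lift i l) | l < n] = y.
  by apply: eq_from_tnth => l; rewrite tnth_mktuple tnth_tins_lift.
by apply/le_anti/andP; split; apply: (@msup_reindex _ _ _ _ _ _ _ id) => k; rewrite E tnth_tins.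
Qed.

Lemma measurable_slice_pois u : measurable_fun setT u -> measurable_fun setT (slice_pois u).
Proof.
move=> mu'; apply: measurable_msup => k.
have mK l : measurable_fun setT (pois (poisson_time R k l)).
  by apply: measurable_pois; exact: poisson_time_gt0.
apply: (measurableT_comp (measurable_slice_tconv i mu' mK)
  (g := fun z : n.+1.-tuple T => (tnth z i, [tuple tnth z (lift i l) | l < n]))).
apply/measurable_fun_pairP; split; first exact: measurable_tnth.
apply/measurable_fun_tnthP => l.
rewrite (_ : _ \o _ = (fun z : n.+1.-tuple T => tnth z (lift i l))).
  exact: measurable_tnth.
by apply/funext => z /=; rewrite tnth_mktuple.
Qed.

Lemma tconv_eq m (g g' : m.-tuple T -> R) K x :
  (forall y, torus R m y -> g y = g' y) -> tconv g K x = tconv g' K x.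
Proof.
move=> h; congr (_ * _); apply: eq_Rintegral => y; rewrite inE => ty.
by rewrite h.
Qed.

(** Common to the real and the imaginary part: all that matters about [part] is
that it is dominated by the modulus and commutes with Poisson means. Outside the
torus the function is replaced by [0], which makes it measurable. *)
Lemma component_weak_type : exists2 C0 : R, 0 < C0 &
  forall (f : n.+1.-tuple T -> C) (part : C -> R) (rho : R),
  (forall z, `|part z| <= normc z) -> 
  (forall t s y, (forall l, 0 < t l) -> part (poisson_conv i t f (tins i s y)) =
    tconv (slice i (part \o f) s) (fun l => pois (t l)) y) ->
  (lam n.+1).-integrable (torus R n.+1) (EFin \o (part \o f)) -> 0 < rho ->
  (lam n.+1 (torus R n.+1 `&` [set x | rho%:E < msup (riesz_conv ga al (part \o f)) x]) <=
   (C0 / rho)%:E * hardy_norm i f)%E.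
Proof.
have [C0 C00 C0P] := riesz_weak_type i ga1 al0.
exists C0 => // f part rho partN partP ipf rho0.
pose u := (part \o f) \_ (torus R n.+1).
have mt1 := @measurable_torus R n.+1.
have mu' : measurable_fun setT u.
  apply/(measurable_restrictT _ mt1); move/integrableP : ipf => [/measurable_EFinP].
  by [].
have uE x : torus R n.+1 x -> part (f x) = u x.
  by move=> tx; rewrite /u patchE mem_set.
have iu : (lam n.+1).-integrable (torus R n.+1) (EFin \o u).
  apply: (eq_integrable mt1 _ _ _ ipf) => x; rewrite inE => tx /=.
  by rewrite uE.
have -> : riesz_conv ga al (part \o f) = riesz_conv ga al u.
  by apply/funext => nu; apply/funext => x; apply: tconv_eq => y /uE.
apply: (le_trans (C0P u mu' iu rho rho0)); apply: lee_wpmul2l.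
  by rewrite lee_fin divr_ge0 ?ltW.
have mS := measurable_slice_pois mu'.
have S0 x : (0 <= slice_pois u x)%E by exact: msup_ge0.
rewrite [leLHS](_ : _ = \int[lam n.+1]_(x in torus R n.+1) slice_pois u x)%E; last first.
  rewrite (integral_torus_tins i mS S0).
  by apply: eq_integral => s _; apply: eq_integral => y _; rewrite slice_pois_tins.
apply: integral_le_nonmeasurable => // x tx.
have H0 : (0 <= ereal_sup [set (normc (poisson_conv i t f x))%:E |
               t in [set t : 'I_n -> R | forall l, (0 < t l)%R]])%E.
  apply: (@le_trans _ _ (normc (poisson_conv i (fun=> 1) f x))%:E).
    by rewrite lee_fin; exact: normc_ge0.
  by apply: ereal_sup_ubound; exists (fun=> 1) => // l; exact: ltr01.
apply: msup_le => // k.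
set s := tnth x i; set y := [tuple tnth x (lift i l) | l < n].
have xE : x = tins i s y.
  apply: eq_from_tnth => j; case: (unliftP i j) => [l ->|->].
    by rewrite tnth_tins_lift tnth_mktuple.
  by rewrite tnth_tins.
have [cs _] : @circle R s /\ torus R n y by apply/(torus_tins i); rewrite -xE.
have -> : pois_conv (slice i u s) k y = part (poisson_conv i (poisson_time R k) f x).
  rewrite xE partP; last by move=> l; exact: poisson_time_gt0.
  apply: tconv_eq => z tz; rewrite /slice /=; apply/esym; apply: uE.
  exact/torus_tins.
apply: (@le_trans _ _ (normc (poisson_conv i (poisson_time R k) f x))%:E).
  by rewrite lee_fin; exact: partN.
by apply: ereal_sup_ubound; exists (poisson_time R k) => // l; exact: poisson_time_gt0.
Qed.

(** Where the maximal mean exceeds [rho], that of the real or that of the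
imaginary part exceeds [rho / 2]. *)
Lemma riesz_max_weak_type : exists2 C0 : R, 0 < C0 &
  forall f : n.+1.-tuple T -> C, hardy i f -> forall rho, 0 < rho ->
  (rho%:E * lam n.+1 (torus R n.+1 `&` [set x | rho%:E < riesz_max ga al f x]) <=
   C0%:E * hardy_norm i f)%E.
Proof.
have [C0 C00 C0P] := component_weak_type.
exists (4 * C0); first by rewrite mulr_gt0.
move=> f [Lf _] rho rho0; have [f1 f2] := Lf.
have mt1 := @measurable_torus R n.+1.
have r2 : 0 < rho / 2 by rewrite divr_gt0.
have h1 := C0P f Re (rho / 2) normc_ge_Re
  (fun t s y t0 => congr1 Re (poisson_conv_tins i f s y t0)) f1 r2.
have h2 := C0P f Im (rho / 2) normc_ge_Im
  (fun t s y t0 => congr1 Im (poisson_conv_tins i f s y t0)) f2 r2.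
set A := (X in (lam n.+1 X <= _)%E) in h1; set B := (X in (lam n.+1 X <= _)%E) in h2.
set E := (X in lam n.+1 X).
have mcv nu : measurable_fun setT (riesz_conv ga al (Re \o f) nu).
  exact: measurable_riesz_conv.
have mcv2 nu : measurable_fun setT (riesz_conv ga al (Im \o f) nu).
  exact: measurable_riesz_conv.
have mset (F : n.+1.-tuple T -> \bar R) (r : \bar R) : measurable_fun setT F ->
    measurable (torus R n.+1 `&` [set x | (r < F x)%E]).
  move=> mF; apply: emeasurable_fun_o_infty => //.
  exact: (@measurable_funS _ _ _ _ setT).
have mA : measurable A by apply: mset; exact: measurable_msup.
have mB : measurable B by apply: mset; exact: measurable_msup.
have mE : measurable E.
  apply: mset; rewrite (_ : riesz_max ga al f = msup (fun nu x =>
    normc (Complex (riesz_conv ga al (Re \o f) nu x) (riesz_conv ga al (Im \o f) nu x)))).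
    apply: measurable_msup => nu /=; apply: measurableT_comp.
      by apply: continuous_measurable_fun; exact: sqrt_continuous.
    by apply: measurable_funD; apply: measurable_funX.
  by apply/funext => x; exact: riesz_maxE.
have EAB : E `<=` A `|` B.
  move=> x [tx]; rewrite /= riesz_maxE// => hx; apply: contrapT => nAB.
  have [nA nB] : ~ A x /\ ~ B x by split=> ?; apply: nAB; [left|right].
  have hA : (msup (riesz_conv ga al (Re \o f)) x <= (rho / 2)%:E)%E.
    by rewrite leNgt; apply/negP => h; apply: nA.
  have hB : (msup (riesz_conv ga al (Im \o f)) x <= (rho / 2)%:E)%E.
    by rewrite leNgt; apply/negP => h; apply: nB.
  move: hx; rewrite ltNge => /negP; apply; apply: msup_le => [|nu].
    by rewrite lee_fin ltW.
  rewrite lee_fin ger0_norm; last exact: normc_ge0.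
  apply: (le_trans (normc_le_ReIm _)) => /=.
  have := le_trans (msup_ge _ nu x) hA; have := le_trans (msup_ge _ nu x) hB.
  rewrite !lee_fin; lra.
have hE : (lam n.+1 E <= (2 * (C0 / (rho / 2)))%:E * hardy_norm i f)%E.
  apply: (le_trans (measure_le_setU (lam n.+1) mE mA mB EAB)).
  have -> : 2 * (C0 / (rho / 2)) = C0 / (rho / 2) + C0 / (rho / 2) by ring.
  have Cr : (0 <= (C0 / (rho / 2))%:E)%E by rewrite lee_fin divr_ge0 ?(ltW C00) ?(ltW r2).
  rewrite EFinD (ge0_muleDl _ Cr Cr).
  exact: (leeD h1 h2).
have := lee_wpmul2l (x := rho%:E) _ hE; rewrite lee_fin (ltW rho0) => /(_ isT).
rewrite muleA -EFinM.
by have -> : rho * (2 * (C0 / (rho / 2))) = 4 * C0 by field; rewrite gt_eqF.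
Qed.

End Final.
End PoissonMeans.

Theorem corollary16p4 (R : realType) (gamma : R) (hgamma : 1 <= gamma)
    (d : nat) (hd : (2 <= d)%N) (alpha : R) (halpha : 0 < alpha) (i : 'I_d) :
  exists C : R, forall f : d.-tuple (measurableTypeR R) -> complex R,
    hardy i f ->
    (ereal_sup
       [set rho%:E * lebesgue_tuple R d
          (torus R d `&` [set x | (rho%:E < riesz_max gamma alpha f x)%E])
        | rho in [set rho : R | (0 < rho)%R]]
     <= C%:E * hardy_norm i f)%E.
Proof.
case: d hd i => [//|n] _ i.
have [C _ CP] := riesz_max_weak_type i hgamma halpha.
exists C => f hf; apply: ge_ereal_sup => z /= [rho rho0 <-].
exact: CP.
Qed.
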